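(* Assume the setting below, with (A) there is $p_0>1$ with $\liminf_{i\to\infty}\frac{a_i}{\theta_i}\frac{\Delta_i^{(p_0)}}{i^{p_0}}>0$, and (K) there are $\kappa>0$, $\alpha\in(0,1)$ with $k_{i,j}\le\kappa((1+\theta_i)^\alpha+(1+\theta_j)^\alpha)$ for all $i,j\ge1$. Let $p>1$. Then for each $f_0\in X_{p,\alpha}^+$ there is $T=T(f_0)>0$ such that the problem $$\frac{df_i}{dt}=g_{i-1}f_{i-1}-g_if_i+d_{i+1}f_{i+1}-d_if_i-s_if_i-a_if_i+\sum_{j=i+1}^\infty a_jb_{i,j}f_j+\frac12\sum_{j=1}^{i-1}k_{i-j,j}f_{i-j}f_j-\sum_{j=1}^\infty k_{i,j}f_if_j,\quad f_i(0)=f_{0,i},$$ has a unique non-negative classical solution $f\in C([0,T],X_{p,\alpha})\cap C^1((0,T),X_p)\cap C((0,T),X_{p,1})$.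
   Context: Setting: $(g_i),(d_i),(s_i),(a_i)$ nonnegative sequences, $(b_{i,j}),(k_{i,j})$ nonnegative arrays, $a_1=0$, $a_i>0$ ($i\ge2$), $b_{i,j}=0$ for $i\ge j$, $\sum_{i=1}^{j-1}ib_{i,j}=j$ ($j\ge2$); $g_0=0$ and the index-$0$ term vanishes; $\theta_i=a_i+g_i+d_i+s_i$; $\Delta_i^{(p)}=i^p-\sum_{j=1}^{i-1}j^pb_{j,i}$. $X_p$: sequences with $\|f\|_p=\sum_{i\ge1}i^p|f_i|<\infty$; $X_{p,\beta}$ ($0<\beta\le1$): sequences with $\|f\|_{p,\beta}=\sum i^p(1+\theta_i)^\beta|f_i|<\infty$; $U^+$: nonnegative elements of $U$. Let $[Y_pf]_i=-\theta_if_i+g_{i-1}f_{i-1}+d_{i+1}f_{i+1}+\sum_{j>i}a_jb_{i,j}f_j$ (domain $X_{p,1}$) and $F(f)_i=\frac12\sum_{j=1}^{i-1}k_{i-j,j}f_{i-j}f_j-\sum_jk_{i,j}f_if_j$. A classical solution on $[0,T]$ is $f\in C([0,T],X_{p,\alpha})\cap C^1((0,T),X_p)$ with $f(t)\in X_{p,1}$ for $t\in(0,T)$, $f'(t)=Y_pf(t)+F(f(t))$ in $X_p$ for $t\in(0,T)$, and $f(0)=f_0$. *)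

(* Defs.v *)
From Stdlib Require Import Reals Lra.
From Coquelicot Require Import Coquelicot.
Open Scope R_scope.

(* Sequences f = (f_i)_{i>=1} are represented as functions nat -> R;
   the component at index 0 is ignored everywhere (norms, equations). *)

Definition theta (a g d s : nat -> R) (i : nat) : R := a i + g i + d i + s i.

Definition wp (p : R) (i : nat) : R := Rpower (INR i) p.
Definition wpb (a g d s : nat -> R) (p beta : R) (i : nat) : R :=
  Rpower (INR i) p * Rpower (1 + theta a g d s i) beta.

Definition wnorm (w : nat -> R) (f : nat -> R) : R :=
  Series (fun n => w (S n) * Rabs (f (S n))).
Definition inX (w : nat -> R) (f : nat -> R) : Prop :=
  ex_series (fun n => w (S n) * Rabs (f (S n))).

Definition DeltaP (b : nat -> nat -> R) (p : R) (i : nat) : R :=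
  Rpower (INR i) p - sum_n_m (fun j => Rpower (INR j) p * b j i) 1 (i - 1).

Definition Yop (a g d s : nat -> R) (b : nat -> nat -> R) (f : nat -> R) (i : nat) : R :=
  - theta a g d s i * f i + g (i - 1)%nat * f (i - 1)%nat + d (S i) * f (S i)
  + Series (fun n => a (i + 1 + n)%nat * b i (i + 1 + n)%nat * f (i + 1 + n)%nat).

Definition Fop (k : nat -> nat -> R) (f : nat -> R) (i : nat) : R :=
  / 2 * sum_n_m (fun j => k (i - j)%nat j * f (i - j)%nat * f j) 1 (i - 1)
  - Series (fun n => k i (S n) * f i * f (S n)).

Definition cont_on (P : R -> Prop) (w : nat -> R) (f : R -> nat -> R) : Prop :=
  forall t, P t -> forall eps, 0 < eps -> exists delta, 0 < delta /\
    forall u, P u -> Rabs (u - t) < delta -> wnorm w (fun i => f u i - f t i) < eps.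

Definition deriv_on (P : R -> Prop) (w : nat -> R) (f f' : R -> nat -> R) : Prop :=
  forall t, P t -> forall eps, 0 < eps -> exists delta, 0 < delta /\
    forall u, P u -> u <> t -> Rabs (u - t) < delta ->
      wnorm w (fun i => (f u i - f t i) / (u - t) - f' t i) < eps.

Definition classical_solution (a g d s : nat -> R) (b k : nat -> nat -> R)
  (p alpha T : R) (f0 : nat -> R) (f : R -> nat -> R) : Prop :=
  (forall t, 0 <= t <= T -> inX (wpb a g d s p alpha) (f t)) /\
  cont_on (fun t => 0 <= t <= T) (wpb a g d s p alpha) f /\
  (exists f' : R -> nat -> R,
     (forall t, 0 < t < T -> inX (wp p) (f' t)) /\
     deriv_on (fun t => 0 < t < T) (wp p) f f' /\
     cont_on (fun t => 0 < t < T) (wp p) f' /\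
     (forall t, 0 < t < T ->
        inX (wpb a g d s p 1) (f t) /\
        (forall i, (1 <= i)%nat ->
           ex_series (fun n => a (i + 1 + n)%nat * b i (i + 1 + n)%nat * f t (i + 1 + n)%nat) /\
           ex_series (fun n => k i (S n) * f t i * f t (S n)) /\
           f' t i = Yop a g d s b (f t) i + Fop k (f t) i))) /\
  (forall i, (1 <= i)%nat -> f 0 i = f0 i).

Definition nonneg_on (T : R) (f : R -> nat -> R) : Prop :=
  forall t, 0 <= t <= T -> forall i, (1 <= i)%nat -> 0 <= f t i.

(* Main.v *)
(* Write the equation as x' = (B - D) x + G(x) with a nonnegative matrix B, where
   D = theta + gam (1 + theta)^alpha absorbs the loss term of the coagulation, so
   that G maps nonnegative sequences of a ball to nonnegative ones. By assumption
   (A), transferred from p0 to p by convexity of the exponential, the weighted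
   columns of B are dominated by those of D - c (1 + theta). The exponentials of the
   finite sections of B - D therefore increase to a limit S(t) whose time integral
   gains the full weight 1 + theta; interpolating with the trivial bound gains
   (1 + theta)^alpha with a factor that is small for small time. Since all these
   bounds come from majorants independent of time, Picard iteration converges in
   the norm sum_i w_i sup_t |x_i(t)|, where w is the weight of X_{p,alpha}, and the
   limit is regular because t S(t) and the integrated kernels are dominated in the
   weight of X_{p,1}. For uniqueness, the difference of two solutions satisfies a
   left Dini differential inequality in the norm of X_p: the dissipation
   c (1 + theta) absorbs the weight (1 + theta)^alpha of the nonlinearity. *)

(* The choice of constants is nearly circular: the shift [gam] must dominate the coagulation loss on
   the ball of radius [R0], [R0] depends on bounds for the semigroup, and the semigroup depends on
   [gam]. The way out is that the bounds entering [R0] involve only the dissipation rate [c] and the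
   column bound [CB] of the gain matrix; a larger [gam] merely strengthens the diagonal loss. So
   [R0] is fixed first, then [gam], and only the length [T] of the time interval depends on the
   resulting Lipschitz constant. A second shift [om] repairs the finitely many small cluster sizes
   about which (A), a statement at infinity, says nothing. Majorants common to all times replace
   calculus with values in a Banach space: estimates are made coordinate by coordinate, and
   dominated convergence turns coordinatewise continuity into continuity in norm. The semigroup is
   never differentiated in the sequence space. Only its integrated equation passes to the limit of
   the finite sections, and the solution is differentiated at the very end through means over short
   time intervals. *)
Require Import Defs.
From Stdlib Require Import Reals Lra Lia Arith ClassicalEpsilon.
From Coquelicot Require Import Coquelicot.
Open Scope R_scope.

(** * Weighted sums and series *)

Notation sm := sum_f_R0.

Lemma sm_le (a b : nat -> R) N :
  (forall n, (n <= N)%nat -> a n <= b n) -> sm a N <= sm b N.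
Proof. exact (sum_Rle a b N). Qed.

Lemma sm_ext (a b : nat -> R) N :
  (forall n, (n <= N)%nat -> a n = b n) -> sm a N = sm b N.
Proof. exact (sum_eq a b N). Qed.

Lemma sm_ge0 (a : nat -> R) N :
  (forall n, (n <= N)%nat -> 0 <= a n) -> 0 <= sm a N.
Proof.
  intros H; induction N as [|N IH]; simpl.
  - apply H; lia.
  - assert (0 <= sm a N) by (apply IH; intros; apply H; lia).
    assert (0 <= a (S N)) by (apply H; lia). lra.
Qed.

Lemma sm_scal c (a : nat -> R) N : sm (fun i => c * a i) N = c * sm a N.
Proof. rewrite scal_sum. apply sum_eq; intros; ring. Qed.

Lemma sm_scal_r c (a : nat -> R) N : sm (fun i => a i * c) N = sm a N * c.
Proof. rewrite (Rmult_comm _ c), scal_sum. apply sum_eq; intros; ring. Qed.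

Lemma sm_plus (a b : nat -> R) N :
  sm (fun i => a i + b i) N = sm a N + sm b N.
Proof. exact (plus_sum a b N). Qed.

Lemma sm_minus (a b : nat -> R) N :
  sm (fun i => a i - b i) N = sm a N - sm b N.
Proof. induction N as [|N IH]; simpl; lra. Qed.

Lemma sm_abs (a : nat -> R) N : Rabs (sm a N) <= sm (fun i => Rabs (a i)) N.
Proof. exact (Rsum_abs a N). Qed.

Lemma sm_switch (a : nat -> nat -> R) M N :
  sm (fun i => sm (a i) N) M = sm (fun j => sm (fun i => a i j) M) N.
Proof.
  induction M as [|M IH]; simpl; [reflexivity|].
  rewrite IH. symmetry. exact (sm_plus _ _ N).
Qed.

Lemma sm_zero (a : nat -> R) N :
  (forall n, (n <= N)%nat -> a n = 0) -> sm a N = 0.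
Proof.
  intros H; induction N as [|N IH]; simpl; [apply H; lia|].
  rewrite IH by (intros; apply H; lia). rewrite H by lia. ring.
Qed.

Lemma sm_mono (a : nat -> R) N M :
  (forall n, 0 <= a n) -> (N <= M)%nat -> sm a N <= sm a M.
Proof.
  intros H; induction 1 as [|M _ IH]; simpl; [lra|].
  specialize (H (S M)); lra.
Qed.

Lemma sm_term_le (a : nat -> R) N k :
  (forall n, 0 <= a n) -> (k <= N)%nat -> a k <= sm a N.
Proof.
  intros H Hk. apply Rle_trans with (sm a k); [|now apply sm_mono].
  destruct k; simpl; [lra|]. pose proof (sm_ge0 a k (fun n _ => H n)). lra.
Qed.

Definition kron (i j : nat) : R := if Nat.eq_dec i j then 1 else 0.

Lemma kron_ge0 i j : 0 <= kron i j.
Proof. unfold kron; destruct Nat.eq_dec; lra. Qed.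

Lemma kron_same i : kron i i = 1.
Proof. unfold kron; destruct Nat.eq_dec; [reflexivity|congruence]. Qed.

Lemma kron_diff i j : i <> j -> kron i j = 0.
Proof. unfold kron; destruct Nat.eq_dec; [congruence|reflexivity]. Qed.

Lemma kron_sym i j : kron i j = kron j i.
Proof. unfold kron; do 2 destruct Nat.eq_dec; congruence. Qed.

Lemma sm_kron (a : nat -> R) N j :
  (j <= N)%nat -> sm (fun i => a i * kron i j) N = a j.
Proof.
  induction N as [|N IH]; intros Hj; simpl.
  - replace j with 0%nat by lia. rewrite kron_same; ring.
  - destruct (Nat.eq_dec j (S N)) as [->|Hn].
    + rewrite kron_same, sm_zero; [ring|].
      intros n Hn. rewrite kron_diff by lia. ring.
    + rewrite IH by lia. rewrite (kron_diff (S N) j) by lia. ring.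
Qed.

Lemma sm_kron_le (a : nat -> R) N j :
  (forall i, 0 <= a i) -> sm (fun i => a i * kron i j) N <= a j.
Proof.
  intros Ha. destruct (Nat.le_gt_cases j N) as [H|H].
  - rewrite sm_kron by exact H. lra.
  - rewrite sm_zero; [apply Ha|]. intros n Hn. rewrite kron_diff by lia. ring.
Qed.

Lemma is_series_sm (a : nat -> R) l :
  is_series a l <-> is_lim_seq (sm a) l.
Proof.
  unfold is_series, is_lim_seq.
  split; apply filterlim_ext; intros n; [|symmetry]; apply sum_n_Reals.
Qed.

(* Coquelicot's canonical structures may leave an equation typed in a module over R. *)
Ltac eqR := match goal with |- ?a = ?b => change (@eq R a b) end.

Lemma sm_support_le (a : nat -> R) N I :
  (forall n, 0 <= a n) -> (forall n, (N < n)%nat -> a n = 0) -> sm a I <= sm a N.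
Proof.
  intros Ha H0. destruct (Nat.le_gt_cases I N) as [H|H]; [now apply sm_mono|].
  apply Req_le. clear - H0 H. induction H as [|m Hm IH]; simpl.
  - rewrite H0 by lia. ring.
  - rewrite IH, H0 by lia. ring.
Qed.

Lemma Series_support (a : nat -> R) N :
  (forall n, (N < n)%nat -> a n = 0) -> Series a = sm a N.
Proof.
  intros H0. apply is_series_unique, is_series_sm.
  apply (is_lim_seq_incr_n _ N).
  apply is_lim_seq_ext with (fun _ => sm a N); [|apply is_lim_seq_const].
  induction n as [|n IH]; simpl; [reflexivity|].
  rewrite H0 by lia. lra.
Qed.

Lemma is_series_kron (a : nat -> R) i : is_series (fun j => kron i j * a j) (a i).
Proof.
  apply is_series_sm, (is_lim_seq_incr_n _ i).
  apply is_lim_seq_ext with (fun _ => a i); [|apply is_lim_seq_const].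
  intros n. rewrite (sm_ext _ (fun j => a j * kron j i)).
  - rewrite sm_kron; [reflexivity|lia].
  - intros; rewrite kron_sym; ring.
Qed.

Lemma is_seriesR_plus (a b : nat -> R) la lb :
  is_series a la -> is_series b lb -> is_series (fun n => a n + b n) (la + lb).
Proof. exact (is_series_plus a b la lb). Qed.

Lemma is_seriesR_minus (a b : nat -> R) la lb :
  is_series a la -> is_series b lb -> is_series (fun n => a n - b n) (la - lb).
Proof. exact (is_series_minus a b la lb). Qed.

Lemma is_seriesR_scal c (a : nat -> R) la :
  is_series a la -> is_series (fun n => c * a n) (c * la).
Proof. exact (is_series_scal c a la). Qed.

Lemma is_series_eq (a : nat -> R) la lb : is_series a la -> la = lb -> is_series a lb.
Proof. intros H <-; exact H. Qed.

Lemma ex_series_bounded (a : nat -> R) K :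
  (forall n, 0 <= a n) -> (forall N, sm a N <= K) ->
  ex_series a /\ Series a <= K.
Proof.
  intros Ha HK.
  destruct (ex_finite_lim_seq_incr (sm a) K) as [l Hl]; [|exact HK|].
  - intros n; simpl; specialize (Ha (S n)); lra.
  - assert (Hs : is_series a l) by (apply is_series_sm; exact Hl).
    split; [exists l; exact Hs|].
    rewrite (is_series_unique _ _ Hs).
    exact (is_lim_seq_le _ _ l K HK Hl (is_lim_seq_const K)).
Qed.

Lemma sm_le_Series (a : nat -> R) N :
  (forall n, 0 <= a n) -> ex_series a -> sm a N <= Series a.
Proof.
  intros Ha Hs. apply Series_correct, is_series_sm in Hs.
  apply (is_lim_seq_incr_compare (sm a) (Series a) Hs).
  intros n; simpl; specialize (Ha (S n)); lra.
Qed.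

Lemma Series_ge0 (a : nat -> R) :
  (forall n, 0 <= a n) -> ex_series a -> 0 <= Series a.
Proof.
  intros Ha Hs. apply Rle_trans with (sm a 0); [apply Ha|now apply sm_le_Series].
Qed.

Lemma Series_term_le (a : nat -> R) k :
  (forall n, 0 <= a n) -> ex_series a -> a k <= Series a.
Proof.
  intros Ha Hs. apply Rle_trans with (sm a k).
  - now apply sm_term_le.
  - now apply sm_le_Series.
Qed.

(** * Dominated convergence and exchange of summations *)

Lemma ex_series_dom (a M : nat -> R) :
  (forall n, Rabs (a n) <= M n) -> ex_series M -> ex_series a.
Proof. intros H. apply (@ex_series_le R_AbsRing R_CompleteNormedModule a M H). Qed.

Lemma Series_abs_le (a M : nat -> R) :
  (forall n, Rabs (a n) <= M n) -> ex_series M -> Rabs (Series a) <= Series M.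
Proof.
  intros H HM. eapply Rle_trans; [apply Series_Rabs|].
  - apply (ex_series_dom _ M); [intros n; rewrite Rabs_Rabsolu; apply H|exact HM].
  - apply Series_le; [intros n; split; [apply Rabs_pos|apply H]|exact HM].
Qed.

Lemma Series_sm_tail (a M : nat -> R) N :
  (forall n, Rabs (a n) <= M n) -> ex_series M ->
  Rabs (Series a - sm a N) <= Series M - sm M N.
Proof.
  intros H HM.
  rewrite (Series_incr_n a (S N)), (Series_incr_n M (S N));
    [|lia|exact HM|lia|now apply (ex_series_dom _ M)].
  simpl Nat.pred.
  match goal with |- Rabs (?x + ?y - ?x) <= ?u + ?v - ?u =>
    replace (x + y - x) with y by ring; replace (u + v - u) with v by ring end.
  apply Series_abs_le; [intros; apply H|].
  now apply (ex_series_incr_n M (S N)).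
Qed.

(** Beyond some [N] the tail of [M] is below [eps / 3] for all parameters at once, and the remaining
    finite sum converges termwise. The arbitrary filter lets one proof serve the limit over finite
    sections, limits in time, and limits in time restricted to a set. *)
Lemma Series_DCT {A : Type} (F : (A -> Prop) -> Prop) {FF : Filter F}
  (u : A -> nat -> R) (l M : nat -> R) :
  ex_series M -> (forall n, Rabs (l n) <= M n) ->
  F (fun a => forall n, Rabs (u a n) <= M n) ->
  (forall n eps, 0 < eps -> F (fun a => Rabs (u a n - l n) < eps)) ->
  forall eps, 0 < eps -> F (fun a => Rabs (Series (u a) - Series l) < eps).
Proof.
  intros HM Hl Hu Hlim eps Heps.
  assert (HN : exists N, Series M - sm M N < eps / 3).
  { pose proof (proj1 (is_series_sm _ _) (Series_correct M HM)) as HL.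
    destruct (proj2 (is_lim_seq_spec _ _) HL (mkposreal (eps/3) ltac:(lra))) as [N HN].
    exists N. specialize (HN N (le_n _)). simpl in HN.
    apply Rabs_lt_between in HN. lra. }
  destruct HN as [N HN].
  assert (Hfin : forall e, 0 < e -> F (fun a => Rabs (sm (u a) N - sm l N) < e)).
  { clear HN. induction N as [|N IH]; intros e He; simpl.
    - apply Hlim; exact He.
    - apply (filter_imp (fun a => Rabs (sm (u a) N - sm l N) < e / 2 /\
               Rabs (u a (S N) - l (S N)) < e / 2)).
      + intros a [H1 H2].
        replace (sm (u a) N + u a (S N) - (sm l N + l (S N)))
          with ((sm (u a) N - sm l N) + (u a (S N) - l (S N))) by ring.
        eapply Rle_lt_trans; [apply Rabs_triang|lra].
      + apply filter_and; [apply IH|apply Hlim]; lra. }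
  apply (filter_imp (fun a => (forall n, Rabs (u a n) <= M n) /\
    Rabs (sm (u a) N - sm l N) < eps / 3)).
  - intros a [H1 H2].
    pose proof (Series_sm_tail (u a) M N H1 HM).
    pose proof (Series_sm_tail l M N Hl HM).
    replace (Series (u a) - Series l) with
      ((Series (u a) - sm (u a) N) + (sm (u a) N - sm l N) - (Series l - sm l N)) by ring.
    eapply Rle_lt_trans; [apply Rabs_triang|]. rewrite Rabs_Ropp.
    eapply Rle_lt_trans; [apply Rplus_le_compat_r, Rabs_triang|]. lra.
  - apply filter_and; [exact Hu|apply Hfin; lra].
Qed.

Lemma is_lim_seq_Series_DCT (u : nat -> nat -> R) (l M : nat -> R) :
  ex_series M -> (forall N n, Rabs (u N n) <= M n) ->
  (forall n, is_lim_seq (fun N => u N n) (l n)) ->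
  is_lim_seq (fun N => Series (u N)) (Series l).
Proof.
  intros HM Hu Hlim.
  assert (Hl : forall n, Rabs (l n) <= M n).
  { intros n. pose proof (is_lim_seq_abs _ _ (Hlim n)) as H. simpl in H.
    exact (is_lim_seq_le _ _ _ (M n) (fun N => Hu N n) H (is_lim_seq_const _)). }
  apply is_lim_seq_spec. intros eps.
  apply (Series_DCT eventually u l M HM Hl); [|intros n e He|apply cond_pos].
  - exists 0%nat; intros; apply Hu.
  - exact (proj2 (is_lim_seq_spec _ _) (Hlim n) (mkposreal e He)).
Qed.

Lemma continuous_eps (f : R -> R) x :
  continuous f x <-> forall eps, 0 < eps -> locally x (fun y => Rabs (f y - f x) < eps).
Proof.
  split; intros H.
  - intros eps He. exact (proj1 (filterlim_locally f (f x)) H (mkposreal eps He)).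
  - apply filterlim_locally. intros eps. exact (H eps (cond_pos eps)).
Qed.

Lemma continuous_Series (u : R -> nat -> R) (M : nat -> R) x :
  ex_series M -> (forall t n, Rabs (u t n) <= M n) ->
  (forall n, continuous (fun t => u t n) x) -> continuous (fun t => Series (u t)) x.
Proof.
  intros HM Hu Hc. apply continuous_eps. intros eps He.
  apply (Series_DCT (locally x) u (u x) M HM); [apply Hu| |intros n e Hen|exact He].
  - apply filter_forall; intros; apply Hu.
  - exact (proj1 (continuous_eps _ _) (Hc n) e Hen).
Qed.

Lemma weighted_abs v x : 0 < v -> Rabs (v * Rabs x) = v * Rabs x.
Proof.
  intros Hv. rewrite Rabs_mult, Rabs_Rabsolu, (Rabs_pos_eq v) by lra. reflexivity.
Qed.

(** The device that upgrades coordinatewise convergence to convergence in a weighted norm: the terms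
    are dominated by [2 * (v i * Z i)]. *)
Lemma weighted_DCT {A : Type} (F : (A -> Prop) -> Prop) {FF : Filter F}
  (v Z X : nat -> R) (x : A -> nat -> R) :
  (forall i, 0 < v i) -> ex_series (fun i => v i * Z i) ->
  (forall i, Rabs (X i) <= Z i) -> F (fun u => forall i, Rabs (x u i) <= Z i) ->
  (forall i eps, 0 < eps -> F (fun u => Rabs (x u i - X i) < eps)) ->
  forall eps, 0 < eps -> F (fun u => Series (fun i => v i * Rabs (x u i - X i)) < eps).
Proof.
  intros Hv HZ HX Hx Hlim eps He.
  apply (filter_imp (fun u => Rabs (Series (fun i => v i * Rabs (x u i - X i))
     - Series (fun _ => 0)) < eps)).
  - intros u Hu. rewrite (Series_support (fun _ => 0) 0) in Hu by reflexivity.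
    simpl in Hu. rewrite Rminus_0_r in Hu. eapply Rle_lt_trans; [apply Rle_abs|exact Hu].
  - apply (Series_DCT F (fun u i => v i * Rabs (x u i - X i)) (fun _ => 0)
      (fun i => 2 * (v i * Z i))); [| | | |exact He].
    + exact (ex_series_scal_l 2 _ HZ).
    + intros n. rewrite Rabs_R0. pose proof (Rabs_pos (X n)). specialize (HX n).
      pose proof (Rlt_le _ _ (Hv n)). assert (0 <= v n * Z n); [apply Rmult_le_pos|]; lra.
    + revert Hx. apply filter_imp. intros u Hu n. rewrite weighted_abs by apply Hv.
      replace (2 * (v n * Z n)) with (v n * (Z n + Z n)) by ring.
      apply Rmult_le_compat_l; [apply Rlt_le, Hv|].
      unfold Rminus. eapply Rle_trans; [apply Rabs_triang|]. rewrite Rabs_Ropp.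
      apply Rplus_le_compat; auto.
    + intros n e Hen.
      assert (Hen' : 0 < e / v n) by (apply Rdiv_lt_0_compat; auto).
      generalize (Hlim n _ Hen'). apply filter_imp. intros u Hu.
      rewrite Rminus_0_r, weighted_abs by apply Hv.
      replace e with (v n * (e / v n)) by (field; apply Rgt_not_eq, Hv).
      now apply Rmult_lt_compat_l.
Qed.

Lemma weighted_triangle (v X Y : nat -> R) : (forall i, 0 < v i) ->
  ex_series (fun i => v i * Rabs (X i)) -> ex_series (fun i => v i * Rabs (Y i)) ->
  ex_series (fun i => v i * Rabs (X i - Y i)) /\
  Series (fun i => v i * Rabs (X i - Y i))
    <= Series (fun i => v i * Rabs (X i)) + Series (fun i => v i * Rabs (Y i)).
Proof.
  intros Hv HX HY.
  assert (HS := is_seriesR_plus _ _ _ _ (Series_correct _ HX) (Series_correct _ HY)).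
  assert (Hle : forall i, 0 <= v i * Rabs (X i - Y i) <= v i * Rabs (X i) + v i * Rabs (Y i)).
  { intros i. split; [apply Rmult_le_pos; [apply Rlt_le, Hv|apply Rabs_pos]|].
    rewrite <- Rmult_plus_distr_l. apply Rmult_le_compat_l; [apply Rlt_le, Hv|].
    unfold Rminus. eapply Rle_trans; [apply Rabs_triang|]. rewrite Rabs_Ropp. lra. }
  split.
  - apply (ex_series_dom _ (fun i => v i * Rabs (X i) + v i * Rabs (Y i))).
    + intros i. rewrite Rabs_pos_eq; apply Hle.
    + eexists; exact HS.
  - rewrite <- (is_series_unique _ _ HS). apply Series_le; [exact Hle|eexists; exact HS].
Qed.

Lemma weighted_triangle_inv (v X Y : nat -> R) : (forall i, 0 < v i) ->
  ex_series (fun i => v i * Rabs (X i)) -> ex_series (fun i => v i * Rabs (Y i)) ->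
  Rabs (Series (fun i => v i * Rabs (X i)) - Series (fun i => v i * Rabs (Y i)))
    <= Series (fun i => v i * Rabs (X i - Y i)).
Proof.
  intros Hv HX HY. rewrite <- Series_minus by assumption.
  apply Series_abs_le; [|now apply weighted_triangle].
  intros n. rewrite <- Rmult_minus_distr_l, Rabs_mult, (Rabs_pos_eq (v n)) by apply Rlt_le, Hv.
  apply Rmult_le_compat_l; [apply Rlt_le, Hv|apply Rabs_triang_inv2].
Qed.

(** Sums of finitely many rows are exchanged by additivity; they increase to the column sums [cc],
    which serve as the majorant in the passage to infinitely many rows. *)
Lemma Series_Tonelli (u : nat -> nat -> R) (cc : nat -> R) :
  (forall l j, 0 <= u l j) -> (forall j, is_series (fun l => u l j) (cc j)) ->
  ex_series cc ->
  (forall l, ex_series (u l)) /\ is_series (fun l => Series (u l)) (Series cc).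
Proof.
  intros Hu Hc Hs.
  assert (Hle : forall L j, sm (fun l => u l j) L <= cc j).
  { intros L j. rewrite <- (is_series_unique _ _ (Hc j)).
    apply sm_le_Series; [intros; apply Hu|eexists; apply Hc]. }
  assert (Hex : forall l, ex_series (u l)).
  { intros l. apply (ex_series_dom _ cc); [|exact Hs]. intros j.
    rewrite Rabs_pos_eq by apply Hu. eapply Rle_trans; [|apply (Hle l j)].
    apply (sm_term_le (fun l => u l j)); [intros; apply Hu|lia]. }
  split; [exact Hex|]. apply is_series_sm.
  apply is_lim_seq_ext with (fun L => Series (fun j => sm (fun l => u l j) L)).
  - induction n as [|n IH]; simpl; [reflexivity|].
    rewrite <- IH. apply Series_plus; [|apply Hex].
    apply (ex_series_dom _ cc); [|exact Hs]. intros j.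
    rewrite Rabs_pos_eq; [apply Hle|apply sm_ge0; intros; apply Hu].
  - apply (is_lim_seq_Series_DCT _ _ cc Hs).
    + intros N n. rewrite Rabs_pos_eq; [apply Hle|apply sm_ge0; intros; apply Hu].
    + intros j. apply is_series_sm, Hc.
Qed.

(** * Bounds in weighted sequence spaces and matrices acting on them *)

(** Stated through partial sums rather than through the value of the series, so that it is preserved
    by pointwise limits and can be checked on finite sums. *)
Definition bnd (v X : nat -> R) (K : R) : Prop :=
  (forall i, 0 <= X i) /\ (forall I, sm (fun i => v i * X i) I <= K).

Lemma bnd_ex v X K : (forall i, 0 < v i) -> bnd v X K ->
  ex_series (fun i => v i * X i) /\ Series (fun i => v i * X i) <= K.
Proof.
  intros Hv [HX HK]. apply ex_series_bounded; [|exact HK].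
  intros n. apply Rmult_le_pos; [apply Rlt_le, Hv|apply HX].
Qed.

Lemma bnd_Kge0 v X K : (forall i, 0 < v i) -> bnd v X K -> 0 <= K.
Proof.
  intros Hv [HX HK]. eapply Rle_trans; [|apply (HK 0%nat)]. simpl.
  apply Rmult_le_pos; [apply Rlt_le, Hv|apply HX].
Qed.

Lemma bnd_of_series v X : (forall i, 0 < v i) -> (forall i, 0 <= X i) ->
  ex_series (fun i => v i * X i) -> bnd v X (Series (fun i => v i * X i)).
Proof.
  intros Hv HX Hs. split; [exact HX|]. intros I. apply sm_le_Series; [|exact Hs].
  intros n. apply Rmult_le_pos; [apply Rlt_le, Hv|apply HX].
Qed.

Lemma bnd_le v X Y K : (forall i, 0 < v i) -> (forall i, 0 <= X i <= Y i) ->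
  bnd v Y K -> bnd v X K.
Proof.
  intros Hv HX [_ HK]. split; [intros i; apply HX|].
  intros I. eapply Rle_trans; [|apply (HK I)].
  apply sm_le; intros. apply Rmult_le_compat_l; [apply Rlt_le, Hv|apply HX].
Qed.

Lemma bnd_weaken v X K K' : bnd v X K -> K <= K' -> bnd v X K'.
Proof. intros [H1 H2] HK. split; [exact H1|]. intros I. specialize (H2 I). lra. Qed.

Lemma bnd_plus v X Y K L : bnd v X K -> bnd v Y L ->
  bnd v (fun i => X i + Y i) (K + L).
Proof.
  intros [H1 H2] [H3 H4]. split.
  - intros i. specialize (H1 i); specialize (H3 i); lra.
  - intros I. rewrite (sm_ext _ (fun i => v i * X i + v i * Y i)) by (intros; ring).
    rewrite sm_plus. specialize (H2 I); specialize (H4 I); lra.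
Qed.

Lemma bnd_scal v X K a : 0 <= a -> bnd v X K -> bnd v (fun i => a * X i) (a * K).
Proof.
  intros Ha [H1 H2]. split.
  - intros i. now apply Rmult_le_pos.
  - intros I. rewrite (sm_ext _ (fun i => a * (v i * X i))) by (intros; ring).
    rewrite sm_scal. now apply Rmult_le_compat_l.
Qed.

Lemma bnd_term v X K i : (forall i, 0 < v i) -> bnd v X K -> v i * X i <= K.
Proof.
  intros Hv [H1 H2]. eapply Rle_trans; [|apply (H2 i)].
  apply (sm_term_le (fun i => v i * X i)); [|lia].
  intros n. apply Rmult_le_pos; [apply Rlt_le, Hv|apply H1].
Qed.

Lemma bnd_weight v v' X K : (forall i, 0 < v' i <= v i) -> bnd v X K -> bnd v' X K.
Proof.
  intros Hv [H1 H2]. split; [exact H1|]. intros I.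
  eapply Rle_trans; [|apply (H2 I)]. apply sm_le; intros.
  apply Rmult_le_compat_r; [apply H1|apply Hv].
Qed.

(** A pointwise inequality between weights does the work of an interpolation inequality between
    norms. *)
Lemma bnd_weight_comb v v1 v2 X K1 K2 a b :
  (forall i, v i <= a * v1 i + b * v2 i) -> 0 <= a -> 0 <= b ->
  bnd v1 X K1 -> bnd v2 X K2 -> bnd v X (a * K1 + b * K2).
Proof.
  intros Hv Ha Hb [H1 H2] [_ H3]. split; [exact H1|]. intros I.
  eapply Rle_trans.
  - apply (sm_le _ (fun i => a * (v1 i * X i) + b * (v2 i * X i))). intros i _.
    replace (a * (v1 i * X i) + b * (v2 i * X i)) with ((a * v1 i + b * v2 i) * X i) by ring.
    apply Rmult_le_compat_r; [apply H1|apply Hv].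
  - rewrite sm_plus, !sm_scal. apply Rplus_le_compat; now apply Rmult_le_compat_l.
Qed.

(* Between weighted l^1 spaces, bounds on the columns of a nonnegative matrix
   give the operator bound. *)
Lemma mat_vec (v u X : nat -> R) (M : nat -> nat -> R) C K :
  (forall i, 0 < v i) -> (forall i, 0 < u i) -> 0 <= C -> (forall i j, 0 <= M i j) ->
  (forall j, bnd v (fun i => M i j) (C * u j)) -> bnd u X K ->
  (forall i, ex_series (fun j => M i j * X j)) /\
  bnd v (fun i => Series (fun j => M i j * X j)) (C * K).
Proof.
  intros Hv Hu HC HM Hcol HX.
  destruct (bnd_ex u X K Hu HX) as [Hs HsK].
  assert (HX0 : forall j, 0 <= X j) by apply HX.
  assert (Hex : forall i, ex_series (fun j => M i j * X j)).
  { intros i.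
    (* A single entry of column [j] is at most the column bound divided by [v i], so every row is
       summable against [X]. *)
    apply (ex_series_dom _ (fun j => C / v i * (u j * X j))).
    - intros j. rewrite Rabs_pos_eq by (apply Rmult_le_pos; auto).
      pose proof (bnd_term v _ _ i Hv (Hcol j)) as H. simpl in H.
      replace (C / v i * (u j * X j)) with ((C * u j) / v i * X j)
        by (field; apply Rgt_not_eq, Hv).
      apply Rmult_le_compat_r; [apply HX0|].
      apply Rmult_le_reg_l with (v i); [apply Hv|].
      replace (v i * (C * u j / v i)) with (C * u j) by (field; apply Rgt_not_eq, Hv).
      exact H.
    - exact (ex_series_scal_l (C / v i) (fun j => u j * X j) Hs). }
  split; [exact Hex|]. split.
  - intros i. apply Series_ge0; [|apply Hex]. intros; apply Rmult_le_pos; auto.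
  - intros I.
    (* Only finitely many rows are summed at a time, so the exchange with the series over [j] is
       plain additivity; afterwards the column bounds apply under the series. *)
    assert (Hsw : is_series (fun j => sm (fun i => v i * M i j) I * X j)
                    (sm (fun i => v i * Series (fun j => M i j * X j)) I)).
    { induction I as [|I IH]; simpl.
      - apply (is_series_ext (fun j => scal (v 0%nat) (M 0%nat j * X j))).
        { intros j; unfold scal; simpl; unfold mult; simpl. ring. }
        apply (is_series_scal (v 0%nat) (fun j => M 0%nat j * X j)). apply Series_correct, Hex.
      - apply (is_series_ext (fun j => plus (sm (fun i => v i * M i j) I * X j)
                  (scal (v (S I)) (M (S I) j * X j)))).
        { intros j; unfold scal; simpl; unfold mult, plus; simpl. ring. }
        apply (is_series_plus (fun j => sm (fun i => v i * M i j) I * X j)); [exact IH|].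
        apply (is_series_scal (v (S I)) (fun j => M (S I) j * X j)).
        apply Series_correct, Hex. }
    rewrite <- (is_series_unique _ _ Hsw).
    apply Rle_trans with (Series (fun j => C * (u j * X j))).
    + apply Series_le; [|exact (ex_series_scal_l C (fun j => u j * X j) Hs)].
      intros j. split.
      * apply Rmult_le_pos; [|apply HX0]. apply sm_ge0; intros.
        apply Rmult_le_pos; [apply Rlt_le, Hv|apply HM].
      * rewrite <- Rmult_assoc. apply Rmult_le_compat_r; [apply HX0|apply Hcol].
    + rewrite Series_scal_l. apply Rmult_le_compat_l; assumption.
Qed.

(** * Derivatives and integrals of real functions *)

Lemma is_derive_plusR (f g : R -> R) x a b :
  is_derive f x a -> is_derive g x b -> is_derive (fun t => f t + g t) x (a + b).
Proof. exact (is_derive_plus f g x a b). Qed.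

Lemma is_derive_minusR (f g : R -> R) x a b :
  is_derive f x a -> is_derive g x b -> is_derive (fun t => f t - g t) x (a - b).
Proof. exact (is_derive_minus f g x a b). Qed.

Lemma is_derive_eq (f : R -> R) x a b : is_derive f x a -> a = b -> is_derive f x b.
Proof. intros H <-; exact H. Qed.

Lemma is_derive_constR (c x : R) : is_derive (fun _ : R => c) x 0.
Proof. exact (is_derive_const c x). Qed.

Lemma is_derive_scal_rR (f : R -> R) x c a :
  is_derive f x a -> is_derive (fun t => f t * c) x (a * c).
Proof.
  intros H. apply (is_derive_ext (fun t => c * f t)); [intros; apply Rmult_comm|].
  rewrite Rmult_comm. exact (is_derive_scal f x c a H).
Qed.

Lemma is_derive_sm (f : nat -> R -> R) (d : nat -> R) N x :
  (forall k, (k <= N)%nat -> is_derive (f k) x (d k)) ->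
  is_derive (fun t => sm (fun k => f k t) N) x (sm d N).
Proof.
  induction N as [|N IH]; intros H; simpl; [apply H; lia|].
  apply is_derive_plusR; [apply IH; intros; apply H; lia|apply H; lia].
Qed.

Lemma is_derive_continuousR (f : R -> R) x d : is_derive f x d -> continuous f x.
Proof. intros H. apply (ex_derive_continuous f x). now exists d. Qed.

Lemma derive_nonpos_decr (f df : R -> R) a b :
  a <= b -> (forall t, a <= t <= b -> is_derive f t (df t)) ->
  (forall t, a <= t <= b -> df t <= 0) -> f b <= f a.
Proof.
  intros Hab Hd Hn.
  destruct (MVT_gen f a b df) as [c [Hc He]];
    rewrite ?Rmin_left, ?Rmax_right in * by lra.
  - intros x Hx. apply Hd; lra.
  - intros x Hx. apply continuity_pt_filterlim.
    exact (is_derive_continuousR f x _ (Hd x Hx)).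
  - assert (df c * (b - a) <= 0); [|lra].
    specialize (Hn c Hc).
    replace 0 with (0 * (b - a)) by ring. apply Rmult_le_compat_r; lra.
Qed.

Lemma continuous_is_derive_RInt (f : R -> R) a :
  (forall t, continuous f t) -> forall t, is_derive (fun t => RInt f a t) t (f t).
Proof.
  intros Hf t. apply (is_derive_RInt f (fun t => RInt f a t) a t); [|apply Hf].
  apply filter_forall. intros b. apply (RInt_correct f a b).
  apply (ex_RInt_continuous f). intros; apply Hf.
Qed.

Lemma continuous_ex_RInt (f : R -> R) a b : (forall t, continuous f t) -> ex_RInt f a b.
Proof. intros Hf. apply (ex_RInt_continuous f). intros; apply Hf. Qed.

(** * Exponentials of finite matrices *)

Definition below (N i : nat) : R := if le_dec i N then 1 else 0.

Lemma below_in N i : (i <= N)%nat -> below N i = 1.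
Proof. unfold below; destruct le_dec; [reflexivity|lia]. Qed.

Lemma below_out N i : (N < i)%nat -> below N i = 0.
Proof. unfold below; destruct le_dec; [lia|reflexivity]. Qed.

Lemma below_01 N i : 0 <= below N i <= 1.
Proof. unfold below; destruct le_dec; lra. Qed.

(** The zeroth power is the projection onto indices up to [N], not the full identity, so that all
    powers, and the exponential, vanish outside the section. *)
Fixpoint mpow (N : nat) (P : nat -> nat -> R) (n i j : nat) : R :=
  match n with
  | O => below N i * kron i j
  | S n => sm (fun l => P i l * mpow N P n l j) N
  end.

Section MatrixPower.
Variables (N : nat) (P : nat -> nat -> R).
Hypothesis Pout : forall i l, (N < i \/ N < l)%nat -> P i l = 0.

Lemma mpow_out n i j : (N < i \/ N < j)%nat -> mpow N P n i j = 0.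
Proof.
  revert i; induction n as [|n IH]; intros i Hi; simpl.
  - destruct (Nat.eq_dec i j) as [->|Hn].
    + rewrite below_out by lia. ring.
    + rewrite kron_diff by exact Hn. ring.
  - apply sm_zero. intros l Hl. destruct Hi as [Hi|Hi].
    + rewrite Pout by lia. ring.
    + rewrite IH by lia. ring.
Qed.

(** The recursion on the other side is what yields the backward differential equation of the
    exponential next to the forward one. *)
Lemma mpow_right n i j : mpow N P (S n) i j = sm (fun l => mpow N P n i l * P l j) N.
Proof.
  revert i; induction n as [|n IH]; intros i.
  - simpl. destruct (Nat.le_gt_cases j N) as [Hj|Hj].
    + rewrite (sm_ext _ (fun l => P i l * kron l j)).
      2:{ intros l Hl. rewrite below_in by exact Hl. ring. }
      rewrite sm_kron by exact Hj.
      destruct (Nat.le_gt_cases i N) as [Hi|Hi].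
      * rewrite (sm_ext _ (fun l => P l j * kron l i)).
        2:{ intros l Hl. rewrite below_in, kron_sym by exact Hi. ring. }
        now rewrite sm_kron by exact Hi.
      * rewrite Pout by lia. symmetry. apply sm_zero. intros.
        rewrite below_out by exact Hi. ring.
    + rewrite !sm_zero; [reflexivity| |]; intros l Hl.
      * rewrite Pout by lia. ring.
      * rewrite kron_diff by lia. ring.
  - change (mpow N P (S (S n)) i j) with (sm (fun l => P i l * mpow N P (S n) l j) N).
    rewrite (sm_ext _ (fun l => sm (fun k => P i l * (mpow N P n l k * P k j)) N)).
    2:{ intros l _. rewrite IH, sm_scal. reflexivity. }
    rewrite sm_switch. apply sm_ext. intros k _. simpl.
    rewrite <- sm_scal_r. apply sm_ext. intros; ring.
Qed.

Lemma mpow_bound n i j :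
  Rabs (mpow N P n i j) <= sm (fun i => sm (fun l => Rabs (P i l)) N) N ^ n.
Proof.
  set (K := sm _ N).
  assert (HK : forall i, sm (fun l => Rabs (P i l)) N <= K).
  { intros i0. destruct (Nat.le_gt_cases i0 N) as [H|H].
    - apply (sm_term_le (fun i => sm (fun l => Rabs (P i l)) N)); [|exact H].
      intros; apply sm_ge0; intros; apply Rabs_pos.
    - rewrite sm_zero.
      + apply sm_ge0; intros; apply sm_ge0; intros; apply Rabs_pos.
      + intros. rewrite Pout by lia. apply Rabs_R0. }
  assert (HK0 : 0 <= K).
  { apply sm_ge0; intros; apply sm_ge0; intros; apply Rabs_pos. }
  revert i; induction n as [|n IH]; intros i; simpl.
  - pose proof (below_01 N i). unfold kron. destruct Nat.eq_dec;
    rewrite Rabs_pos_eq; lra.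
  - eapply Rle_trans; [apply sm_abs|].
    apply Rle_trans with (sm (fun l => Rabs (P i l) * K ^ n) N).
    + apply sm_le; intros l _. rewrite Rabs_mult.
      apply Rmult_le_compat_l; [apply Rabs_pos|apply IH].
    + rewrite sm_scal_r. apply Rmult_le_compat_r; [now apply pow_le|apply HK].
Qed.

Definition mexp (t : R) (i j : nat) : R :=
  PSeries (fun n => mpow N P n i j / INR (fact n)) t.

Lemma mexp_ex_series i j t :
  ex_series (fun n => Rabs (mpow N P n i j / INR (fact n) * t ^ n)).
Proof.
  set (K := sm (fun i => sm (fun l => Rabs (P i l)) N) N).
  apply (ex_series_dom _ (fun n => / INR (fact n) * (K * Rabs t) ^ n)).
  - intros n. rewrite Rabs_Rabsolu. unfold Rdiv. rewrite !Rabs_mult, <- RPow_abs.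
    rewrite Rpow_mult_distr.
    rewrite (Rabs_pos_eq (/ INR (fact n))).
    2:{ apply Rlt_le, Rinv_0_lt_compat, INR_fact_lt_0. }
    replace (/ INR (fact n) * (K ^ n * Rabs t ^ n))
      with (K ^ n * (/ INR (fact n)) * Rabs t ^ n) by ring.
    apply Rmult_le_compat_r; [apply pow_le, Rabs_pos|].
    apply Rmult_le_compat_r; [|apply mpow_bound].
    apply Rlt_le, Rinv_0_lt_compat, INR_fact_lt_0.
  - apply ex_pseries_R. eexists. apply is_exp_Reals.
Qed.

Lemma mexp_CV i j t : Rbar_lt (Rabs t) (CV_radius (fun n => mpow N P n i j / INR (fact n))).
Proof.
  (* If the radius were below [Rabs t + 1], the terms at that point would not tend to 0, although
     the series converges absolutely everywhere. *)
  apply Rbar_lt_le_trans with (Rabs t + 1); [simpl; lra|].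
  apply Rbar_not_lt_le. intros H.
  apply (CV_disk_outside (fun n => mpow N P n i j / INR (fact n)) (Rabs t + 1)).
  - rewrite Rabs_pos_eq; [exact H|]. pose proof (Rabs_pos t); lra.
  - apply ex_series_lim_0, ex_series_Rabs, mexp_ex_series.
Qed.

Lemma mexp_deriv i j t :
  is_derive (fun t => mexp t i j) t
    (PSeries (fun n => mpow N P (S n) i j / INR (fact n)) t).
Proof.
  eapply is_derive_eq; [apply (is_derive_PSeries _ t (mexp_CV i j t))|].
  apply PSeries_ext. intros n. unfold PS_derive.
  rewrite fact_simpl, mult_INR. field.
  split; [apply INR_fact_neq_0|]. rewrite S_INR. pose proof (pos_INR n); lra.
Qed.

Lemma PSeries_sm (u : nat -> nat -> R) (c : nat -> R) M t :
  (forall l, ex_series (fun n => u l n * t ^ n)) ->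
  PSeries (fun n => sm (fun l => c l * u l n) M) t =
  sm (fun l => c l * PSeries (u l) t) M.
Proof.
  intros Hu.
  assert (Hc : forall l, ex_series (fun n => c l * u l n * t ^ n)).
  { intros l. apply (ex_series_ext (fun n => scal (c l) (u l n * t ^ n))).
    - intros n. unfold scal; simpl; unfold mult; simpl; ring.
    - exact (ex_series_scal (c l) _ (Hu l)). }
  assert (H1 : forall l, PSeries (fun n => c l * u l n) t = c l * PSeries (u l) t).
  { intros l. unfold PSeries. rewrite <- Series_scal_l. apply Series_ext; intros; ring. }
  assert (Hs : ex_series (fun n => sm (fun l => c l * u l n) M * t ^ n) /\
    PSeries (fun n => sm (fun l => c l * u l n) M) t =
    sm (fun l => c l * PSeries (u l) t) M); [|apply Hs].
  induction M as [|M [IH1 IH2]]; simpl.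
  - split; [apply Hc|apply H1].
  - split.
    + eapply ex_series_ext; [|apply (ex_series_plus _ _ IH1 (Hc (S M)))].
      intros n. unfold plus; simpl. ring.
    + rewrite <- IH2, <- H1. unfold PSeries at 2 3. rewrite <- Series_plus; [|apply IH1|apply Hc].
      unfold PSeries. apply Series_ext. intros; ring.
Qed.

Lemma mexp_ex_series' i j t :
  ex_series (fun n => mpow N P n i j / INR (fact n) * t ^ n).
Proof. apply ex_series_Rabs, mexp_ex_series. Qed.

Lemma mexp_deriv_left i j t :
  is_derive (fun t => mexp t i j) t (sm (fun l => P i l * mexp t l j) N).
Proof.
  eapply is_derive_eq; [apply mexp_deriv|]. unfold mexp.
  rewrite <- (PSeries_sm (fun l n => mpow N P n l j / INR (fact n)) (P i)).
  2:{ intros; apply mexp_ex_series'. }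
  apply PSeries_ext. intros n. simpl. unfold Rdiv.
  rewrite <- sm_scal_r. apply sm_ext; intros; ring.
Qed.

Lemma mexp_deriv_right i j t :
  is_derive (fun t => mexp t i j) t (sm (fun l => mexp t i l * P l j) N).
Proof.
  eapply is_derive_eq; [apply mexp_deriv|].
  transitivity (sm (fun l => P l j * mexp t i l) N).
  2:{ apply sm_ext; intros; ring. }
  unfold mexp.
  rewrite <- (PSeries_sm (fun l n => mpow N P n i l / INR (fact n)) (fun l => P l j)).
  2:{ intros; apply mexp_ex_series'. }
  apply PSeries_ext. intros n. rewrite mpow_right. unfold Rdiv.
  rewrite <- sm_scal_r. apply sm_ext; intros; ring.
Qed.

Lemma mexp_0 i j : mexp 0 i j = below N i * kron i j.
Proof. unfold mexp. rewrite PSeries_0. simpl. field. Qed.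

Lemma mexp_out t i j : (N < i \/ N < j)%nat -> mexp t i j = 0.
Proof.
  intros H. unfold mexp.
  transitivity (PSeries (fun _ => 0) t); [|apply PSeries_const_0].
  apply PSeries_ext. intros n. rewrite mpow_out by exact H. unfold Rdiv; ring.
Qed.

Lemma mexp_ge0 t i j : (forall i l, 0 <= P i l) -> 0 <= t -> 0 <= mexp t i j.
Proof.
  intros HP Ht.
  assert (Hm : forall n i, 0 <= mpow N P n i j).
  { induction n as [|n IH]; intros i0; simpl.
    - apply Rmult_le_pos; [apply below_01|apply kron_ge0].
    - apply sm_ge0; intros; apply Rmult_le_pos; auto. }
  apply Series_ge0; [|apply mexp_ex_series'].
  intros n. apply Rmult_le_pos; [|now apply pow_le].
  apply Rmult_le_pos; [apply Hm|apply Rlt_le, Rinv_0_lt_compat, INR_fact_lt_0].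
Qed.

End MatrixPower.

(* Uniformization: adding a multiple [m] of the identity makes the generator
   entrywise nonnegative, and hence its exponential as well. *)
Definition gshift (N : nat) (Y : nat -> nat -> R) : R := sm (fun i => Rabs (Y i i)) N.

Definition gpos (N : nat) (Y : nat -> nat -> R) (i l : nat) : R :=
  Y i l + gshift N Y * (below N i * kron i l).

Definition gsem (N : nat) (Y : nat -> nat -> R) (t : R) (i j : nat) : R :=
  exp (- gshift N Y * t) * mexp N (gpos N Y) t i j.

Section FiniteSemigroup.
Variables (N : nat) (Y : nat -> nat -> R).
Hypothesis Yout : forall i l, (N < i \/ N < l)%nat -> Y i l = 0.
Hypothesis Yoff : forall i l, i <> l -> 0 <= Y i l.

Lemma gpos_out i l : (N < i \/ N < l)%nat -> gpos N Y i l = 0.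
Proof.
  intros H. unfold gpos. rewrite Yout by exact H.
  destruct (Nat.eq_dec i l) as [->|Hn].
  - rewrite below_out by lia. ring.
  - rewrite kron_diff by exact Hn. ring.
Qed.

Lemma gpos_ge0 i l : 0 <= gpos N Y i l.
Proof.
  unfold gpos. destruct (Nat.eq_dec i l) as [->|Hn].
  - rewrite kron_same. destruct (Nat.le_gt_cases l N) as [H|H].
    + rewrite below_in by exact H.
      assert (Rabs (Y l l) <= gshift N Y).
      { apply (sm_term_le (fun i => Rabs (Y i i))); [intros; apply Rabs_pos|exact H]. }
      pose proof (Rle_abs (- Y l l)). rewrite Rabs_Ropp in *. lra.
    + rewrite below_out, Yout by lia. lra.
  - rewrite kron_diff by exact Hn. specialize (Yoff i l Hn). lra.
Qed.

Lemma gsem_ge0 t i j : 0 <= t -> 0 <= gsem N Y t i j.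
Proof.
  intros Ht. apply Rmult_le_pos; [apply Rlt_le, exp_pos|].
  apply mexp_ge0; [exact gpos_out|exact gpos_ge0|exact Ht].
Qed.

Lemma gsem_out t i j : (N < i \/ N < j)%nat -> gsem N Y t i j = 0.
Proof.
  intros H. unfold gsem. rewrite mexp_out; [ring|exact gpos_out|exact H].
Qed.

Lemma gsem_0 i j : gsem N Y 0 i j = below N i * kron i j.
Proof.
  unfold gsem. rewrite mexp_0, Rmult_0_r, exp_0. ring.
Qed.

Lemma gsem_deriv_aux t (f : R -> R) d :
  is_derive f t d ->
  is_derive (fun t => exp (- gshift N Y * t) * f t) t
    (exp (- gshift N Y * t) * (d - gshift N Y * f t)).
Proof.
  intros H.
  assert (He : is_derive (fun t => exp (- gshift N Y * t)) t
            (- gshift N Y * exp (- gshift N Y * t))).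
  { auto_derive; [exact I|ring]. }
  eapply is_derive_eq; [apply (Derive.is_derive_mult _ _ _ _ _ He H)|]. eqR; ring.
Qed.

Lemma gsem_deriv_left t i j :
  is_derive (fun t => gsem N Y t i j) t (sm (fun l => Y i l * gsem N Y t l j) N).
Proof.
  unfold gsem.
  eapply is_derive_eq.
  { apply gsem_deriv_aux, (mexp_deriv_left N (gpos N Y) gpos_out). }
  set (E := exp (- gshift N Y * t)).
  (* [Y] is [gpos] minus a multiple of the identity; the [kron] term selects [l = i] and reproduces
     the derivative of the scalar exponential. *)
  rewrite (sm_ext (fun l => Y i l * (E * mexp N (gpos N Y) t l j))
    (fun l => E * (gpos N Y i l * mexp N (gpos N Y) t l j
       - gshift N Y * (below N i * mexp N (gpos N Y) t l j) * kron l i))).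
  2:{ intros l Hl. unfold gpos at 2. rewrite (kron_sym i l). ring. }
  rewrite sm_scal, sm_minus. f_equal. f_equal.
  destruct (Nat.le_gt_cases i N) as [Hi|Hi].
  - rewrite (sm_kron (fun l => gshift N Y * (below N i * mexp N (gpos N Y) t l j))) by exact Hi.
    rewrite below_in by exact Hi. ring.
  - rewrite sm_zero.
    + rewrite mexp_out; [ring|exact gpos_out|now left].
    + intros n Hn. rewrite below_out by exact Hi. ring.
Qed.

Lemma gsem_deriv_right t i j :
  is_derive (fun t => gsem N Y t i j) t (sm (fun l => gsem N Y t i l * Y l j) N).
Proof.
  unfold gsem.
  eapply is_derive_eq.
  { apply gsem_deriv_aux, (mexp_deriv_right N (gpos N Y) gpos_out). }
  set (E := exp (- gshift N Y * t)).
  rewrite (sm_ext (fun l => E * mexp N (gpos N Y) t i l * Y l j)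
    (fun l => E * (mexp N (gpos N Y) t i l * gpos N Y l j
       - gshift N Y * (mexp N (gpos N Y) t i l) * kron l j))).
  2:{ intros l Hl. unfold gpos at 3. rewrite (below_in N l) by exact Hl. ring. }
  rewrite sm_scal, sm_minus. f_equal. f_equal.
  destruct (Nat.le_gt_cases j N) as [Hj|Hj].
  - now rewrite (sm_kron (fun l => gshift N Y * (mexp N (gpos N Y) t i l))) by exact Hj.
  - rewrite sm_zero.
    + rewrite mexp_out; [ring|exact gpos_out|now right].
    + intros n Hn. rewrite kron_diff by lia. ring.
Qed.

Lemma gsem_continuous t i j : continuous (fun t => gsem N Y t i j) t.
Proof. exact (is_derive_continuousR _ _ _ (gsem_deriv_left t i j)). Qed.

End FiniteSemigroup.

(* The derivative of [s |-> S'(t-s) S(s)], from which both the semigroup law and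
   the monotonicity in the generator are read off. *)
Lemma gsem_interpolation N N' Y Y' t s i j :
  (N <= N')%nat ->
  (forall i l, (N < i \/ N < l)%nat -> Y i l = 0) ->
  (forall i l, (N' < i \/ N' < l)%nat -> Y' i l = 0) ->
  is_derive (fun s => sm (fun l => gsem N' Y' (t - s) i l * gsem N Y s l j) N') s
    (sm (fun l => sm (fun k => gsem N' Y' (t - s) i l * (Y l k - Y' l k)
                               * gsem N Y s k j) N') N').
Proof.
  intros HN HY HY'.
  eapply is_derive_eq.
  - apply (is_derive_sm (fun l s => gsem N' Y' (t - s) i l * gsem N Y s l j)
      (fun l => (- sm (fun k => gsem N' Y' (t - s) i k * Y' k l) N') * gsem N Y s l j
        + gsem N' Y' (t - s) i l * sm (fun k => Y l k * gsem N Y s k j) N)).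
    intros l Hl.
    apply (Derive.is_derive_mult (fun s => gsem N' Y' (t - s) i l) (fun s => gsem N Y s l j)).
    + eapply is_derive_eq.
      * apply (is_derive_comp (fun u => gsem N' Y' u i l) (fun s => t - s)).
        -- apply gsem_deriv_right. exact HY'.
        -- apply (is_derive_minusR (fun _ => t) (fun s => s)).
           ++ apply is_derive_constR.
           ++ apply (is_derive_id s).
      * unfold scal; simpl; unfold mult, one; simpl. eqR; ring.
    + apply gsem_deriv_left. exact HY.
  - rewrite sm_plus.
    rewrite (sm_ext (fun l => gsem N' Y' (t - s) i l * sm (fun k => Y l k * gsem N Y s k j) N)
      (fun l => sm (fun k => gsem N' Y' (t - s) i l * Y l k * gsem N Y s k j) N')).
    2:{ intros l Hl. rewrite <- sm_scal.
        assert (Hext : forall f, (forall k, (N < k)%nat -> f k = 0) -> sm f N = sm f N').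
        { intros f Hf. clear - HN Hf. induction HN as [|m Hm IH]; [reflexivity|].
          simpl. rewrite (Hf (S m)) by lia. lra. }
        rewrite Hext.
        - apply sm_ext; intros; ring.
        - intros k Hk. rewrite HY by lia. ring. }
    rewrite (sm_ext (fun l => - sm (fun k => gsem N' Y' (t - s) i k * Y' k l) N' * gsem N Y s l j)
      (fun l => sm (fun k => - (gsem N' Y' (t - s) i k * Y' k l * gsem N Y s l j)) N')).
    2:{ intros l Hl. rewrite Ropp_mult_distr_l_reverse, Ropp_mult_distr_r, <- sm_scal_r.
        apply sm_ext; intros; ring. }
    rewrite (sm_switch (fun l k => - (gsem N' Y' (t - s) i k * Y' k l * gsem N Y s l j))).
    rewrite <- sm_plus. apply sm_ext. intros l Hl.
    rewrite <- sm_plus. apply sm_ext. intros; ring.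
Qed.

(** * Lipschitz functions, quadratic remainders and term-by-term integration *)

Lemma Lipschitz_of_derive (f df : R -> R) L a b :
  (forall t, Rmin a b <= t <= Rmax a b -> is_derive f t (df t) /\ Rabs (df t) <= L) ->
  Rabs (f b - f a) <= L * Rabs (b - a).
Proof.
  intros H. destruct (MVT_gen f a b df) as [x [Hx ->]].
  - intros x Hx. apply H; lra.
  - intros x Hx. apply continuity_pt_filterlim.
    exact (is_derive_continuousR f x _ (proj1 (H x Hx))).
  - rewrite Rabs_mult. apply Rmult_le_compat_r; [apply Rabs_pos|apply H, Hx].
Qed.

Lemma Lipschitz_continuous (f : R -> R) L x :
  (forall s t, Rabs (f t - f s) <= L * Rabs (t - s)) -> continuous f x.
Proof.
  intros H. apply continuous_eps. intros eps He.
  assert (HL : 0 <= L).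
  { specialize (H 0 1). rewrite Rminus_0_r, Rabs_R1 in H.
    pose proof (Rabs_pos (f 1 - f 0)). lra. }
  assert (Hd : 0 < eps / (L + 1)) by (apply Rdiv_lt_0_compat; lra).
  exists (mkposreal _ Hd). intros y Hy.
  change (Rabs (y - x) < eps / (L + 1)) in Hy.
  eapply Rle_lt_trans; [apply H|].
  apply Rle_lt_trans with ((L + 1) * Rabs (y - x)).
  - apply Rmult_le_compat_r; [apply Rabs_pos|lra].
  - replace eps with ((L + 1) * (eps / (L + 1))) by (field; lra).
    apply Rmult_lt_compat_l; lra.
Qed.

(** Lipschitz integrands give remainders that are quadratic in the time step, and this is the form
    in which such derivatives are established below. *)
Lemma is_derive_quadratic (f : R -> R) x d K :
  (forall y, Rabs (y - x) <= 1 -> Rabs (f y - f x - (y - x) * d) <= K * (y - x) ^ 2) ->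
  is_derive f x d.
Proof.
  intros H.
  assert (HK : 0 <= K).
  { specialize (H (x + 1)). replace (x + 1 - x) with 1 in H by ring.
    rewrite Rabs_R1 in H. pose proof (Rabs_pos (f (x + 1) - f x - 1 * d)).
    specialize (H (Rle_refl 1)). lra. }
  apply is_derive_Reals. intros eps Heps.
  assert (He : 0 < Rmin 1 (eps / (K + 1))).
  { apply Rmin_glb_lt; [lra|apply Rdiv_lt_0_compat; lra]. }
  exists (mkposreal _ He). intros h Hh0 Hh. simpl in Hh.
  pose proof (Rabs_pos_lt h Hh0) as Hp.
  assert (Hh1 := Rlt_le_trans _ _ _ Hh (Rmin_l _ _)).
  assert (Hh2 := Rlt_le_trans _ _ _ Hh (Rmin_r _ _)).
  specialize (H (x + h)). replace (x + h - x) with h in H by ring.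
  specialize (H (Rlt_le _ _ Hh1)).
  replace ((f (x + h) - f x) / h - d) with ((f (x + h) - f x - h * d) * / h)
    by (field; exact Hh0).
  rewrite Rabs_mult, Rabs_inv.
  apply Rmult_lt_reg_r with (Rabs h); [exact Hp|].
  rewrite Rmult_assoc, Rinv_l, Rmult_1_r by lra.
  eapply Rle_lt_trans; [apply H|].
  rewrite <- pow2_abs. simpl. rewrite Rmult_1_r.
  rewrite <- Rmult_assoc. apply Rmult_lt_compat_r; [exact Hp|].
  apply Rle_lt_trans with ((K + 1) * Rabs h); [nra|].
  replace eps with ((K + 1) * (eps / (K + 1))) by (field; lra).
  apply Rmult_lt_compat_l; lra.
Qed.

Lemma quadratic_const (f : R -> R) L s t :
  (forall s t, Rabs (f t - f s) <= L * (t - s) ^ 2) -> f t = f s.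
Proof.
  intros H.
  assert (Hd : forall x, is_derive f x 0).
  { intros x. apply (is_derive_quadratic f x 0 L). intros y _.
    rewrite Rmult_0_r, Rminus_0_r. apply H. }
  assert (HH : Rabs (f t - f s) <= 0 * Rabs (t - s)).
  { apply (Lipschitz_of_derive f (fun _ => 0)).
    intros; split; [apply Hd|rewrite Rabs_R0; lra]. }
  rewrite Rmult_0_l in HH. apply Rabs_le_between in HH. lra.
Qed.

Lemma Rmax_0_Lipschitz s t : Rabs (Rmax 0 t - Rmax 0 s) <= Rabs (t - s).
Proof.
  unfold Rmax; do 2 destruct Rle_dec; unfold Rabs; repeat destruct Rcase_abs; lra.
Qed.

Lemma abs_RInt_bound (f : R -> R) M a b :
  (forall t, continuous f t) ->
  (forall t, Rmin a b <= t <= Rmax a b -> Rabs (f t) <= M) ->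
  Rabs (RInt f a b) <= M * Rabs (b - a).
Proof.
  intros Hf HM. destruct (Rle_dec a b) as [H|H].
  - rewrite (Rabs_pos_eq (b - a)) by lra. rewrite Rmult_comm.
    rewrite Rmin_left, Rmax_right in HM by lra.
    apply abs_RInt_le_const; [exact H|now apply continuous_ex_RInt|exact HM].
  - rewrite <- opp_RInt_swap by now apply continuous_ex_RInt.
    change (Rabs (- RInt f b a) <= M * Rabs (b - a)).
    rewrite Rabs_Ropp, <- (Rabs_Ropp (b - a)), (Rabs_pos_eq (- (b - a))) by lra.
    rewrite Rmult_comm. rewrite Rmin_right, Rmax_left in HM by lra.
    replace (- (b - a)) with (a - b) by ring.
    apply abs_RInt_le_const; [lra|now apply continuous_ex_RInt|exact HM].
Qed.

Lemma RInt_ChaslesR (f : R -> R) a b d :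
  (forall t, continuous f t) -> RInt f a b + RInt f b d = RInt f a d.
Proof.
  intros Hf. apply (RInt_Chasles f a b d); now apply continuous_ex_RInt.
Qed.

Lemma RInt_pointR (f : R -> R) a : RInt f a a = 0.
Proof. apply (RInt_point a f). Qed.

Lemma RInt_const_R (c a b : R) : RInt (fun _ => c) a b = (b - a) * c.
Proof. apply (RInt_const a b c). Qed.

Lemma RInt_minusR (f g : R -> R) a b :
  (forall t, continuous f t) -> (forall t, continuous g t) ->
  RInt (fun t => f t - g t) a b = RInt f a b - RInt g a b.
Proof.
  intros Hf Hg. apply (RInt_minus f g a b); now apply continuous_ex_RInt.
Qed.

Lemma RInt_nonneg (f : R -> R) a b :
  a <= b -> (forall t, continuous f t) -> (forall t, a <= t <= b -> 0 <= f t) ->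
  0 <= RInt f a b.
Proof.
  intros Hab Hf H0. apply RInt_ge_0; [exact Hab|now apply continuous_ex_RInt|].
  intros; apply H0; lra.
Qed.

(** Fatou's lemma for weighted sums: each partial sum passes to the limit separately. It carries
    bounds from finite sections to the full semigroup. *)
Lemma bnd_lim v (X : nat -> nat -> R) (Y : nat -> R) K :
  (forall N, bnd v (X N) K) -> (forall i, is_lim_seq (fun N => X N i) (Y i)) ->
  bnd v Y K.
Proof.
  intros HX HY. split.
  - intros i. exact (is_lim_seq_le _ _ 0 (Y i) (fun N => proj1 (HX N) i)
      (is_lim_seq_const 0) (HY i)).
  - intros I.
    assert (HL : is_lim_seq (fun N => sm (fun i => v i * X N i) I)
                   (sm (fun i => v i * Y i) I)).
    { induction I as [|I IH]; simpl.
      - apply (is_lim_seq_scal_l _ (v 0%nat) _ (HY 0%nat)).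
      - apply (is_lim_seq_plus' _ _ _ _ IH).
        apply (is_lim_seq_scal_l _ (v (S I)) _ (HY (S I))). }
    exact (is_lim_seq_le _ _ _ K (fun N => proj2 (HX N) I) HL (is_lim_seq_const K)).
Qed.

Lemma Rpower_le_1plus y a : 0 < y -> 0 <= a <= 1 -> Rpower y a <= 1 + y.
Proof.
  intros Hy Ha. destruct (Rle_dec 1 y) as [H|H].
  - apply Rle_trans with (Rpower y 1); [|rewrite Rpower_1; lra].
    now apply Rle_Rpower.
  - apply Rle_trans with 1; [|lra].
    unfold Rpower.
    assert (Hl : ln y < 0) by (rewrite <- ln_1; apply ln_increasing; lra).
    destruct (Req_dec a 0) as [->|Hn]; [rewrite Rmult_0_l, exp_0; lra|].
    rewrite <- exp_0. apply Rlt_le, exp_increasing. nra.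
Qed.

(** The tail of [M] bounds the remainder uniformly in [t], so convergence is uniform on the
    interval. *)
Lemma RInt_Series (u : R -> nat -> R) (M : nat -> R) a b :
  a <= b -> ex_series M -> (forall t n, Rabs (u t n) <= M n) ->
  (forall n t, continuous (fun t => u t n) t) ->
  is_series (fun n => RInt (fun t => u t n) a b) (RInt (fun t => Series (u t)) a b).
Proof.
  intros Hab HM Hu Hc.
  assert (HS : forall t, continuous (fun t => Series (u t)) t).
  { intros t. now apply (continuous_Series u M). }
  assert (Hsm : forall N t, continuous (fun t => sm (u t) N) t).
  { intros N t. induction N as [|N IH]; simpl; [apply Hc|].
    exact (continuous_plus _ _ t IH (Hc (S N) t)). }
  assert (HI : forall N, sm (fun n => RInt (fun t => u t n) a b) N
             = RInt (fun t => sm (u t) N) a b).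
  { induction N as [|N IH]; simpl; [reflexivity|]. rewrite IH. symmetry.
    apply (RInt_plus (fun t => sm (u t) N) (fun t => u t (S N)));
    apply continuous_ex_RInt; [apply Hsm|apply Hc]. }
  apply is_series_sm. apply is_lim_seq_spec. intros eps.
  pose proof (proj1 (is_series_sm _ _) (Series_correct M HM)) as HL.
  assert (He : 0 < eps / (b - a + 1)) by (apply Rdiv_lt_0_compat; [apply cond_pos|lra]).
  destruct (proj2 (is_lim_seq_spec _ _) HL (mkposreal _ He)) as [N HN].
  exists N. intros n Hn. specialize (HN n Hn). simpl in HN.
  rewrite Rabs_minus_sym in HN. rewrite HI, Rabs_minus_sym, <- RInt_minusR by auto.
  eapply Rle_lt_trans.
  - apply (abs_RInt_bound _ (Series M - sm M n)).
    + intros t. apply (continuous_minus (fun t => Series (u t)) (fun t => sm (u t) n)); auto.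
    + intros t _. now apply Series_sm_tail.
  - rewrite Rabs_pos_eq by lra. pose proof (Rle_abs (Series M - sm M n)).
    apply Rle_lt_trans with (eps / (b - a + 1) * (b - a)).
    + apply Rmult_le_compat_r; lra.
    + replace (pos eps) with (eps / (b - a + 1) * (b - a + 1)) at 2 by (field; lra).
      apply Rmult_lt_compat_l; lra.
Qed.

(** * Scalar convolutions in time *)

Definition conv (u h : R -> R) (t : R) : R := RInt (fun s => u (t - s) * h s) 0 t.

Section Convolution.
Variables (u h : R -> R) (L H : R).
Hypothesis Lip : forall s t, Rabs (u t - u s) <= L * Rabs (t - s).
Hypothesis hc : forall t, continuous h t.
Hypothesis hH : forall t, Rabs (h t) <= H.

Lemma conv_L_ge0 : 0 <= L.
Proof.
  pose proof (Lip 0 1) as HH. rewrite Rminus_0_r, Rabs_R1 in HH.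
  pose proof (Rabs_pos (u 1 - u 0)). lra.
Qed.

Lemma conv_H_ge0 : 0 <= H.
Proof. eapply Rle_trans; [apply Rabs_pos|apply (hH 0)]. Qed.

Lemma conv_integrand_cont (v : R -> R) t s :
  (forall x, continuous v x) -> continuous (fun s => v (t - s) * h s) s.
Proof.
  intros Hv. apply (continuous_mult (fun s => v (t - s)) h); [|apply hc].
  apply (continuous_comp (fun s => t - s) v); [|apply Hv].
  apply (continuous_minus (fun _ => t) (fun s => s));
    [apply continuous_const|apply continuous_id].
Qed.

Lemma conv_u_cont x : continuous u x.
Proof. exact (Lipschitz_continuous u L x Lip). Qed.

Lemma conv_between t y s : Rmin t y <= s <= Rmax t y -> Rabs (y - s) <= Rabs (y - t).
Proof.
  unfold Rmin, Rmax; destruct Rle_dec; intros Hs; unfold Rabs;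
  repeat destruct Rcase_abs; lra.
Qed.

Lemma conv_diff (v : R -> R) t y : (forall x, continuous v x) ->
  conv v h y - conv v h t =
  RInt (fun s => (v (y - s) - v (t - s)) * h s) 0 t + RInt (fun s => v (y - s) * h s) t y.
Proof.
  intros Hv. unfold conv.
  rewrite <- (RInt_ChaslesR (fun s => v (y - s) * h s) 0 t y)
    by (intros; now apply conv_integrand_cont).
  rewrite (RInt_ext (fun s => (v (y - s) - v (t - s)) * h s)
    (fun s => v (y - s) * h s - v (t - s) * h s)) by (intros; apply Rmult_minus_distr_r).
  rewrite RInt_minusR by (intros; now apply conv_integrand_cont). eqR. ring.
Qed.

Lemma conv_cont t : continuous (conv u h) t.
Proof.
  pose proof conv_L_ge0 as HL. pose proof conv_H_ge0 as HH.
  (* The first summand is the variation of the kernel over the interval from 0 to [t]; the second is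
     the added interval from [t] to [y], where the argument of [u] is at most 1 in absolute
     value. *)
  set (K := L * H * Rabs t + (Rabs (u 0) + L) * H).
  assert (HK : 0 <= K).
  { pose proof (Rabs_pos t). pose proof (Rabs_pos (u 0)). unfold K.
    apply Rplus_le_le_0_compat; repeat apply Rmult_le_pos; lra. }
  assert (Hloc : forall y, Rabs (y - t) <= 1 -> Rabs (conv u h y - conv u h t) <= K * Rabs (y - t)).
  { intros y Hy. rewrite conv_diff by exact conv_u_cont.
    eapply Rle_trans; [apply Rabs_triang|].
    unfold K. rewrite Rmult_plus_distr_r. apply Rplus_le_compat.
    - eapply Rle_trans.
      + apply (abs_RInt_bound _ (L * Rabs (y - t) * H)).
        * intros s. apply (continuous_ext (fun s => u (y - s) * h s - u (t - s) * h s)).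
          { intros; symmetry; apply Rmult_minus_distr_r. }
          apply (continuous_minus (fun s => u (y - s) * h s) (fun s => u (t - s) * h s));
          apply conv_integrand_cont, conv_u_cont.
        * intros s _. rewrite Rabs_mult. apply Rmult_le_compat; try apply Rabs_pos; [|apply hH].
          eapply Rle_trans; [apply Lip|]. replace (y - s - (t - s)) with (y - t) by ring. lra.
      + rewrite Rminus_0_r. lra.
    - eapply Rle_trans.
      + apply (abs_RInt_bound _ ((Rabs (u 0) + L) * H)).
        * intros s. apply conv_integrand_cont, conv_u_cont.
        * intros s Hs. rewrite Rabs_mult. apply Rmult_le_compat; try apply Rabs_pos; [|apply hH].
          pose proof (conv_between t y s Hs). pose proof (Lip 0 (y - s)) as H1.
          rewrite Rminus_0_r in H1.
          replace (u (y - s)) with (u 0 + (u (y - s) - u 0)) by ring.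
          eapply Rle_trans; [apply Rabs_triang|]. apply Rplus_le_compat_l.
          eapply Rle_trans; [apply H1|].
          rewrite <- (Rmult_1_r L) at 2. apply Rmult_le_compat_l; lra.
      + lra. }
  apply continuous_eps. intros eps He.
  assert (Hd : 0 < Rmin 1 (eps / (K + 1))).
  { apply Rmin_glb_lt; [lra|apply Rdiv_lt_0_compat; lra]. }
  exists (mkposreal _ Hd). intros y Hy. change (Rabs (y - t) < Rmin 1 (eps / (K + 1))) in Hy.
  assert (Hh1 := Rlt_le_trans _ _ _ Hy (Rmin_l _ _)).
  assert (Hh2 := Rlt_le_trans _ _ _ Hy (Rmin_r _ _)).
  eapply Rle_lt_trans; [apply Hloc; lra|].
  apply Rle_lt_trans with ((K + 1) * Rabs (y - t)).
  - apply Rmult_le_compat_r; [apply Rabs_pos|lra].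
  - replace eps with ((K + 1) * (eps / (K + 1))) by (field; lra).
    apply Rmult_lt_compat_l; lra.
Qed.

Let q (t : R) : R := RInt u 0 t.

Lemma conv_q_deriv t : is_derive q t (u t).
Proof. apply continuous_is_derive_RInt, conv_u_cont. Qed.

Lemma conv_q_cont t : continuous q t.
Proof. exact (is_derive_continuousR q t _ (conv_q_deriv t)). Qed.

Lemma conv_q_diff a b : q b - q a = RInt u a b.
Proof.
  unfold q. rewrite <- (RInt_ChaslesR u 0 a b) by exact conv_u_cont. eqR. ring.
Qed.

(** The antiderivative [q] of the kernel vanishes at 0, so the boundary term of the Leibniz rule
    disappears and [h] needs only to be continuous. Both parts of the remainder are quadratic in
    [y - t]. *)
Lemma conv_deriv t : is_derive (conv q h) t (conv u h t).
Proof.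
  pose proof conv_L_ge0 as HL. pose proof conv_H_ge0 as HH.
  set (K := L * H * Rabs t + (Rabs (u 0) + L) * H).
  apply (is_derive_quadratic _ _ _ K). intros y Hy.
  rewrite conv_diff by exact conv_q_cont.
  replace ((y - t) * conv u h t) with (RInt (fun s => (y - t) * (u (t - s) * h s)) 0 t).
  2:{ apply (RInt_scal (fun s => u (t - s) * h s)). apply continuous_ex_RInt.
      intros; apply conv_integrand_cont, conv_u_cont. }
  replace (RInt (fun s => (q (y - s) - q (t - s)) * h s) 0 t + RInt (fun s => q (y - s) * h s) t y
     - RInt (fun s => (y - t) * (u (t - s) * h s)) 0 t)
    with (RInt (fun s => (q (y - s) - q (t - s)) * h s - (y - t) * (u (t - s) * h s)) 0 t
     + RInt (fun s => q (y - s) * h s) t y).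
  2:{ rewrite RInt_minusR.
      - eqR; ring.
      - intros s. apply (continuous_ext (fun s => q (y - s) * h s - q (t - s) * h s)).
        { intros; symmetry; apply Rmult_minus_distr_r. }
        apply (continuous_minus (fun s => q (y - s) * h s) (fun s => q (t - s) * h s));
        apply conv_integrand_cont, conv_q_cont.
      - intros s. apply (continuous_scal_r (y - t) (fun s => u (t - s) * h s)).
        apply conv_integrand_cont, conv_u_cont. }
  eapply Rle_trans; [apply Rabs_triang|].
  unfold K. rewrite Rmult_plus_distr_r, <- (pow2_abs (y - t)). apply Rplus_le_compat.
  - eapply Rle_trans.
    + apply (abs_RInt_bound _ (L * Rabs (y - t) * Rabs (y - t) * H)).
      * intros s. apply (continuous_minus (fun s => (q (y - s) - q (t - s)) * h s)
          (fun s => (y - t) * (u (t - s) * h s))).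
        -- apply (continuous_ext (fun s => q (y - s) * h s - q (t - s) * h s)).
           { intros; symmetry; apply Rmult_minus_distr_r. }
           apply (continuous_minus (fun s => q (y - s) * h s) (fun s => q (t - s) * h s));
           apply conv_integrand_cont, conv_q_cont.
        -- apply (continuous_scal_r (y - t) (fun s => u (t - s) * h s)).
           apply conv_integrand_cont, conv_u_cont.
      * intros s _.
        replace ((q (y - s) - q (t - s)) * h s - (y - t) * (u (t - s) * h s))
          with ((q (y - s) - q (t - s) - (y - t) * u (t - s)) * h s) by ring.
        rewrite Rabs_mult. apply Rmult_le_compat; try apply Rabs_pos; [|apply hH].
        (* The remainder of [q] is the integral of [u x - u (t - s)] over an interval of length
           [Rabs (y - t)], on which the integrand is at most [L * Rabs (y - t)]. *)
        rewrite conv_q_diff.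
        replace ((y - t) * u (t - s)) with (RInt (fun _ => u (t - s)) (t - s) (y - s)).
        2:{ rewrite RInt_const_R. eqR; ring. }
        rewrite <- RInt_minusR by (intros; try apply continuous_const; apply conv_u_cont).
        eapply Rle_trans.
        -- apply (abs_RInt_bound _ (L * Rabs (y - t))).
           ++ intros x. apply (continuous_minus u (fun _ => u (t - s)));
                [apply conv_u_cont|apply continuous_const].
           ++ intros x Hx. eapply Rle_trans; [apply Lip|].
              apply Rmult_le_compat_l; [exact HL|].
              revert Hx. unfold Rmin, Rmax; destruct Rle_dec; intros Hx; unfold Rabs;
              repeat destruct Rcase_abs; lra.
        -- replace (y - s - (t - s)) with (y - t) by ring. lra.
    + rewrite Rminus_0_r. simpl. lra.
  - eapply Rle_trans.
    + apply (abs_RInt_bound _ ((Rabs (u 0) + L) * Rabs (y - t) * H)).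
      * intros s. apply conv_integrand_cont, conv_q_cont.
      * intros s Hs. rewrite Rabs_mult. apply Rmult_le_compat; try apply Rabs_pos; [|apply hH].
        pose proof (conv_between t y s Hs).
        eapply Rle_trans.
        -- apply (abs_RInt_bound u (Rabs (u 0) + L)); [exact conv_u_cont|].
           intros x Hx. pose proof (Lip 0 x) as H1. rewrite Rminus_0_r in H1.
           replace (u x) with (u 0 + (u x - u 0)) by ring.
           eapply Rle_trans; [apply Rabs_triang|]. apply Rplus_le_compat_l.
           eapply Rle_trans; [apply H1|].
           rewrite <- (Rmult_1_r L) at 2. apply Rmult_le_compat_l; [exact HL|].
           assert (Rabs x <= Rabs (y - s)); [|lra].
           revert Hx. unfold Rmin, Rmax; destruct Rle_dec; intros Hx; unfold Rabs;
           repeat destruct Rcase_abs; lra.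
        -- rewrite Rminus_0_r. apply Rmult_le_compat_l; [|assumption].
           pose proof (Rabs_pos (u 0)); lra.
    + simpl. lra.
Qed.

Lemma conv_bound t : 0 <= t -> (forall s, 0 <= u s) -> Rabs (conv u h t) <= q t * H.
Proof.
  intros Ht Hu. unfold conv.
  eapply Rle_trans.
  - apply abs_RInt_le; [exact Ht|].
    apply continuous_ex_RInt; intros; apply conv_integrand_cont, conv_u_cont.
  - apply Rle_trans with (RInt (fun s => H * u (t - s)) 0 t).
    + apply RInt_le; [exact Ht| | |].
      * apply continuous_ex_RInt; intros s.
        apply (continuous_comp (fun s => u (t - s) * h s) Rabs).
        -- apply conv_integrand_cont, conv_u_cont.
        -- apply (continuous_Rabs (u (t - s) * h s)).
      * apply continuous_ex_RInt; intros s.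
        apply (continuous_scal_r H (fun s => u (t - s))).
        apply (continuous_comp (fun s => t - s) u); [|apply conv_u_cont].
        apply (continuous_minus (fun _ => t) (fun s => s));
        [apply continuous_const|apply continuous_id].
      * intros s _. rewrite Rabs_mult, (Rabs_pos_eq (u (t - s))) by apply Hu.
        rewrite Rmult_comm. apply Rmult_le_compat_r; [apply Hu|apply hH].
    + apply Req_le.
      transitivity (H * 0 - (H * - q t)); [|ring].
      apply is_RInt_unique.
      apply (is_RInt_ext (fun s => H * u (t - s))); [reflexivity|].
      (* Written as the increment of the antiderivative [fun s => H * - q (t - s)], with [q 0 = 0]
         at the upper end. *)
      replace (H * 0 - H * - q t) with (minus (H * - q (t - t)) (H * - q (t - 0))).
      2:{ unfold minus, plus, opp; simpl. rewrite Rminus_0_r, Rminus_diag.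
          unfold q at 1. rewrite RInt_pointR. ring. }
      apply (is_RInt_derive (fun s => H * - q (t - s)) (fun s => H * u (t - s))).
      * intros s _. apply (is_derive_scal (fun s => - q (t - s)) s H (u (t - s))).
        eapply is_derive_eq.
        -- apply (is_derive_opp (fun s => q (t - s))).
           apply (is_derive_comp q (fun s => t - s)); [apply conv_q_deriv|].
           apply (is_derive_minusR (fun _ => t) (fun s => s));
           [apply is_derive_constR|apply (is_derive_id s)].
        -- unfold opp, scal, one; simpl; unfold mult; simpl. eqR; ring.
      * intros s _. apply (continuous_scal_r H (fun s => u (t - s))).
        apply (continuous_comp (fun s => t - s) u); [|apply conv_u_cont].
        apply (continuous_minus (fun _ => t) (fun s => s));
        [apply continuous_const|apply continuous_id].
Qed.

Lemma conv_ge0 t : 0 <= t -> (forall s, 0 <= u s) -> (forall s, 0 <= h s) -> 0 <= conv u h t.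
Proof.
  intros Ht Hu Hh. apply RInt_nonneg; [exact Ht| |].
  - intros; apply conv_integrand_cont, conv_u_cont.
  - intros; apply Rmult_le_pos; auto.
Qed.

End Convolution.

Lemma conv_minus (u h1 h2 : R -> R) t :
  (forall x, continuous u x) -> (forall x, continuous h1 x) -> (forall x, continuous h2 x) ->
  conv u (fun s => h1 s - h2 s) t = conv u h1 t - conv u h2 t.
Proof.
  intros Hu H1 H2. unfold conv.
  rewrite <- RInt_minusR by (intros; now apply conv_integrand_cont).
  apply RInt_ext. intros. apply Rmult_minus_distr_l.
Qed.

(** * Trajectories dominated uniformly in time *)

(** Composition with it extends a trajectory on the closed time interval to the whole line by
    constants, so that continuity and majorants can be stated for all real times. *)
Definition clamp (T t : R) : R := Rmax 0 (Rmin T t).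

Lemma clamp_range T t : 0 < T -> 0 <= clamp T t <= T.
Proof.
  intros HT. unfold clamp. split; [apply Rmax_l|].
  apply Rmax_lub; [lra|apply Rmin_l].
Qed.

Lemma clamp_id T t : 0 <= t <= T -> clamp T t = t.
Proof. intros Ht. unfold clamp. rewrite Rmin_right, Rmax_right; lra. Qed.

Lemma clamp_Lipschitz T s t : Rabs (clamp T t - clamp T s) <= Rabs (t - s).
Proof.
  eapply Rle_trans; [apply Rmax_0_Lipschitz|].
  unfold Rmin; do 2 destruct Rle_dec; unfold Rabs; repeat destruct Rcase_abs; lra.
Qed.

Lemma clamp_cont T t : continuous (clamp T) t.
Proof.
  apply (Lipschitz_continuous _ 1). intros s r. rewrite Rmult_1_l. apply clamp_Lipschitz.
Qed.

Definition traj_cont (y : R -> nat -> R) : Prop :=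
  forall i t, continuous (fun t => y t i) t.

(** One sequence [Y] has to work for all times; this is stronger than a bound on the norm at each
    time and is exactly what dominated convergence in time requires. *)
Definition maj (v : nat -> R) (K : R) (y : R -> nat -> R) : Prop :=
  exists Y, bnd v Y K /\ forall t i, Rabs (y t i) <= Y i.

Lemma maj_weaken v K K' y : maj v K y -> K <= K' -> maj v K' y.
Proof. intros [Y [HY Hy]] HK. exists Y. split; [now apply (bnd_weaken _ _ K)|exact Hy]. Qed.

Lemma maj_plus v K K' y z : maj v K y -> maj v K' z ->
  maj v (K + K') (fun t i => y t i + z t i).
Proof.
  intros [Y [HY Hy]] [Z [HZ Hz]]. exists (fun i => Y i + Z i).
  split; [now apply bnd_plus|]. intros t i.
  eapply Rle_trans; [apply Rabs_triang|]. now apply Rplus_le_compat.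
Qed.

Lemma maj_ext v K y z : (forall t i, y t i = z t i) -> maj v K y -> maj v K z.
Proof. intros E [Y [HY Hy]]. exists Y. split; [exact HY|]. intros t i. rewrite <- E. apply Hy. Qed.

Lemma maj_bnd v K y t : (forall i, 0 < v i) -> maj v K y -> bnd v (fun i => Rabs (y t i)) K.
Proof.
  intros Hv [Y [HY Hy]]. apply (bnd_le v _ Y); [exact Hv| |exact HY].
  intros i; split; [apply Rabs_pos|apply Hy].
Qed.

Lemma maj_term v K y t i : (forall i, 0 < v i) -> maj v K y -> v i * Rabs (y t i) <= K.
Proof. intros Hv Hy. exact (bnd_term v _ _ i Hv (maj_bnd v K y t Hv Hy)). Qed.

Definition norm_cont_on (P : R -> Prop) (v : nat -> R) (x : R -> nat -> R) : Prop :=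
  forall t, P t -> forall eps, 0 < eps -> exists delta, 0 < delta /\
    forall u, P u -> Rabs (u - t) < delta ->
      Series (fun i => v i * Rabs (x u i - x t i)) < eps.

(** The majorant may depend on [t] and is needed only nearby. This matters for the heaviest weight,
    where majorants degenerate as time tends to 0. *)
Lemma traj_cont_norm_cont (P : R -> Prop) v x :
  (forall i, 0 < v i) -> traj_cont x ->
  (forall t, P t -> exists Z, ex_series (fun i => v i * Z i) /\
     (forall i, Rabs (x t i) <= Z i) /\
     within P (locally t) (fun u => forall i, Rabs (x u i) <= Z i)) ->
  norm_cont_on P v x.
Proof.
  intros Hv Hc HZ t Ht eps He. destruct (HZ t Ht) as [Z [HZs [HZt HZl]]].
  destruct (weighted_DCT (within P (locally t)) v Z (x t) x Hv HZs HZt HZl) with (eps := eps)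
    as [delta Hd].
  - intros i e Hei. apply filter_le_within. exact (proj1 (continuous_eps _ _) (Hc i t) e Hei).
  - exact He.
  - exists delta. split; [apply cond_pos|]. intros u Hu Hut. now apply Hd.
Qed.

(* Lipschitz continuity for the norms [sum_i v_i sup_t |y_i(t)|], in which the
   contraction argument is carried out. *)
Definition maj_Lipschitz (G : (nat -> R) -> nat -> R) (v w : nat -> R) (R0 L : R) : Prop :=
  forall K x y, 0 <= K -> maj v R0 x -> maj v R0 y -> maj v K (fun t i => x t i - y t i) ->
  maj w (L * K) (fun t i => G (x t) i - G (y t) i).

(** Freezing [x] at two different times gives two constant trajectories; on these the Lipschitz
    property in the strong norm is the ordinary Lipschitz estimate between their values. *)
Lemma maj_Lipschitz_cont G v w R0 L x :
  (forall i, 0 < v i) -> (forall i, 0 < w i) -> 0 <= L ->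
  maj_Lipschitz G v w R0 L -> maj v R0 x -> traj_cont x -> traj_cont (fun t => G (x t)).
Proof.
  intros Hv Hw HL HG Hx Hc i t. apply continuous_eps. intros eps Heps.
  assert (Hex : forall s, ex_series (fun i => v i * Rabs (x s i))).
  { intros r. exact (proj1 (bnd_ex v _ _ Hv (maj_bnd v R0 x r Hv Hx))). }
  assert (He : 0 < eps * w i / (L + 1)).
  { apply Rdiv_lt_0_compat; [|lra]. now apply Rmult_lt_0_compat. }
  assert (Hser : locally t (fun u => Series (fun i => v i * Rabs (x u i - x t i)) < eps * w i / (L + 1))).
  { destruct Hx as [X [HX Hx]].
    apply (weighted_DCT (locally t) v X); auto.
    - apply (bnd_ex v X R0 Hv HX).
    - apply filter_forall. intros; apply Hx.
    - intros n. apply continuous_eps, Hc. }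
  revert Hser. apply filter_imp. intros u Hu.
  set (K := Series (fun i => v i * Rabs (x u i - x t i))) in *.
  assert (Hb : bnd v (fun i => Rabs (x u i - x t i)) K).
  { apply bnd_of_series; [exact Hv|intros; apply Rabs_pos|].
    now apply (weighted_triangle v (x u) (x t)). }
  pose proof (bnd_Kge0 v _ _ Hv Hb) as HK.
  assert (Hcst : forall r, maj v R0 (fun _ => x r)).
  { destruct Hx as [X [HX Hx]]. intros r. exists X. split; [exact HX|intros _; apply Hx]. }
  assert (HGut := HG K (fun _ => x u) (fun _ => x t) HK (Hcst u) (Hcst t)
    (ex_intro _ _ (conj Hb (fun _ i => Rle_refl _)))).
  pose proof (maj_term w _ _ 0 i Hw HGut) as HT. simpl in HT.
  apply Rmult_lt_reg_l with (w i); [apply Hw|].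
  eapply Rle_lt_trans; [apply HT|].
  apply Rle_lt_trans with ((L + 1) * K).
  - apply Rmult_le_compat_r; lra.
  - replace (w i * eps) with ((L + 1) * (eps * w i / (L + 1))) by (field; lra).
    apply Rmult_lt_compat_l; lra.
Qed.

(** * A Gronwall inequality for left Dini derivatives *)

Lemma first_zero (phi : R -> R) b : 0 <= b -> (forall t, continuous phi t) ->
  phi 0 < 0 -> 0 <= phi b ->
  exists t, 0 < t <= b /\ phi t = 0 /\ forall s, 0 <= s < t -> phi s < 0.
Proof.
  intros Hb Hc H0 Hpb.
  (* The wanted time is the supremum of [A]: a negative value there would allow going further, a
     positive one would contradict negativity just before. *)
  set (A t := 0 <= t <= b /\ forall s, 0 <= s <= t -> phi s < 0).
  assert (HA0 : A 0) by (split; [lra|intros s Hs; now replace s with 0 by lra]).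
  destruct (completeness A) as [t [Hub Hlub]]; [exists b; intros t [Ht _]; lra|now exists 0|].
  assert (Ht : 0 <= t <= b) by (split; [now apply Hub|apply Hlub; intros r [Hr _]; lra]).
  assert (Hlt : forall s, 0 <= s < t -> phi s < 0).
  { intros s Hs. apply Rnot_le_lt. intros Hle. specialize (Hlub s).
    assert (t <= s); [|lra]. apply Hlub. intros r [Hr Hphi].
    apply Rnot_lt_le. intros Hsr. assert (Hss : 0 <= s <= r) by lra. specialize (Hphi s Hss). lra. }
  assert (Hz : phi t = 0).
  { apply Rle_antisym; apply Rnot_lt_le; intros Hn.
    - destruct (proj1 (continuous_eps phi t) (Hc t) _ Hn) as [del Hdel].
      destruct (Req_dec t 0) as [->|Hne]; [lra|].
      set (r := Rmax 0 (t - del / 2)). pose proof (cond_pos del).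
      assert (0 <= r) by apply Rmax_l. assert (t - del / 2 <= r) by apply Rmax_r.
      assert (r < t) by (apply Rmax_lub_lt; lra).
      assert (Hr : Rabs (r - t) < del) by (rewrite Rabs_minus_sym, Rabs_pos_eq; lra).
      specialize (Hdel r Hr). apply Rabs_lt_between in Hdel.
      assert (Hrt : 0 <= r < t) by lra. specialize (Hlt r Hrt). lra.
    - assert (Hn' : 0 < - phi t) by lra.
      destruct (proj1 (continuous_eps phi t) (Hc t) _ Hn') as [del Hdel].
      destruct (Req_dec t b) as [->|Hne]; [lra|].
      set (r := Rmin b (t + del / 2)). pose proof (cond_pos del).
      assert (r <= b) by apply Rmin_l. assert (r <= t + del / 2) by apply Rmin_r.
      assert (t < r) by (apply Rmin_glb_lt; lra).
      assert (r <= t); [|lra]. apply Hub. split; [lra|]. intros s Hs.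
      destruct (Rlt_dec s t) as [Hst|Hst]; [apply Hlt; lra|].
      assert (Hr : Rabs (s - t) < del) by (rewrite Rabs_pos_eq; lra).
      specialize (Hdel s Hr). apply Rabs_lt_between in Hdel. lra. }
  exists t. split; [|split; [exact Hz|exact Hlt]].
  destruct (Req_dec t 0) as [->|]; lra.
Qed.

(** Comparison with a small multiple of [exp ((M + 1) * t)]. At the first contact [N] must rise from
    the left at least as fast as the comparison function, whose rate exceeds the permitted [M * N t]
    by [E t]; errors of [E t / 4] on each side leave a contradiction. *)
Lemma left_Dini_Gronwall (N : R -> R) (M T : R) :
  0 <= M -> (forall t, continuous N t) -> N 0 <= 0 ->
  (forall t, 0 < t < T -> forall eps, 0 < eps -> exists delta, 0 < delta /\
     forall s, 0 < s < t -> t - s < delta -> N t - N s <= (t - s) * (M * N t + eps)) ->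
  forall t, 0 <= t <= T -> N t <= 0.
Proof.
  intros HM Hc H0 Hd.
  assert (Hb : forall b, 0 <= b < T -> N b <= 0).
  { intros b Hb. apply Rnot_lt_le. intros Hpos.
    (* Scaled so that the comparison function equals [N] at [b]; a first contact then exists no
       later than [b]. *)
    set (e := N b / exp ((M + 1) * b)).
    assert (He : 0 < e) by (apply Rdiv_lt_0_compat; [exact Hpos|apply exp_pos]).
    set (E t := e * exp ((M + 1) * t)).
    assert (HE : forall t, 0 < E t) by (intros; apply Rmult_lt_0_compat; [exact He|apply exp_pos]).
    assert (HEd : forall t, is_derive E t ((M + 1) * E t)).
    { intros t. unfold E. auto_derive; [exact I|ring]. }
    destruct (first_zero (fun t => N t - E t) b) as [t [Ht [Hz Hlt]]]; [lra| | | |].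
    - intros t. apply (continuous_minus N E); [apply Hc|].
      exact (is_derive_continuousR E t _ (HEd t)).
    - pose proof (HE 0). lra.
    - unfold E, e. apply Req_le. field. apply Rgt_not_eq, exp_pos.
    - assert (Hq : 0 < E t / 4) by (pose proof (HE t); lra).
      assert (HtT : 0 < t < T) by lra.
      destruct (Hd t HtT _ Hq) as [d1 [Hd1 H1]].
      pose proof (HEd t) as H2. apply is_derive_Reals in H2. destruct (H2 _ Hq) as [d2 H3].
      pose proof (cond_pos d2) as Hd2.
      set (r := Rmin (t / 2) (Rmin (d1 / 2) (d2 / 2))).
      assert (Hr : 0 < r) by (repeat apply Rmin_glb_lt; lra).
      assert (r <= t / 2) by apply Rmin_l.
      assert (r <= d1 / 2) by (eapply Rle_trans; [apply Rmin_r|apply Rmin_l]).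
      assert (r <= d2 / 2) by (eapply Rle_trans; [apply Rmin_r|apply Rmin_r]).
      assert (Hs1 : 0 < t - r < t) by lra. assert (Hs2 : t - (t - r) < d1) by lra.
      specialize (H1 _ Hs1 Hs2). replace (t - (t - r)) with r in H1 by ring.
      assert (Hs3 : 0 <= t - r < t) by lra. specialize (Hlt _ Hs3).
      assert (Hr0 : - r <> 0) by lra.
      assert (Hr2 : Rabs (- r) < d2) by (rewrite Rabs_Ropp, Rabs_pos_eq; lra).
      specialize (H3 _ Hr0 Hr2). apply Rabs_lt_between, proj1 in H3.
      replace (t + - r) with (t - r) in H3 by ring.
      apply (Rmult_lt_compat_l r) in H3; [|exact Hr].
      replace (r * ((E (t - r) - E t) / - r - (M + 1) * E t))
        with (E t - E (t - r) - r * ((M + 1) * E t)) in H3 by (field; lra).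
      replace (N t) with (E t) in H1 by lra.
      assert (0 < r * (E t / 2)) by (apply Rmult_lt_0_compat; lra). lra. }
  (* The differential inequality covers only times before [T]; the endpoint follows by
     continuity. *)
  intros t Ht. destruct (Req_dec t T) as [->|Hne]; [|apply Hb; lra].
  apply Rnot_lt_le. intros Hl.
  destruct (proj1 (continuous_eps N T) (Hc T) _ Hl) as [del Hdel].
  destruct (Req_dec T 0) as [->|HT0]; [lra|].
  set (r := Rmax 0 (T - del / 2)). pose proof (cond_pos del).
  assert (0 <= r) by apply Rmax_l. assert (T - del / 2 <= r) by apply Rmax_r.
  assert (r < T) by (apply Rmax_lub_lt; lra).
  assert (Hr : Rabs (r - T) < del) by (rewrite Rabs_minus_sym, Rabs_pos_eq; lra).
  specialize (Hdel r Hr). apply Rabs_lt_between in Hdel.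
  assert (Hrt : 0 <= r < T) by lra. specialize (Hb r Hrt). lra.
Qed.

Lemma norm_clamp_continuous (v : nat -> R) (y : R -> nat -> R) T t :
  0 < T -> (forall i, 0 < v i) ->
  (forall t, 0 <= t <= T -> ex_series (fun i => v i * Rabs (y t i))) ->
  norm_cont_on (fun t => 0 <= t <= T) v y ->
  continuous (fun t => Series (fun i => v i * Rabs (y (clamp T t) i))) t.
Proof.
  intros HT Hv Hex Hc. apply continuous_eps. intros eps He.
  destruct (Hc (clamp T t) (clamp_range T t HT) eps He) as [del [Hd0 Hd]].
  exists (mkposreal _ Hd0). intros u Hu. change (Rabs (u - t) < del) in Hu.
  pose proof (clamp_range T u HT) as Hur. pose proof (clamp_range T t HT) as Htr.
  eapply Rle_lt_trans; [|apply (Hd (clamp T u) Hur)].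
  - apply weighted_triangle_inv; [exact Hv|now apply Hex|now apply Hex].
  - eapply Rle_lt_trans; [apply clamp_Lipschitz|exact Hu].
Qed.

Lemma norm_bounded (v : nat -> R) (y : R -> nat -> R) T :
  0 < T -> (forall i, 0 < v i) ->
  (forall t, 0 <= t <= T -> ex_series (fun i => v i * Rabs (y t i))) ->
  norm_cont_on (fun t => 0 <= t <= T) v y ->
  exists R0, 0 <= R0 /\ forall t, 0 <= t <= T -> bnd v (fun i => Rabs (y t i)) R0.
Proof.
  intros HT Hv Hex Hc. set (N t := Series (fun i => v i * Rabs (y (clamp T t) i))).
  destruct (continuity_ab_maj N 0 T (Rlt_le _ _ HT)) as [m [Hm _]].
  - intros t Ht. apply continuity_pt_filterlim. now apply (norm_clamp_continuous v y).
  - exists (Rmax 0 (N m)). split; [apply Rmax_l|]. intros t Ht. specialize (Hm t Ht).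
    apply (bnd_weaken _ _ (N t)); [|eapply Rle_trans; [exact Hm|apply Rmax_r]].
    unfold N. rewrite (clamp_id T t Ht).
    apply bnd_of_series; [exact Hv|intros; apply Rabs_pos|now apply Hex].
Qed.

(** The value 1 at 0 keeps the absolute value equal to 1 without exception; besides this only
    [sgn r * r = Rabs r] matters. *)
Definition sgn (r : R) : R := if Rle_dec 0 r then 1 else -1.

Lemma sgn_mult r : sgn r * r = Rabs r.
Proof.
  unfold sgn. destruct Rle_dec; [rewrite Rabs_pos_eq; lra|rewrite Rabs_left; lra].
Qed.

Lemma sgn_abs r : Rabs (sgn r) = 1.
Proof. unfold sgn. destruct Rle_dec; unfold Rabs; destruct Rcase_abs; lra. Qed.

Lemma sgn_le r y : sgn r * y <= Rabs y.
Proof.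
  eapply Rle_trans; [apply Rle_abs|]. rewrite Rabs_mult, sgn_abs. lra.
Qed.

(** * The abstract equation x' = (B - D) x + G(x) *)

Section AbstractEquation.
Variables (B : nat -> nat -> R) (D w Th : nat -> R) (c CB CD alpha : R).
Hypothesis HB : forall i j, 0 <= B i j.
Hypothesis HD : forall j, 0 <= D j.
Hypothesis Hw : forall i, 0 < w i.
Hypothesis HTh : forall i, 1 <= Th i.
Hypothesis Hc : 0 < c.
Hypothesis HCB : 0 <= CB.
Hypothesis HCD : 0 <= CD.
(** Dissipativity by columns: measured in [w], what index [j] hands on falls short of what it loses
    by at least [c * (Th j * w j)]. All smoothing, and later the uniqueness, comes from this
    surplus. *)
Hypothesis Hcol : forall j I, sm (fun i => w i * B i j) I + c * (Th j * w j) <= D j * w j.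
Hypothesis HcolB : forall j, bnd w (fun i => B i j) (CB * (Th j * w j)).
Hypothesis HDle : forall j, D j <= CD * Th j.
Hypothesis Halpha : 0 < alpha < 1.

Let wT (i : nat) : R := Th i * w i.

Let wT_pos i : 0 < wT i.
Proof. apply Rmult_lt_0_compat; [specialize (HTh i); lra|apply Hw]. Qed.

(** * Semigroups of the finite sections *)

(** Gains that leave the section are dropped, while the loss on the diagonal is kept in full. The
    column inequality thus survives truncation with the same [c], and the gains increase with
    [N]. *)
Definition genN (N i j : nat) : R := below N i * below N j * (B i j - kron i j * D i).
Definition SN (N : nat) (t : R) (i j : nat) : R := gsem N (genN N) t i j.
Definition QN (N : nat) (t : R) (i j : nat) : R := RInt (fun s => SN N s i j) 0 t.

Lemma genN_out N i l : (N < i \/ N < l)%nat -> genN N i l = 0.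
Proof.
  intros [H|H]; unfold genN; [rewrite (below_out N i)|rewrite (below_out N l)]; auto; ring.
Qed.

Lemma genN_off N i l : i <> l -> 0 <= genN N i l.
Proof.
  intros H. unfold genN. rewrite kron_diff by exact H.
  pose proof (below_01 N i). pose proof (below_01 N l).
  apply Rmult_le_pos; [apply Rmult_le_pos; lra|]. specialize (HB i l); lra.
Qed.

Lemma SN_ge0 N t i j : 0 <= t -> 0 <= SN N t i j.
Proof. apply gsem_ge0; [apply genN_out|apply genN_off]. Qed.

Lemma SN_0 N i j : SN N 0 i j = below N i * kron i j.
Proof. apply gsem_0. Qed.

Lemma SN_out N t i j : (N < i \/ N < j)%nat -> SN N t i j = 0.
Proof. apply gsem_out, genN_out. Qed.

Lemma SN_cont N i j t : continuous (fun s => SN N s i j) t.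
Proof. apply gsem_continuous, genN_out. Qed.

Lemma QN_deriv N i j t : is_derive (fun t => QN N t i j) t (SN N t i j).
Proof. apply (continuous_is_derive_RInt (fun s => SN N s i j)). intros; apply SN_cont. Qed.

Lemma QN_0 N i j : QN N 0 i j = 0.
Proof. apply RInt_pointR. Qed.

Lemma QN_ge0 N t i j : 0 <= t -> 0 <= QN N t i j.
Proof.
  intros Ht. apply RInt_nonneg; [exact Ht|intros; apply SN_cont|].
  intros; apply SN_ge0; lra.
Qed.

Lemma QN_out N t i j : (N < i \/ N < j)%nat -> QN N t i j = 0.
Proof.
  intros H. unfold QN. rewrite (RInt_ext _ (fun _ => 0)).
  - rewrite RInt_const_R. ring.
  - intros; now apply SN_out.
Qed.

(** In [gsem_interpolation] the generators differ only in row and column [S N]. In the column the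
    factor [SN N s k j] vanishes; in the row the larger generator has nonnegative entries. The
    interpolating sum therefore decreases from the larger semigroup at [s = 0] to the smaller one at
    [s = t]. *)
Lemma SN_incr N t i j : 0 <= t -> SN N t i j <= SN (S N) t i j.
Proof.
  intros Ht. destruct (Nat.le_gt_cases j N) as [Hj|Hj].
  2:{ rewrite SN_out by now right. now apply SN_ge0. }
  pose proof (derive_nonpos_decr _ _ 0 t Ht
    (fun s _ => gsem_interpolation N (S N) (genN N) (genN (S N)) t s i j
       (Nat.le_succ_diag_r N) (genN_out N) (genN_out (S N)))) as H.
  simpl in H.
  assert (Hle : forall s, 0 <= s <= t -> sm (fun l => sm (fun k =>
     gsem (S N) (genN (S N)) (t - s) i l * (genN N l k - genN (S N) l k)
       * gsem N (genN N) s k j) (S N)) (S N) <= 0).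
  { intros s Hs. rewrite <- (Rmult_0_l 0). eapply Rle_trans; [apply (sm_le _ (fun _ => 0))|].
    2:{ rewrite sm_zero; [lra|auto]. }
    intros l Hl. eapply Rle_trans; [apply (sm_le _ (fun _ => 0))|].
    2:{ rewrite sm_zero; [lra|auto]. }
    intros k Hk.
    assert (H1 : 0 <= gsem (S N) (genN (S N)) (t - s) i l) by (apply SN_ge0; lra).
    assert (H2 : 0 <= gsem N (genN N) s k j) by (apply SN_ge0; lra).
    destruct (Nat.eq_dec k (S N)) as [->|Hk'].
    - fold (SN N s (S N) j). rewrite SN_out by lia. lra.
    - assert (H3 : genN N l k - genN (S N) l k <= 0).
      { destruct (Nat.eq_dec l (S N)) as [->|Hl'].
        - rewrite genN_out by lia. pose proof (genN_off (S N) (S N) k). 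
          assert (H3 : S N <> k) by congruence. specialize (H0 H3). lra.
        - unfold genN. rewrite !below_in by lia. lra. }
      rewrite Rmult_assoc, (Rmult_comm (_ - _)), <- Rmult_assoc.
      assert (0 <= gsem (S N) (genN (S N)) (t - s) i l * gsem N (genN N) s k j)
        by now apply Rmult_le_pos.
      clear - H0 H3. nra. }
  specialize (H Hle). clear Hle.
  fold (sm (fun l => gsem (S N) (genN (S N)) (t - t) i l * gsem N (genN N) t l j) (S N)) in H.
  match type of H with ?a <= ?b =>
    change a with (sm (fun l => gsem (S N) (genN (S N)) (t - t) i l * gsem N (genN N) t l j) (S N)) in H;
    change b with (sm (fun l => gsem (S N) (genN (S N)) (t - 0) i l * gsem N (genN N) 0 l j) (S N)) in H end.
  rewrite (sm_ext _ (fun l => below (S N) i * gsem N (genN N) t l j * kron l i)) in H.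
  2:{ intros l Hl. replace (t - t) with 0 by ring. rewrite gsem_0, kron_sym. ring. }
  rewrite (sm_ext (fun l => gsem (S N) (genN (S N)) (t - 0) i l * gsem N (genN N) 0 l j)
    (fun l => gsem (S N) (genN (S N)) t i l * below N l * kron l j)) in H.
  2:{ intros l Hl. rewrite Rminus_0_r, gsem_0. ring. }
  rewrite (sm_kron (fun l => gsem (S N) (genN (S N)) t i l * below N l)) in H by lia.
  rewrite (below_in N j), Rmult_1_r in H by exact Hj.
  destruct (Nat.le_gt_cases i (S N)) as [Hi|Hi].
  - rewrite (sm_kron (fun l => below (S N) i * gsem N (genN N) t l j)) in H by lia.
    rewrite below_in, Rmult_1_l in H by exact Hi. exact H.
  - rewrite SN_out by lia. now apply SN_ge0.
Qed.

Lemma genN_col N l : (l <= N)%nat -> sm (fun i => w i * genN N i l) N <= - c * wT l.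
Proof.
  intros Hl. pose proof (Hcol l N) as H.
  rewrite (sm_ext _ (fun i => w i * B i l - (w i * D i) * kron i l)).
  2:{ intros i Hi. unfold genN. rewrite !below_in by lia. ring. }
  rewrite sm_minus, (sm_kron (fun i => w i * D i)) by exact Hl.
  unfold wT. lra.
Qed.

(** A Lyapunov functional: by [genN_col] its derivative is nonpositive, and at time 0 it is at most
    [w j]. One inequality gives both the contraction in [w] and the gain of the factor [Th] by the
    time integral. *)
Lemma SN_col N t j : 0 <= t ->
  sm (fun i => w i * SN N t i j) N + c * sm (fun l => wT l * QN N t l j) N <= w j.
Proof.
  intros Ht.
  pose proof (derive_nonpos_decr
    (fun t => sm (fun i => w i * SN N t i j) N + c * sm (fun l => wT l * QN N t l j) N)
    (fun t => sm (fun i => w i * sm (fun l => genN N i l * SN N t l j) N) N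
              + c * sm (fun l => wT l * SN N t l j) N) 0 t Ht) as H.
  simpl in H.
  assert (Hd : forall s, 0 <= s <= t -> is_derive
    (fun t => sm (fun i => w i * SN N t i j) N + c * sm (fun l => wT l * QN N t l j) N) s
    (sm (fun i => w i * sm (fun l => genN N i l * SN N s l j) N) N
              + c * sm (fun l => wT l * SN N s l j) N)).
  { intros s _. apply is_derive_plusR.
    - apply (is_derive_sm (fun i t => w i * SN N t i j)). intros k _.
      apply (is_derive_scal (fun t => SN N t k j)). apply gsem_deriv_left, genN_out.
    - apply (is_derive_scal (fun t => sm (fun l => wT l * QN N t l j) N)).
      apply (is_derive_sm (fun l t => wT l * QN N t l j)). intros k _.
      apply (is_derive_scal (fun t => QN N t k j)). apply QN_deriv. }
  specialize (H Hd). clear Hd.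
  eapply Rle_trans; [apply H|].
  - intros s Hs.
    rewrite (sm_ext _ (fun i => sm (fun l => w i * (genN N i l * SN N s l j)) N)).
    2:{ intros i _. now rewrite sm_scal. }
    rewrite sm_switch, <- sm_scal, <- sm_plus.
    eapply Rle_trans; [apply (sm_le _ (fun _ => 0))|rewrite sm_zero; auto; lra].
    intros l Hl.
    rewrite (sm_ext _ (fun i => w i * genN N i l * SN N s l j)) by (intros; ring).
    rewrite sm_scal_r, <- Rmult_assoc, <- Rmult_plus_distr_r.
    pose proof (genN_col N l Hl). pose proof (SN_ge0 N s l j (proj1 Hs)).
    clear - H0 H1. nra.
  - rewrite (sm_zero (fun l => wT l * QN N 0 l j)).
    2:{ intros; rewrite QN_0; ring. }
    rewrite Rmult_0_r, Rplus_0_r.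
    eapply Rle_trans; [|apply (sm_kron_le w N j)].
    + apply sm_le. intros i Hi. rewrite SN_0, below_in by exact Hi. lra.
    + intros; apply Rlt_le, Hw.
Qed.

Lemma SN_bnd N t j : 0 <= t -> bnd w (fun i => SN N t i j) (w j).
Proof.
  intros Ht. split; [intros; now apply SN_ge0|]. intros I.
  eapply Rle_trans; [apply (sm_support_le _ N)|].
  - intros. apply Rmult_le_pos; [apply Rlt_le, Hw|now apply SN_ge0].
  - intros. rewrite SN_out by now left. ring.
  - pose proof (SN_col N t j Ht).
    assert (0 <= c * sm (fun l => wT l * QN N t l j) N); [|lra].
    apply Rmult_le_pos; [lra|]. apply sm_ge0; intros.
    apply Rmult_le_pos; [apply Rlt_le, wT_pos|now apply QN_ge0].
Qed.

Lemma QN_bnd_Th N t j : 0 <= t -> bnd wT (fun i => QN N t i j) (/ c * w j).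
Proof.
  intros Ht. split; [intros; now apply QN_ge0|]. intros I.
  eapply Rle_trans; [apply (sm_support_le _ N)|].
  - intros. apply Rmult_le_pos; [apply Rlt_le, wT_pos|now apply QN_ge0].
  - intros. rewrite QN_out by now left. ring.
  - pose proof (SN_col N t j Ht).
    assert (0 <= sm (fun i => w i * SN N t i j) N).
    { apply sm_ge0; intros. apply Rmult_le_pos; [apply Rlt_le, Hw|now apply SN_ge0]. }
    apply Rmult_le_reg_l with c; [exact Hc|].
    rewrite <- Rmult_assoc, Rinv_r, Rmult_1_l by lra. lra.
Qed.

Lemma QN_bnd_w N t j : 0 <= t -> bnd w (fun i => QN N t i j) (t * w j).
Proof.
  intros Ht. split; [intros; now apply QN_ge0|]. intros I.
  pose proof (derive_nonpos_decr
    (fun t => sm (fun i => w i * QN N t i j) I - t * w j)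
    (fun t => sm (fun i => w i * SN N t i j) I - 1 * w j) 0 t Ht) as H.
  simpl in H.
  rewrite (sm_zero (fun i => w i * QN N 0 i j)) in H.
  2:{ intros; rewrite QN_0; ring. }
  assert (sm (fun i => w i * QN N t i j) I - t * w j <= 0 - 0 * w j); [|lra].
  apply H.
  - intros s _. apply is_derive_minusR.
    + apply (is_derive_sm (fun i t => w i * QN N t i j)). intros k _.
      apply (is_derive_scal (fun t => QN N t k j)). apply QN_deriv.
    + apply (is_derive_scal_rR (fun t => t)). apply (is_derive_id s).
  - intros s Hs. pose proof (proj2 (SN_bnd N s j (proj1 Hs)) I). lra.
Qed.

(** A Lipschitz constant in time valid for all sections. It comes from the backward equation, which
    involves only column [j] of the generator, with the entries of row [i] of the semigroup bounded
    by [w l / w i]. *)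
Definition SLip (i j : nat) : R := (CB * wT j + D j * w j) / w i.

Lemma SN_le N t i j : 0 <= t -> SN N t i j <= w j / w i.
Proof.
  intros Ht. pose proof (bnd_term w _ _ i Hw (SN_bnd N t j Ht)) as H. simpl in H.
  apply Rmult_le_reg_l with (w i); [apply Hw|].
  replace (w i * (w j / w i)) with (w j) by (field; apply Rgt_not_eq, Hw). exact H.
Qed.

Lemma SN_Lip N i j s t : 0 <= s -> 0 <= t ->
  Rabs (SN N t i j - SN N s i j) <= SLip i j * Rabs (t - s).
Proof.
  intros Hs Ht.
  apply (Lipschitz_of_derive (fun t => SN N t i j)
    (fun t => sm (fun l => SN N t i l * genN N l j) N)).
  intros r Hr. split; [apply gsem_deriv_right, genN_out|].
  assert (Hr0 : 0 <= r).
  { destruct Hr as [Hr _]. eapply Rle_trans; [|exact Hr]. now apply Rmin_glb. }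
  eapply Rle_trans; [apply sm_abs|].
  apply Rle_trans with (/ w i * sm (fun l => w l * B l j + w l * D l * kron l j) N).
  - rewrite <- sm_scal. apply sm_le. intros l Hl. rewrite Rabs_mult.
    rewrite (Rabs_pos_eq (SN N r i l)) by now apply SN_ge0.
    replace (/ w i * (w l * B l j + w l * D l * kron l j))
      with (w l / w i * (B l j + D l * kron l j)) by (field; apply Rgt_not_eq, Hw).
    apply Rmult_le_compat; [now apply SN_ge0|apply Rabs_pos|now apply SN_le|].
    unfold genN. rewrite !Rabs_mult.
    pose proof (below_01 N l). pose proof (below_01 N j).
    rewrite !(Rabs_pos_eq (below _ _)) by lra.
    assert (HX : Rabs (B l j - kron l j * D l) <= B l j + D l * kron l j).
    { unfold Rminus. eapply Rle_trans; [apply Rabs_triang|].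
      rewrite Rabs_Ropp, !Rabs_pos_eq; [lra| |apply HB].
      apply Rmult_le_pos; [apply kron_ge0|apply HD]. }
    rewrite <- (Rmult_1_l (B l j + _)).
    apply Rmult_le_compat; [apply Rmult_le_pos; lra|apply Rabs_pos| |exact HX].
    rewrite <- (Rmult_1_l 1). apply Rmult_le_compat; lra.
  - unfold SLip, Rdiv. rewrite Rmult_comm.
    apply Rmult_le_compat_r; [apply Rlt_le, Rinv_0_lt_compat, Hw|].
    rewrite sm_plus. apply Rplus_le_compat; [apply HcolB|].
    rewrite (Rmult_comm (D j)). apply (sm_kron_le (fun l => w l * D l)).
    intros; apply Rmult_le_pos; [apply Rlt_le, Hw|apply HD].
Qed.

(** * The limit semigroup and its time integral *)

(** Negative times are sent to 0: the limit is monotone and bounded only for nonnegative times, and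
    the entries become Lipschitz on the whole line. *)
Definition evo (t : R) (i j : nat) : R := real (Lim_seq (fun N => SN N (Rmax 0 t) i j)).
Definition ievo (t : R) (i j : nat) : R := RInt (fun s => evo s i j) 0 t.

Lemma evo_lim t i j : 0 <= t -> is_lim_seq (fun N => SN N t i j) (evo t i j).
Proof.
  intros Ht. unfold evo. rewrite Rmax_right by exact Ht.
  apply Lim_seq_correct', (ex_finite_lim_seq_incr _ (w j / w i)).
  - intros; now apply SN_incr.
  - intros; now apply SN_le.
Qed.

Lemma evo_Rmax t i j : evo (Rmax 0 t) i j = evo t i j.
Proof. unfold evo. now rewrite Rmax_right by apply Rmax_l. Qed.

Lemma evo_ge0 t i j : 0 <= evo t i j.
Proof.
  rewrite <- evo_Rmax. pose proof (Rmax_l 0 t).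
  exact (is_lim_seq_le _ _ 0 (evo (Rmax 0 t) i j)
    (fun N => SN_ge0 N _ i j H) (is_lim_seq_const 0) (evo_lim _ i j H)).
Qed.

Lemma evo_Lip i j s t : Rabs (evo t i j - evo s i j) <= SLip i j * Rabs (t - s).
Proof.
  rewrite <- (evo_Rmax t), <- (evo_Rmax s).
  pose proof (Rmax_l 0 t). pose proof (Rmax_l 0 s).
  apply Rle_trans with (SLip i j * Rabs (Rmax 0 t - Rmax 0 s)).
  - assert (HL := is_lim_seq_abs _ _ (is_lim_seq_minus' _ _ _ _
      (evo_lim (Rmax 0 t) i j H) (evo_lim (Rmax 0 s) i j H0))).
    exact (is_lim_seq_le _ _ _ _ (fun N => SN_Lip N i j _ _ H0 H) HL
      (is_lim_seq_const _)).
  - apply Rmult_le_compat_l; [|apply Rmax_0_Lipschitz].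
    apply Rmult_le_pos; [|apply Rlt_le, Rinv_0_lt_compat, Hw].
    apply Rplus_le_le_0_compat; apply Rmult_le_pos; auto; apply Rlt_le; [apply wT_pos|apply Hw].
Qed.

Lemma evo_cont i j t : continuous (fun s => evo s i j) t.
Proof. apply (Lipschitz_continuous _ (SLip i j)). intros; apply evo_Lip. Qed.

Lemma SLip_ge0 i j : 0 <= SLip i j.
Proof.
  pose proof (evo_Lip i j 0 1) as H. rewrite Rminus_0_r, Rabs_R1 in H.
  pose proof (Rabs_pos (evo 1 i j - evo 0 i j)). lra.
Qed.

Lemma QN_incr N t i j : 0 <= t -> QN N t i j <= QN (S N) t i j.
Proof.
  intros Ht. apply RInt_le; [exact Ht| | |].
  - apply continuous_ex_RInt; intros; apply SN_cont.
  - apply continuous_ex_RInt; intros; apply SN_cont.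
  - intros; apply SN_incr; lra.
Qed.

(** The limit passes under the integral because the Lipschitz constants do not depend on [N]:
    between two times the integrated error is at most the length times the sum of the error at one
    end, which tends to 0, and a multiple of the length. *)
Lemma ievo_lim t i j : 0 <= t -> is_lim_seq (fun N => QN N t i j) (ievo t i j).
Proof.
  intros Ht.
  assert (Hex : forall t, 0 <= t -> ex_finite_lim_seq (fun N => QN N t i j)).
  { intros r Hr. apply (ex_finite_lim_seq_incr _ (/ w i * (r * w j))).
    - intros; now apply QN_incr.
    - intros N. pose proof (bnd_term w _ _ i Hw (QN_bnd_w N r j Hr)) as H; simpl in H.
      apply Rmult_le_reg_l with (w i); [apply Hw|].
      rewrite <- Rmult_assoc, Rinv_r, Rmult_1_l; [exact H|apply Rgt_not_eq, Hw]. }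
  set (q t := real (Lim_seq (fun N => QN N (Rmax 0 t) i j))).
  assert (Hq : forall t, is_lim_seq (fun N => QN N (Rmax 0 t) i j) (q t)).
  { intros r. apply Lim_seq_correct', Hex, Rmax_l. }
  (* the defect [q - ievo] varies at most quadratically in time, hence is constant *)
  assert (H : q t - ievo (Rmax 0 t) i j = q 0 - ievo (Rmax 0 0) i j).
  { apply (quadratic_const (fun t => q t - ievo (Rmax 0 t) i j) (2 * SLip i j)).
    intros s r. pose proof (Rmax_l 0 s) as Hs. pose proof (Rmax_l 0 r) as Hr.
    set (s' := Rmax 0 s) in *. set (r' := Rmax 0 r) in *.
    assert (HN : forall N, Rabs ((QN N r' i j - ievo r' i j) - (QN N s' i j - ievo s' i j))
        <= (Rabs (SN N s' i j - evo s' i j) + 2 * SLip i j * Rabs (r' - s')) * Rabs (r' - s')).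
    { intros N.
      replace (QN N r' i j - ievo r' i j - (QN N s' i j - ievo s' i j))
        with (RInt (fun x => SN N x i j - evo x i j) s' r').
      2:{ rewrite RInt_minusR by (intros; first [apply SN_cont|apply evo_cont]).
          unfold QN, ievo.
          rewrite <- (RInt_ChaslesR (fun s => SN N s i j) 0 s' r') by (intros; apply SN_cont).
          rewrite <- (RInt_ChaslesR (fun s => evo s i j) 0 s' r') by (intros; apply evo_cont).
          eqR; ring. }
      apply abs_RInt_bound.
      - intros. apply (continuous_minus (fun x => SN N x i j) (fun x => evo x i j));
        [apply SN_cont|apply evo_cont].
      - intros x Hx.
        assert (Hx0 : 0 <= x) by (destruct Hx as [Hx _]; eapply Rle_trans; [|exact Hx]; now apply Rmin_glb).
        replace (SN N x i j - evo x i j) with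
          ((SN N s' i j - evo s' i j) + (SN N x i j - SN N s' i j) - (evo x i j - evo s' i j)) by ring.
        eapply Rle_trans; [apply Rabs_triang|]. rewrite Rabs_Ropp.
        eapply Rle_trans; [apply Rplus_le_compat_r, Rabs_triang|].
        assert (Hxx : Rabs (x - s') <= Rabs (r' - s')).
        { revert Hx. unfold Rmin, Rmax; destruct Rle_dec; intros Hx;
          unfold Rabs; repeat destruct Rcase_abs; lra. }
        pose proof (SN_Lip N i j s' x Hs Hx0) as H1.
        pose proof (evo_Lip i j s' x) as H2.
        pose proof (Rmult_le_compat_l (SLip i j) _ _ (SLip_ge0 i j) Hxx). lra. }
    assert (HL1 : is_lim_seq (fun N => Rabs ((QN N r' i j - ievo r' i j) - (QN N s' i j - ievo s' i j)))
        (Rabs ((q r - ievo r' i j) - (q s - ievo s' i j)))).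
    { apply (is_lim_seq_abs _ (Finite ((q r - ievo r' i j) - (q s - ievo s' i j)))).
      apply is_lim_seq_minus'; apply is_lim_seq_minus'; try apply is_lim_seq_const; apply Hq. }
    assert (HL2 : is_lim_seq (fun N => (Rabs (SN N s' i j - evo s' i j)
           + 2 * SLip i j * Rabs (r' - s')) * Rabs (r' - s'))
        ((0 + 2 * SLip i j * Rabs (r' - s')) * Rabs (r' - s'))).
    { apply (is_lim_seq_scal_r _ (Rabs (r' - s')) (Finite (0 + 2 * SLip i j * Rabs (r' - s')))).
      apply is_lim_seq_plus'; [|apply is_lim_seq_const].
      rewrite <- Rabs_R0. apply (is_lim_seq_abs _ (Finite 0)).
      rewrite <- (Rminus_diag (evo s' i j)).
      apply is_lim_seq_minus'; [now apply evo_lim|apply is_lim_seq_const]. }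
    eapply Rle_trans; [exact (is_lim_seq_le _ _ _ _ HN HL1 HL2)|].
    rewrite Rplus_0_l, Rmult_assoc.
    apply Rmult_le_compat_l; [pose proof (SLip_ge0 i j); lra|].
    rewrite <- pow2_abs. simpl. rewrite Rmult_1_r.
    pose proof (Rmax_0_Lipschitz s r).
    apply Rmult_le_compat; try apply Rabs_pos; assumption. }
  rewrite (Rmax_right 0 t), (Rmax_right 0 0) in H by lra.
  assert (q 0 = 0).
  { unfold q. rewrite Rmax_right by lra.
    rewrite (Lim_seq_ext _ (fun _ => 0)) by (intros; apply QN_0).
    now rewrite Lim_seq_const. }
  assert (ievo 0 i j = 0) by apply RInt_pointR.
  replace (ievo t i j) with (q t) by lra.
  specialize (Hq t). now rewrite (Rmax_right 0 t) in Hq by lra.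
Qed.

Lemma QN_le_ievo N t i j : 0 <= t -> QN N t i j <= ievo t i j.
Proof.
  intros Ht. apply (is_lim_seq_incr_compare (fun N => QN N t i j)); [now apply ievo_lim|].
  intros; now apply QN_incr.
Qed.

Lemma ievo_bnd_w t j : 0 <= t -> bnd w (fun i => ievo t i j) (t * w j).
Proof.
  intros Ht. apply (bnd_lim w (fun N i => QN N t i j)).
  - intros; now apply QN_bnd_w.
  - intros; now apply ievo_lim.
Qed.

Lemma ievo_bnd_Th t j : 0 <= t -> bnd wT (fun i => ievo t i j) (/ c * w j).
Proof.
  intros Ht. apply (bnd_lim wT (fun N i => QN N t i j)).
  - intros; now apply QN_bnd_Th.
  - intros; now apply ievo_lim.
Qed.

Lemma ievo_mono s t i j : 0 <= s <= t -> ievo s i j <= ievo t i j.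
Proof.
  intros Hs. unfold ievo. rewrite <- (RInt_ChaslesR _ 0 s t) by (intros; apply evo_cont).
  assert (0 <= RInt (fun s => evo s i j) s t); [|lra].
  apply RInt_nonneg; [lra|intros; apply evo_cont|intros; apply evo_ge0].
Qed.

(** The integrated form contains no time derivative, so it can pass to the limit in [N]. *)
Lemma SN_forward N t i j :
  SN N t i j = below N i * kron i j + sm (fun l => genN N i l * QN N t l j) N.
Proof.
  pose proof (Lipschitz_of_derive
    (fun t => SN N t i j - sm (fun l => genN N i l * QN N t l j) N) (fun _ => 0) 0 0 t) as H.
  cut (Rabs ((SN N t i j - sm (fun l => genN N i l * QN N t l j) N) -
    (SN N 0 i j - sm (fun l => genN N i l * QN N 0 l j) N)) <= 0 * Rabs (t - 0)).
  - intros H1. rewrite Rmult_0_l in H1. apply Rabs_le_between in H1.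
    rewrite SN_0, (sm_zero (fun l => genN N i l * QN N 0 l j)) in H1; [lra|].
    intros; rewrite QN_0; ring.
  - apply H. intros s _. split; [|rewrite Rabs_R0; lra].
    eapply is_derive_eq; [apply is_derive_minusR|].
    + apply gsem_deriv_left, genN_out.
    + apply (is_derive_sm (fun l t => genN N i l * QN N t l j)). intros k _.
      apply (is_derive_scal (fun t => QN N t k j)). apply QN_deriv.
    + unfold SN. eqR. ring.
Qed.

Lemma SN_backward N t i j :
  SN N t i j = below N i * kron i j + sm (fun l => QN N t i l * genN N l j) N.
Proof.
  pose proof (Lipschitz_of_derive
    (fun t => SN N t i j - sm (fun l => QN N t i l * genN N l j) N) (fun _ => 0) 0 0 t) as H.
  cut (Rabs ((SN N t i j - sm (fun l => QN N t i l * genN N l j) N) -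
    (SN N 0 i j - sm (fun l => QN N 0 i l * genN N l j) N)) <= 0 * Rabs (t - 0)).
  - intros H1. rewrite Rmult_0_l in H1. apply Rabs_le_between in H1.
    rewrite SN_0, (sm_zero (fun l => QN N 0 i l * genN N l j)) in H1; [lra|].
    intros; rewrite QN_0; ring.
  - apply H. intros s _. split; [|rewrite Rabs_R0; lra].
    eapply is_derive_eq; [apply is_derive_minusR|].
    + apply gsem_deriv_right, genN_out.
    + apply (is_derive_sm (fun l t => QN N t i l * genN N l j)). intros k _.
      apply (is_derive_scal_rR (fun t => QN N t i k)). apply QN_deriv.
    + unfold SN. eqR. ring.
Qed.

Lemma genN_le_B N i l : genN N i l <= B i l.
Proof.
  unfold genN. pose proof (below_01 N i). pose proof (below_01 N l).
  assert (0 <= kron i l * D i) by (apply Rmult_le_pos; [apply kron_ge0|apply HD]).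
  specialize (HB i l).
  apply Rle_trans with (below N i * below N l * B i l).
  - apply Rmult_le_compat_l; [apply Rmult_le_pos; lra|lra].
  - rewrite <- (Rmult_1_l (B i l)) at 2. apply Rmult_le_compat_r; [exact HB|].
    rewrite <- (Rmult_1_l 1). apply Rmult_le_compat; lra.
Qed.

Lemma BQ_bnd t j : 0 <= t ->
  (forall i, ex_series (fun l => B i l * ievo t l j)) /\
  bnd w (fun i => Series (fun l => B i l * ievo t l j)) (CB * (/ c * w j)).
Proof.
  intros Ht. apply (mat_vec w wT); auto using wT_pos, ievo_bnd_Th.
Qed.

Lemma QB_bnd t j : 0 <= t ->
  (forall i, ex_series (fun l => ievo t i l * B l j)) /\
  bnd wT (fun i => Series (fun l => ievo t i l * B l j)) (/ c * (CB * wT j)).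
Proof.
  intros Ht. apply (mat_vec wT w (fun l => B l j) (ievo t)); auto using wT_pos, ievo_bnd_Th.
  - apply Rlt_le, Rinv_0_lt_compat, Hc.
  - intros i l. apply (ievo_bnd_Th t l Ht).
Qed.

(** The limit of [SN_forward]. Since [QN] increases to [ievo], the limiting series is its own
    majorant; it is finite because [ievo] gains exactly the factor [Th] that [B] costs. *)
Lemma evo_forward t i j : 0 <= t ->
  is_series (fun l => B i l * ievo t l j) (evo t i j - kron i j + D i * ievo t i j).
Proof.
  intros Ht. destruct (BQ_bnd t j Ht) as [Hex _].
  assert (Hser := is_lim_seq_Series_DCT (fun N l => B i l * QN N t l j)
    (fun l => B i l * ievo t l j) (fun l => B i l * ievo t l j) (Hex i)).
  assert (HL : is_lim_seq (fun N => Series (fun l => B i l * QN N t l j))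
     (evo t i j - kron i j + D i * ievo t i j)).
  { apply (is_lim_seq_incr_n _ i).
    apply is_lim_seq_ext with
      (fun n => SN (n + i) t i j - kron i j + D i * QN (n + i) t i j).
    - intros n. set (N := (n + i)%nat).
      rewrite (Series_support _ N).
      2:{ intros l Hl. rewrite QN_out by now left. ring. }
      rewrite SN_forward, below_in by (unfold N; lia).
      rewrite (sm_ext (fun l => genN N i l * QN N t l j)
        (fun l => B i l * QN N t l j - D i * QN N t l j * kron l i)).
      2:{ intros l Hl. unfold genN. rewrite !below_in by (unfold N in *; lia).
          rewrite (kron_sym i l). ring. }
      rewrite sm_minus, (sm_kron (fun l => D i * QN N t l j)) by (unfold N; lia). ring.
    - apply is_lim_seq_plus'.
      + apply is_lim_seq_minus'; [|apply is_lim_seq_const].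
        apply (is_lim_seq_incr_n (fun N => SN N t i j) i), evo_lim, Ht.
      + apply (is_lim_seq_scal_l _ (D i) (Finite (ievo t i j))).
        apply (is_lim_seq_incr_n (fun N => QN N t i j) i), ievo_lim, Ht. }
  assert (Heq : Series (fun l => B i l * ievo t l j) = evo t i j - kron i j + D i * ievo t i j).
  { apply is_lim_seq_unique in HL. apply Rbar_finite_eq. rewrite <- HL.
    symmetry. apply is_lim_seq_unique, Hser.
    - intros N n. rewrite Rabs_pos_eq.
      + apply Rmult_le_compat_l; [apply HB|now apply QN_le_ievo].
      + apply Rmult_le_pos; [apply HB|now apply QN_ge0].
    - intros n. apply (is_lim_seq_scal_l _ (B i n) (Finite (ievo t n j))), ievo_lim, Ht. }
  rewrite <- Heq. apply Series_correct, Hex.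
Qed.

(* The Duhamel formulas S <= I + QB and S <= I + BQ, with Q the time integral of
   the semigroup S, bound S(t) by [sgm] uniformly in time; then
   t S(t) = int_0^t S(t-s) S(s) ds is bounded by [rhm]. *)
Definition sgm (i j : nat) : R :=
  Rmin (kron i j + Series (fun l => ievo 1 i l * B l j))
       (kron i j + Series (fun l => B i l * ievo 1 l j)).

Lemma ievo_ge0 t i j : 0 <= t -> 0 <= ievo t i j.
Proof. intros Ht. apply (ievo_bnd_w t j Ht). Qed.

Lemma SN_sgm N t i j : 0 <= t <= 1 -> SN N t i j <= sgm i j.
Proof.
  intros Ht.
  assert (Hk : below N i * kron i j <= kron i j).
  { pose proof (below_01 N i). pose proof (kron_ge0 i j).
    rewrite <- (Rmult_1_l (kron i j)) at 2. apply Rmult_le_compat_r; lra. }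
  apply Rmin_glb.
  - rewrite SN_backward. apply Rplus_le_compat; [exact Hk|].
    destruct (QB_bnd 1 j ltac:(lra)) as [Hex _].
    eapply Rle_trans; [|apply (sm_le_Series _ N)].
    2:{ intros; apply Rmult_le_pos; [apply ievo_ge0; lra|apply HB]. }
    2:{ apply Hex. }
    apply sm_le. intros l Hl.
    apply Rle_trans with (QN N t i l * B l j).
    + apply Rmult_le_compat_l; [apply QN_ge0; lra|apply genN_le_B].
    + apply Rmult_le_compat_r; [apply HB|].
      eapply Rle_trans; [apply QN_le_ievo|apply ievo_mono]; lra.
  - rewrite SN_forward. apply Rplus_le_compat; [exact Hk|].
    destruct (BQ_bnd 1 j ltac:(lra)) as [Hex _].
    eapply Rle_trans; [|apply (sm_le_Series _ N)].
    2:{ intros; apply Rmult_le_pos; [apply HB|apply ievo_ge0; lra]. }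
    2:{ apply Hex. }
    apply sm_le. intros l Hl.
    apply Rle_trans with (B i l * QN N t l j).
    + apply Rmult_le_compat_r; [apply QN_ge0; lra|apply genN_le_B].
    + apply Rmult_le_compat_l; [apply HB|].
      eapply Rle_trans; [apply QN_le_ievo|apply ievo_mono]; lra.
Qed.

Lemma kron_bnd v j : (forall i, 0 < v i) -> bnd v (fun i => kron i j) (v j).
Proof.
  intros Hv. split; [intros; apply kron_ge0|]. intros I.
  apply sm_kron_le. intros; apply Rlt_le, Hv.
Qed.

Let Cs := 1 + CB / c.

Lemma sgm_ge0 i j : 0 <= sgm i j.
Proof.
  apply Rmin_glb; apply Rplus_le_le_0_compat; try apply kron_ge0; apply Series_ge0.
  - intros; apply Rmult_le_pos; [apply ievo_ge0; lra|apply HB].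
  - apply QB_bnd; lra.
  - intros; apply Rmult_le_pos; [apply HB|apply ievo_ge0; lra].
  - apply BQ_bnd; lra.
Qed.

(** The reason for a minimum in [sgm]: in the product of [B] and the time integral, integrating
    first raises [w] to [wT] and [B] returns to [w]. The product in the other order is bounded in
    [wT], which is [sgm_bnd_Th]. Neither product alone is shown to serve both weights. *)
Lemma sgm_bnd_w j : bnd w (fun i => sgm i j) (Cs * w j).
Proof.
  apply (bnd_le w _ (fun i => kron i j + Series (fun l => B i l * ievo 1 l j))).
  - exact Hw.
  - intros i. split; [apply sgm_ge0|apply Rmin_r].
  - replace (Cs * w j) with (w j + CB * (/ c * w j)) by (unfold Cs; field; lra).
    apply bnd_plus; [now apply kron_bnd|apply BQ_bnd; lra].
Qed.

Lemma sgm_bnd_Th j : bnd wT (fun i => sgm i j) (Cs * wT j).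
Proof.
  apply (bnd_le wT _ (fun i => kron i j + Series (fun l => ievo 1 i l * B l j))).
  - exact wT_pos.
  - intros i. split; [apply sgm_ge0|apply Rmin_l].
  - replace (Cs * wT j) with (wT j + / c * (CB * wT j)) by (unfold Cs; field; lra).
    apply bnd_plus; [apply kron_bnd, wT_pos|apply QB_bnd; lra].
Qed.

Definition rhm (i j : nat) : R := Series (fun l => sgm i l * ievo 1 l j).

Let Cs_pos : 0 < Cs.
Proof.
  unfold Cs. assert (0 <= CB / c); [|lra].
  apply Rmult_le_pos; [exact HCB|apply Rlt_le, Rinv_0_lt_compat, Hc].
Qed.

(** The integral up to time 1 maps weight [w] to [wT], and [sgm] preserves [wT]. *)
Lemma rhm_bnd j :
  (forall i, ex_series (fun l => sgm i l * ievo 1 l j)) /\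
  bnd wT (fun i => rhm i j) (Cs / c * w j).
Proof.
  replace (Cs / c * w j) with (Cs * (/ c * w j)) by (unfold Rdiv; ring).
  apply (mat_vec wT wT); auto using wT_pos, Rlt_le, Cs_pos, sgm_ge0, sgm_bnd_Th.
  apply ievo_bnd_Th; lra.
Qed.

Lemma SN_semigroup N t s i j :
  0 <= s <= t -> SN N t i j = sm (fun l => SN N (t - s) i l * SN N s l j) N.
Proof.
  intros Hs. destruct (Nat.le_gt_cases j N) as [Hj|Hj].
  2:{ rewrite SN_out by now right. symmetry. apply sm_zero. intros l _.
      rewrite (SN_out N s) by now right. ring. }
  pose proof (Lipschitz_of_derive
    (fun s => sm (fun l => SN N (t - s) i l * SN N s l j) N) (fun _ => 0) 0 0 s) as H.
  cut (Rabs (sm (fun l => SN N (t - s) i l * SN N s l j) N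
    - sm (fun l => SN N (t - 0) i l * SN N 0 l j) N) <= 0 * Rabs (s - 0)).
  - intros H1. rewrite Rmult_0_l in H1. apply Rabs_le_between in H1.
    rewrite (sm_ext (fun l => SN N (t - 0) i l * SN N 0 l j) (fun l => SN N t i l * kron l j)) in H1.
    + rewrite (sm_kron (fun l => SN N t i l)) in H1 by exact Hj. lra.
    + intros l Hl. rewrite Rminus_0_r, SN_0, below_in by exact Hl. ring.
  - apply H. intros r _. split; [|rewrite Rabs_R0; lra].
    eapply is_derive_eq.
    + apply (gsem_interpolation N N (genN N) (genN N)); auto using genN_out.
    + apply sm_zero. intros l _. apply sm_zero. intros k _. ring.
Qed.

Lemma SN_rhm N t i j : 0 <= t <= 1 -> t * SN N t i j <= rhm i j.
Proof.
  intros Ht.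
  (* With [t] fixed, monotonicity in [s] takes the place of integrating the semigroup law: [SN N t]
     is the product of [SN N (t - s)], at most [sgm], and [SN N s]. *)
  pose proof (derive_nonpos_decr
    (fun s => s * SN N t i j - sm (fun l => sgm i l * QN N s l j) N)
    (fun s => 1 * SN N t i j - sm (fun l => sgm i l * SN N s l j) N) 0 t (proj1 Ht)) as H.
  simpl in H.
  rewrite (sm_zero (fun l => sgm i l * QN N 0 l j)) in H.
  2:{ intros; rewrite QN_0; ring. }
  assert (H' : t * SN N t i j - sm (fun l => sgm i l * QN N t l j) N <= 0 * SN N t i j - 0).
  { apply H.
    - intros s _. apply is_derive_minusR.
      + apply (is_derive_scal_rR (fun s => s)). apply (is_derive_id s).
      + apply (is_derive_sm (fun l t => sgm i l * QN N t l j)). intros k _.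
        apply (is_derive_scal (fun t => QN N t k j)). apply QN_deriv.
    - intros s Hs. rewrite Rmult_1_l, (SN_semigroup N t s i j Hs).
      cut (sm (fun l => SN N (t - s) i l * SN N s l j) N
           <= sm (fun l => sgm i l * SN N s l j) N); [lra|].
      apply sm_le. intros l _. apply Rmult_le_compat_r; [apply SN_ge0; lra|].
      apply SN_sgm; lra. }
  apply Rle_trans with (sm (fun l => sgm i l * QN N t l j) N); [lra|].
  apply Rle_trans with (sm (fun l => sgm i l * ievo 1 l j) N).
  - apply sm_le. intros l _. apply Rmult_le_compat_l; [apply sgm_ge0|].
    eapply Rle_trans; [apply QN_le_ievo|apply ievo_mono]; lra.
  - apply sm_le_Series; [|apply rhm_bnd].
    intros; apply Rmult_le_pos; [apply sgm_ge0|apply ievo_ge0; lra].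
Qed.

Lemma evo_0 i j : evo 0 i j = kron i j.
Proof.
  assert (H := evo_lim 0 i j (Rle_refl 0)).
  apply is_lim_seq_unique in H. apply Rbar_finite_eq. rewrite <- H.
  apply is_lim_seq_unique. apply (is_lim_seq_incr_n _ i).
  apply is_lim_seq_ext with (fun _ => kron i j); [|apply is_lim_seq_const].
  intros n. rewrite SN_0, below_in by lia. ring.
Qed.

Lemma evo_Lip_ex i j : exists L, forall s t, Rabs (evo t i j - evo s i j) <= L * Rabs (t - s).
Proof. exists (SLip i j). intros; apply evo_Lip. Qed.

Lemma evo_sgm t i j : 0 <= t <= 1 -> evo t i j <= sgm i j.
Proof.
  intros Ht. exact (is_lim_seq_le _ _ (evo t i j) (sgm i j)
    (fun N => SN_sgm N t i j Ht) (evo_lim t i j (proj1 Ht)) (is_lim_seq_const _)).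
Qed.

Lemma evo_rhm t i j : 0 <= t <= 1 -> t * evo t i j <= rhm i j.
Proof.
  intros Ht. refine (is_lim_seq_le _ _ (t * evo t i j) (rhm i j)
    (fun N => SN_rhm N t i j Ht) _ (is_lim_seq_const _)).
  apply (is_lim_seq_scal_l _ t (Finite (evo t i j))), evo_lim, Ht.
Qed.

(** * Interpolation between the weights *)

Definition wal (i : nat) : R := Rpower (Th i) alpha * w i.

Lemma wal_pos i : 0 < wal i.
Proof. apply Rmult_lt_0_compat; [apply exp_pos|apply Hw]. Qed.

Lemma w_le_wal i : w i <= wal i.
Proof.
  unfold wal. rewrite <- (Rmult_1_l (w i)) at 1.
  apply Rmult_le_compat_r; [apply Rlt_le, Hw|].
  specialize (HTh i). rewrite <- (Rpower_O (Th i)) by lra. apply Rle_Rpower; lra.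
Qed.

(* Replaces Hoelder's inequality; [m] will be [Th j] or [1/T]. *)
Lemma wal_interp m i : 0 < m ->
  wal i <= Rpower m alpha * w i + Rpower m alpha / m * wT i.
Proof.
  intros Hm. unfold wal, wT.
  assert (HT : 0 < Th i) by (specialize (HTh i); lra).
  assert (Hr : 0 < Th i / m) by now apply Rdiv_lt_0_compat.
  replace (Rpower (Th i) alpha) with (Rpower m alpha * Rpower (Th i / m) alpha).
  2:{ rewrite Rpower_mult_distr by assumption. f_equal. field. lra. }
  replace (Rpower m alpha * w i + Rpower m alpha / m * (Th i * w i))
    with (Rpower m alpha * (1 + Th i / m) * w i) by (field; lra).
  apply Rmult_le_compat_r; [apply Rlt_le, Hw|].
  apply Rmult_le_compat_l; [apply Rlt_le, exp_pos|].
  apply Rpower_le_1plus; lra.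
Qed.

(** The choice [m = Th j] in [wal_interp] balances the bounds in [w] and [wT]: each contributes
    [Cs * wal j]. *)
Lemma sgm_bnd_al j : bnd wal (fun i => sgm i j) (2 * Cs * wal j).
Proof.
  assert (HT : 0 < Th j) by (specialize (HTh j); lra).
  replace (2 * Cs * wal j) with
    (Rpower (Th j) alpha * (Cs * w j) + Rpower (Th j) alpha / Th j * (Cs * (Th j * w j)))
    by (unfold wal; field; lra).
  apply (bnd_weight_comb wal w wT).
  - intros i. now apply wal_interp.
  - apply Rlt_le, exp_pos.
  - apply Rlt_le, Rdiv_lt_0_compat; [apply exp_pos|exact HT].
  - apply sgm_bnd_w.
  - apply sgm_bnd_Th.
Qed.

Definition eta (T : R) : R := Rpower T (1 - alpha) * (1 + / c).

Lemma eta_pos T : 0 < eta T.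
Proof.
  apply Rmult_lt_0_compat; [apply exp_pos|].
  assert (0 < / c) by now apply Rinv_0_lt_compat. lra.
Qed.

Lemma eta_small eps : 0 < eps -> exists T, 0 < T <= 1 /\ eta T <= eps.
Proof.
  intros He. assert (Hc1 : 0 < 1 + / c) by (pose proof (Rinv_0_lt_compat c Hc); lra).
  set (e := eps / (1 + / c)).
  assert (Hep : 0 < e) by now apply Rdiv_lt_0_compat.
  exists (Rmin 1 (Rpower e (/ (1 - alpha)))). split; [split|].
  - apply Rmin_glb_lt; [lra|apply exp_pos].
  - apply Rmin_l.
  - unfold eta. apply Rle_trans with (e * (1 + / c)).
    + apply Rmult_le_compat_r; [lra|].
      apply Rle_trans with (Rpower (Rpower e (/ (1 - alpha))) (1 - alpha)).
      * apply Rle_Rpower_l; [lra|]. split; [|apply Rmin_r].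
        apply Rmin_glb_lt; [lra|apply exp_pos].
      * rewrite Rpower_mult, Rinv_l, Rpower_1 by lra. lra.
    + unfold e. apply Req_le. field. lra.
Qed.

(** The choice [m = / T] in [wal_interp] weighs the bound [T] in [w] against [/ c] in [wT]; the
    common power of [T] is [1 - alpha], positive, hence small for small [T]. *)
Lemma ievo_bnd_al T j : 0 < T -> bnd wal (fun i => ievo T i j) (eta T * w j).
Proof.
  intros HT.
  assert (Hi : 0 < / T) by now apply Rinv_0_lt_compat.
  assert (E : Rpower T (1 - alpha) = Rpower (/ T) alpha * T).
  { unfold Rminus. rewrite Rpower_plus, Rpower_1, Rpower_Ropp by exact HT.
    rewrite Rmult_comm. f_equal. unfold Rpower. rewrite <- exp_Ropp, ln_Rinv by exact HT.
    f_equal. ring. }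
  replace (eta T * w j) with
    (Rpower (/ T) alpha * (T * w j) + Rpower (/ T) alpha / (/ T) * (/ c * w j)).
  2:{ unfold eta. rewrite E. field. split; lra. }
  apply (bnd_weight_comb wal w wT).
  - intros i. now apply wal_interp.
  - apply Rlt_le, exp_pos.
  - apply Rlt_le, Rdiv_lt_0_compat; [apply exp_pos|exact Hi].
  - apply ievo_bnd_w; lra.
  - apply ievo_bnd_Th; lra.
Qed.

(** The common ground of existence and uniqueness. The weight [wT] and the equation are required
    only at interior times, because the initial datum is controlled only in [wal]. *)
Definition strong_solution (G : (nat -> R) -> nat -> R) (T : R) (z z' : R -> nat -> R) : Prop :=
  (forall t, 0 <= t <= T -> ex_series (fun i => wal i * Rabs (z t i))) /\
  norm_cont_on (fun t => 0 <= t <= T) wal z /\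
  (forall t, 0 < t < T ->
     ex_series (fun i => wT i * Rabs (z t i)) /\
     ex_series (fun i => w i * Rabs (z' t i)) /\
     (forall i, z' t i = - D i * z t i + Series (fun l => B i l * z t l) + G (z t) i) /\
     forall eps, 0 < eps -> exists delta, 0 < delta /\
       forall v, 0 < v < T -> v <> t -> Rabs (v - t) < delta ->
         Series (fun i => w i * Rabs ((z v i - z t i) / (v - t) - z' t i)) < eps).

(** * Mild solutions on a short time interval *)

Section Mild.
Variable T : R.
Hypothesis HT : 0 < T <= 1.

(** The free evolution and, in [Vduh], the Duhamel integral of the variation of constants formula.
    The latter is written as a series of scalar convolutions over the source index, so no integral
    of a sequence-valued function occurs. *)
Definition Afree (x0 : nat -> R) (t : R) (i : nat) : R :=
  Series (fun j => evo (clamp T t) i j * x0 j).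

Definition Vduh (h : R -> nat -> R) (t : R) (i : nat) : R :=
  Series (fun j => conv (fun s => evo s i j) (fun s => h s j) (clamp T t)).

Lemma Afree_term x0 t i j : 0 <= x0 j ->
  Rabs (evo (clamp T t) i j * x0 j) <= sgm i j * x0 j.
Proof.
  intros Hx. pose proof (clamp_range T t (proj1 HT)).
  rewrite Rabs_pos_eq.
  - apply Rmult_le_compat_r; [exact Hx|].
    apply evo_sgm. lra.
  - apply Rmult_le_pos; [apply evo_ge0|exact Hx].
Qed.

Lemma sgm_x0 x0 K : bnd wal x0 K ->
  (forall i, ex_series (fun j => sgm i j * x0 j)) /\
  bnd wal (fun i => Series (fun j => sgm i j * x0 j)) (2 * Cs * K).
Proof.
  intros H. apply (mat_vec wal wal); auto using wal_pos, sgm_ge0, sgm_bnd_al. lra.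
Qed.

Lemma Afree_maj x0 K : bnd wal x0 K -> maj wal (2 * Cs * K) (Afree x0).
Proof.
  intros H. destruct (sgm_x0 x0 K H) as [Hex Hb].
  eexists. split; [exact Hb|]. intros t i.
  apply Series_abs_le; [|apply Hex]. intros; apply Afree_term, H.
Qed.

Lemma Afree_ge0 x0 K t i : bnd wal x0 K -> 0 <= Afree x0 t i.
Proof.
  intros H. destruct (sgm_x0 x0 K H) as [Hex Hb].
  apply Series_ge0.
  - intros j. apply Rmult_le_pos; [apply evo_ge0|apply H].
  - apply (ex_series_dom _ (fun j => sgm i j * x0 j)); [|apply Hex].
    intros; apply Afree_term, H.
Qed.

Lemma Afree_cont x0 K : bnd wal x0 K -> traj_cont (Afree x0).
Proof.
  intros H i t. destruct (sgm_x0 x0 K H) as [Hex Hb].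
  apply (continuous_Series (fun t j => evo (clamp T t) i j * x0 j) (fun j => sgm i j * x0 j)).
  - apply Hex.
  - intros; apply Afree_term, H.
  - intros j. apply (continuous_mult (fun t => evo (clamp T t) i j) (fun _ => x0 j));
      [|apply continuous_const].
    apply (continuous_comp (clamp T) (fun s => evo s i j)); [apply clamp_cont|apply evo_cont].
Qed.

Lemma Afree_smooth x0 K : bnd w x0 K ->
  exists Y, bnd wT Y (Cs / c * K) /\ forall t i, clamp T t * Rabs (Afree x0 t i) <= Y i.
Proof.
  intros H.
  destruct (mat_vec wT w x0 rhm (Cs / c) K) as [Hex Hb]; auto using wT_pos.
  - apply Rlt_le, Rdiv_lt_0_compat; assumption.
  - intros i j. apply (rhm_bnd j).
  - apply rhm_bnd.
  - eexists. split; [exact Hb|]. intros t i.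
    pose proof (clamp_range T t (proj1 HT)).
    replace (clamp T t * Rabs (Afree x0 t i)) with
      (Rabs (Series (fun j => clamp T t * (evo (clamp T t) i j * x0 j)))).
    2:{ rewrite Series_scal_l, Rabs_mult, (Rabs_pos_eq (clamp T t)) by lra. reflexivity. }
    apply Series_abs_le; [|apply Hex]. intros j.
    rewrite <- Rmult_assoc, Rabs_pos_eq.
    + apply Rmult_le_compat_r; [apply H|].
      apply evo_rhm. lra.
    + apply Rmult_le_pos; [|apply H].
      apply Rmult_le_pos; [lra|apply evo_ge0].
Qed.

Lemma Vduh_term h H t i j : traj_cont h -> (forall t i, Rabs (h t i) <= H i) ->
  Rabs (conv (fun s => evo s i j) (fun s => h s j) (clamp T t)) <= ievo T i j * H j.
Proof.
  intros Hc' Hh. pose proof (clamp_range T t (proj1 HT)).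
  destruct (evo_Lip_ex i j) as [L HL].
  eapply Rle_trans.
  - apply (conv_bound _ _ L (H j) HL); auto; [lra|].
    intros; apply evo_ge0.
  - apply Rmult_le_compat_r; [eapply Rle_trans; [apply Rabs_pos|apply (Hh 0 j)]|].
    now apply ievo_mono.
Qed.

Lemma ievo_H v C H K : (forall i, 0 < v i) -> 0 <= C ->
  (forall j, bnd v (fun i => ievo T i j) (C * w j)) -> bnd w H K ->
  (forall i, ex_series (fun j => ievo T i j * H j)) /\
  bnd v (fun i => Series (fun j => ievo T i j * H j)) (C * K).
Proof.
  intros Hv HC Hb HH. apply (mat_vec v w); auto. intros; apply ievo_ge0; lra.
Qed.

Lemma Vduh_ex h H K i t : traj_cont h -> bnd w H K -> (forall t i, Rabs (h t i) <= H i) ->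
  ex_series (fun j => conv (fun s => evo s i j) (fun s => h s j) (clamp T t)).
Proof.
  intros Hc' HH Hh.
  destruct (ievo_H wal (eta T) H K) as [Hex _]; auto using wal_pos.
  - apply Rlt_le, eta_pos.
  - intros; now apply ievo_bnd_al.
  - apply (ex_series_dom _ (fun j => ievo T i j * H j)); [|apply Hex].
    intros; now apply Vduh_term.
Qed.

Lemma Vduh_maj_gen v C h K : (forall i, 0 < v i) -> 0 <= C ->
  (forall j, bnd v (fun i => ievo T i j) (C * w j)) ->
  traj_cont h -> maj w K h -> maj v (C * K) (Vduh h).
Proof.
  intros Hv HC Hb Hc' [H [HH Hh]].
  destruct (ievo_H v C H K Hv HC Hb HH) as [Hex Hbd].
  eexists. split; [exact Hbd|]. intros t i.
  apply Series_abs_le; [|apply Hex]. intros; now apply Vduh_term.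
Qed.

Lemma Vduh_maj h K : traj_cont h -> maj w K h -> maj wal (eta T * K) (Vduh h).
Proof.
  apply Vduh_maj_gen; [exact wal_pos|apply Rlt_le, eta_pos|].
  intros; now apply ievo_bnd_al.
Qed.

Lemma Vduh_maj_Th h K : traj_cont h -> maj w K h -> maj wT (/ c * K) (Vduh h).
Proof.
  apply Vduh_maj_gen; [exact wT_pos|apply Rlt_le, Rinv_0_lt_compat, Hc|].
  intros; apply ievo_bnd_Th; lra.
Qed.

Lemma Vduh_cont h K : traj_cont h -> maj w K h -> traj_cont (Vduh h).
Proof.
  intros Hc' [H [HH Hh]] i t.
  destruct (ievo_H wal (eta T) H K) as [Hex _]; auto using wal_pos.
  - apply Rlt_le, eta_pos.
  - intros; now apply ievo_bnd_al.
  - apply (continuous_Series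
      (fun t j => conv (fun s => evo s i j) (fun s => h s j) (clamp T t))
      (fun j => ievo T i j * H j)).
    + apply Hex.
    + intros; now apply Vduh_term.
    + intros j. destruct (evo_Lip_ex i j) as [L HL].
      apply (continuous_comp (clamp T) (conv (fun s => evo s i j) (fun s => h s j)));
        [apply clamp_cont|].
      apply (conv_cont _ _ L (H j) HL); auto.
Qed.

Lemma Vduh_ge0 h K t i : traj_cont h -> maj w K h -> (forall t i, 0 <= h t i) -> 0 <= Vduh h t i.
Proof.
  intros Hc' [H [HH Hh]] H0. apply Series_ge0; [|now apply (Vduh_ex h H K)].
  intros j. destruct (evo_Lip_ex i j) as [L HL].
  apply (conv_ge0 _ _ L HL); auto.
  - apply clamp_range, HT.
  - intros; apply evo_ge0.
Qed.

Lemma Vduh_minus h1 h2 K1 K2 t i : traj_cont h1 -> traj_cont h2 ->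
  maj w K1 h1 -> maj w K2 h2 ->
  Vduh h1 t i - Vduh h2 t i = Vduh (fun t i => h1 t i - h2 t i) t i.
Proof.
  intros C1 C2 [H1 [HH1 Hh1]] [H2 [HH2 Hh2]]. unfold Vduh.
  rewrite <- Series_minus; [|now apply (Vduh_ex h1 H1 K1)|now apply (Vduh_ex h2 H2 K2)].
  apply Series_ext. intros j. symmetry. apply conv_minus; auto. intros; apply evo_cont.
Qed.

Lemma traj_cont_minus h1 h2 : traj_cont h1 -> traj_cont h2 ->
  traj_cont (fun t i => h1 t i - h2 t i).
Proof.
  intros C1 C2 i t. apply (continuous_minus (fun t => h1 t i) (fun t => h2 t i)); auto.
Qed.

Lemma traj_cont_plus h1 h2 : traj_cont h1 -> traj_cont h2 ->
  traj_cont (fun t i => h1 t i + h2 t i).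
Proof.
  intros C1 C2 i t. apply (continuous_plus (fun t => h1 t i) (fun t => h2 t i)); auto.
Qed.

(** * Picard iteration *)

Section Picard.
Variables (G : (nat -> R) -> nat -> R) (R0 L K0 : R) (x0 : nat -> R).
Hypothesis HL : 0 <= L.
Hypothesis Hx0 : bnd wal x0 K0.
Hypothesis HR0 : 4 * Cs * K0 <= R0.
Hypothesis HetaL : eta T * L <= / 2.
Hypothesis HGL : maj_Lipschitz G wal w R0 L.
Hypothesis HGpos : forall x, (forall i, 0 <= x i) -> bnd wal x R0 -> forall i, 0 <= G x i.
Hypothesis HG0 : forall i, G (fun _ => 0) i = 0.

Let K1 := 2 * Cs * K0.

Fixpoint picard (n : nat) (t : R) (i : nat) : R :=
  match n with
  | O => 0
  | S n => Afree x0 t i + Vduh (fun s => G (picard n s)) t i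
  end.

Lemma K1_ge0 : 0 <= K1.
Proof.
  pose proof (bnd_Kge0 wal x0 K0 wal_pos Hx0).
  unfold K1. apply Rmult_le_pos; lra.
Qed.

Lemma R0_ge0 : 0 <= R0.
Proof.
  pose proof K1_ge0. unfold K1 in *. lra.
Qed.

Lemma maj_zero v K : 0 <= K -> maj v K (fun _ _ => 0).
Proof.
  intros HK. exists (fun _ => 0). split; [split|].
  - intros; lra.
  - intros I. rewrite sm_zero; [exact HK|intros; ring].
  - intros; rewrite Rabs_R0; lra.
Qed.

Lemma G_maj x : maj wal R0 x -> maj w (L * R0) (fun t => G (x t)).
Proof.
  intros Hx.
  apply (maj_ext w (L * R0) (fun t i => G (x t) i - G (fun _ => 0) i)).
  - intros; rewrite HG0; ring.
  - apply (HGL R0 x (fun _ _ => 0)); [apply R0_ge0|exact Hx|apply maj_zero, R0_ge0|].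
    apply (maj_ext wal R0 x); [intros; ring|exact Hx].
Qed.

Lemma G_cont x : maj wal R0 x -> traj_cont x -> traj_cont (fun t => G (x t)).
Proof. intros. apply (maj_Lipschitz_cont G wal w R0 L); auto using wal_pos. Qed.

Lemma pow_half_pos n : 0 < / 2 ^ n.
Proof. apply Rinv_0_lt_compat, pow_lt; lra. Qed.

(** The increments halve because [eta T * L <= / 2], so the iterates stay below
    [2 * K1 = 4 * Cs * K0], hence in the ball of radius [R0] where [G] is Lipschitz. Nonnegativity
    is carried along because [G] preserves it only on nonnegative sequences of that ball. *)
Lemma picard_inv n :
  traj_cont (picard n) /\ (forall t i, 0 <= picard n t i) /\
  maj wal (2 * K1 * (1 - / 2 ^ n)) (picard n) /\
  maj wal (K1 * / 2 ^ n) (fun t i => picard (S n) t i - picard n t i).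
Proof.
  pose proof K1_ge0 as HK1.
  assert (Hle : forall n, 2 * K1 * (1 - / 2 ^ n) <= R0).
  { intros m. pose proof (pow_half_pos m). unfold K1 in *. nra. }
  induction n as [|n [IHc [IHp [IHm IHd]]]].
  - split; [|split; [|split]].
    + intros i t. apply continuous_const.
    + intros; simpl; lra.
    + apply maj_zero. simpl. rewrite Rinv_1. lra.
    (* The first increment is the free evolution alone, since the iteration starts at 0 and [G]
       vanishes there. *)
    + replace (K1 * / 2 ^ 0) with (2 * Cs * K0) by (simpl; unfold K1; field).
      apply (maj_ext wal (2 * Cs * K0) (Afree x0)).
      * intros t i. simpl. rewrite Rminus_0_r.
        rewrite <- (Rplus_0_r (Afree x0 t i)) at 1. f_equal. symmetry.
        unfold Vduh. rewrite (Series_support _ 0).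
        -- simpl. unfold conv. rewrite (RInt_ext _ (fun _ => 0)).
           ++ rewrite RInt_const_R. ring.
           ++ intros; rewrite HG0; eqR; ring.
        -- intros j _. unfold conv. rewrite (RInt_ext _ (fun _ => 0)).
           ++ rewrite RInt_const_R. ring.
           ++ intros; rewrite HG0; eqR; ring.
      * now apply Afree_maj.
  - assert (HmR : maj wal R0 (picard n)) by (eapply maj_weaken; [exact IHm|apply Hle]).
    assert (Hcn : traj_cont (fun t => G (picard n t))) by now apply G_cont.
    assert (Hmn := G_maj _ HmR).
    assert (Hc' : traj_cont (picard (S n))).
    { apply traj_cont_plus; [now apply (Afree_cont x0 K0)|now apply (Vduh_cont _ (L * R0))]. }
    assert (Hm' : maj wal (2 * K1 * (1 - / 2 ^ (S n))) (picard (S n))).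
    { apply (maj_weaken _ (2 * K1 * (1 - / 2 ^ n) + K1 * / 2 ^ n)).
      - eapply maj_ext; [|apply (maj_plus _ _ _ _ _ IHm IHd)].
        intros; cbv beta; ring.
      - simpl. rewrite Rinv_mult. lra. }
    assert (Hp' : forall t i, 0 <= picard (S n) t i).
    { intros t i. simpl. apply Rplus_le_le_0_compat; [now apply (Afree_ge0 x0 K0)|].
      apply (Vduh_ge0 _ (L * R0)); auto. intros s j. apply HGpos; [apply IHp|].
      apply (bnd_le wal _ (fun i => Rabs (picard n s i))); [exact wal_pos| |now apply maj_bnd; [apply wal_pos|]].
      intros k; split; [apply IHp|apply Rle_abs]. }
    split; [exact Hc'|split; [exact Hp'|split; [exact Hm'|]]].
    assert (HmR' : maj wal R0 (picard (S n))) by (eapply maj_weaken; [exact Hm'|apply Hle]).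
    assert (Hcn' : traj_cont (fun t => G (picard (S n) t))) by now apply G_cont.
    assert (Hmn' := G_maj _ HmR').
    apply (maj_ext wal (K1 * / 2 ^ S n)
      (Vduh (fun t i => G (picard (S n) t) i - G (picard n t) i))).
    { intros t i.
      transitivity (Vduh (fun s => G (picard (S n) s)) t i - Vduh (fun s => G (picard n s)) t i).
      { symmetry. now apply (Vduh_minus _ _ (L * R0) (L * R0)). }
      change (picard (S (S n)) t i) with (Afree x0 t i + Vduh (fun s => G (picard (S n) s)) t i).
      change (picard (S n) t i) with (Afree x0 t i + Vduh (fun s => G (picard n s)) t i).
      ring. }
    apply (maj_weaken _ (eta T * (L * (K1 * / 2 ^ n)))).
    + apply Vduh_maj; [now apply traj_cont_minus|].
      apply HGL; auto. apply Rmult_le_pos; [exact HK1|apply Rlt_le, pow_half_pos].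
    + rewrite <- Rmult_assoc. simpl. rewrite Rinv_mult.
      pose proof (pow_half_pos n).
      replace (K1 * (/ 2 * / 2 ^ n)) with (/ 2 * (K1 * / 2 ^ n)) by ring.
      apply Rmult_le_compat_r; [apply Rmult_le_pos; lra|exact HetaL].
Qed.

Theorem mild_exists : exists x : R -> nat -> R,
  traj_cont x /\ (forall t i, 0 <= x t i) /\ maj wal R0 x /\
  forall t i, x t i = Afree x0 t i + Vduh (fun s => G (x s)) t i.
Proof.
  pose proof K1_ge0 as HK1.
  (* The majorants of all increments must be summed over [n], so one is selected for each [n]. *)
  assert (Hch : forall n, {Z : nat -> R | bnd wal Z (K1 * / 2 ^ n) /\
     forall t i, Rabs (picard (S n) t i - picard n t i) <= Z i}).
  { intros n. apply constructive_indefinite_description. apply picard_inv. }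
  set (Z n := proj1_sig (Hch n)).
  assert (HZ : forall n, bnd wal (Z n) (K1 * / 2 ^ n)) by (intros n; apply (proj2_sig (Hch n))).
  assert (HZd : forall n t i, Rabs (picard (S n) t i - picard n t i) <= Z n i)
    by (intros n; apply (proj2_sig (Hch n))).
  assert (Hgeo : forall N M, bnd wal (fun i => sm (fun n => Z n i) (N + M) - sm (fun n => Z n i) N)
             (K1 * (/ 2 ^ N - / 2 ^ (N + M)))).
  { intros N M. induction M as [|M IH].
    - rewrite Nat.add_0_r. apply (bnd_le wal _ (fun _ => 0)); [exact wal_pos|intros; lra|].
      split; [intros; lra|]. intros I. rewrite sm_zero; [lra|intros; ring].
    - apply (bnd_le wal _ (fun i => (sm (fun n => Z n i) (N + M) - sm (fun n => Z n i) N) + Z (S (N + M)) i)).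
      + exact wal_pos.
      + intros i. rewrite Nat.add_succ_r. simpl.
        pose proof (proj1 IH i). pose proof (proj1 (HZ (S (N + M))) i). lra.
      + eapply bnd_weaken; [apply (bnd_plus _ _ _ _ _ IH (HZ (S (N + M))))|].
        rewrite Nat.add_succ_r. simpl. rewrite Rinv_mult. lra. }
  assert (HZex : forall i, ex_series (fun n => Z n i)).
  { intros i. apply (ex_series_dom _ (fun n => K1 / wal i * (/ 2) ^ n)).
    - intros n. rewrite Rabs_pos_eq by apply HZ.
      pose proof (bnd_term wal _ _ i wal_pos (HZ n)) as Ht.
      apply Rmult_le_reg_l with (wal i); [apply wal_pos|].
      rewrite pow_inv.
      replace (wal i * (K1 / wal i * / 2 ^ n)) with (K1 * / 2 ^ n); [exact Ht|].
      field. split; [apply pow_nonzero; lra|apply Rgt_not_eq, wal_pos].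
    - apply (ex_series_scal_l (K1 / wal i) (fun n => (/ 2) ^ n)), ex_series_geom.
      rewrite Rabs_pos_eq; lra. }
  (* As a telescoping series the limit inherits from [Z] tail bounds that hold at all times
     simultaneously. *)
  set (x := fun t i => Series (fun n => picard (S n) t i - picard n t i)).
  assert (Hsum : forall n t i, sm (fun n => picard (S n) t i - picard n t i) n = picard (S n) t i).
  { intros n t i. induction n as [|n IH]; [simpl; ring|].
    change (sm (fun n => picard (S n) t i - picard n t i) n
      + (picard (S (S n)) t i - picard (S n) t i) = picard (S (S n)) t i).
    rewrite IH. ring. }
  assert (Hd : forall N, maj wal (K1 * / 2 ^ N) (fun t i => x t i - picard (S N) t i)).
  { intros N. exists (fun i => Series (fun n => Z n i) - sm (fun n => Z n i) N). split.
    - apply (bnd_lim wal (fun M i => sm (fun n => Z n i) (N + M) - sm (fun n => Z n i) N)).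
      + intros M. eapply bnd_weaken; [apply Hgeo|].
        apply Rmult_le_compat_l; [exact HK1|]. pose proof (pow_half_pos (N + M)). lra.
      + intros i. apply is_lim_seq_minus'; [|apply is_lim_seq_const].
        apply (is_lim_seq_ext (fun M => sm (fun n => Z n i) (M + N))).
        { intros M. now rewrite Nat.add_comm. }
        apply (is_lim_seq_incr_n (sm (fun n => Z n i)) N).
        apply is_series_sm, Series_correct, HZex.
    - intros t i. rewrite <- Hsum. apply Series_sm_tail; [intros; apply HZd|apply HZex]. }
  assert (Hxm : maj wal R0 x).
  { apply (maj_weaken _ (K1 * / 2 ^ 0 + K1)).
    - apply (maj_ext _ _ (fun t i => (x t i - picard 1 t i) + picard 1 t i)).
      { intros; ring. }
      apply (maj_plus _ _ _ _ _ (Hd 0%nat)).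
      destruct (picard_inv 1) as [_ [_ [H _]]].
      eapply maj_weaken; [exact H|]. simpl. lra.
    - simpl. rewrite Rinv_1. unfold K1. lra. }
  assert (Hxc : traj_cont x).
  { intros i t. apply (continuous_Series (fun t n => picard (S n) t i - picard n t i) (fun n => Z n i)).
    - apply HZex.
    - intros; apply HZd.
    - intros n. apply (continuous_minus (fun t => picard (S n) t i) (fun t => picard n t i)).
      + apply (picard_inv (S n)).
      + apply (picard_inv n). }
  assert (Hlim : forall t i, is_lim_seq (fun n => picard (S n) t i) (x t i)).
  { intros t i. apply (is_lim_seq_ext (sm (fun n => picard (S n) t i - picard n t i))).
    - intros n. apply Hsum.
    - apply is_series_sm, Series_correct.
      apply (ex_series_dom _ (fun n => Z n i)); [intros; apply HZd|apply HZex]. }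
  exists x. split; [exact Hxc|split; [|split; [exact Hxm|]]].
  - intros t i. exact (is_lim_seq_le _ _ 0 (x t i)
      (fun n => proj1 (proj2 (picard_inv (S n))) t i) (is_lim_seq_const 0) (Hlim t i)).
  - intros t i.
    assert (Hfix : is_lim_seq (fun n => picard (S (S n)) t i)
       (Afree x0 t i + Vduh (fun s => G (x s)) t i)).
    { apply is_lim_seq_spec. intros eps.
      assert (Hgeom : is_lim_seq (fun n => K1 / wal i * (/ 2) ^ n) 0).
      { apply ex_series_lim_0.
        apply (ex_series_scal_l (K1 / wal i) (fun n => (/ 2) ^ n)), ex_series_geom.
        rewrite Rabs_pos_eq; lra. }
      destruct (proj2 (is_lim_seq_spec _ _) Hgeom eps) as [N HN].
      exists N. intros n Hn. specialize (HN n Hn). rewrite Rminus_0_r in HN.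
      eapply Rle_lt_trans; [|exact HN]. eapply Rle_trans; [|apply Rle_abs].
      assert (HmR : maj wal R0 (picard (S n))).
      { eapply maj_weaken; [apply (picard_inv (S n))|].
        pose proof (pow_half_pos (S n)). unfold K1 in *. nra. }
      destruct (picard_inv (S n)) as [Hcn _].
      (* The distance between the fixed-point map at [x] and the next iterate is contracted from
         [K1 * / 2 ^ n], so the iterates converge to the image of [x] as well. *)
      assert (HV : maj wal (eta T * (L * (K1 * / 2 ^ n)))
         (Vduh (fun t i => G (x t) i - G (picard (S n) t) i))).
      { apply Vduh_maj.
        - apply traj_cont_minus; now apply G_cont.
        - apply HGL; auto. apply Rmult_le_pos; [exact HK1|apply Rlt_le, pow_half_pos]. }
      pose proof (maj_term wal _ _ t i wal_pos HV) as Ht.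
      rewrite <- (Vduh_minus _ _ (L * R0) (L * R0)) in Ht
        by (auto using G_cont; now apply G_maj).
      change (picard (S (S n)) t i) with
        (Afree x0 t i + Vduh (fun s => G (picard (S n) s)) t i).
      rewrite Rabs_minus_sym.
      replace (Afree x0 t i + Vduh (fun s => G (x s)) t i -
        (Afree x0 t i + Vduh (fun s => G (picard (S n) s)) t i))
        with (Vduh (fun t => G (x t)) t i - Vduh (fun t => G (picard (S n) t)) t i) by ring.
      apply Rmult_le_reg_l with (wal i); [apply wal_pos|].
      rewrite pow_inv.
      replace (wal i * (K1 / wal i * / 2 ^ n)) with (K1 * / 2 ^ n).
      2:{ field. split; [apply pow_nonzero; lra|apply Rgt_not_eq, wal_pos]. }
      eapply Rle_trans; [exact Ht|]. rewrite <- Rmult_assoc.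
      rewrite <- (Rmult_1_l (K1 * / 2 ^ n)) at 2.
      apply Rmult_le_compat_r; [|lra].
      apply Rmult_le_pos; [exact HK1|apply Rlt_le, pow_half_pos]. }
    pose proof (is_lim_seq_unique _ _ Hfix) as E1.
    assert (E2 : is_lim_seq (fun n => picard (S (S n)) t i) (x t i)).
    { apply (is_lim_seq_incr_1 (fun n => picard (S n) t i)), Hlim. }
    apply is_lim_seq_unique in E2. rewrite E1 in E2.
    apply Rbar_finite_eq. now rewrite E2.
Qed.

End Picard.

(** * Regularity of mild solutions *)

Section Regularity.
Variables (x0 : nat -> R) (h x : R -> nat -> R) (K0 Kh : R).
Hypothesis Hx0 : bnd wal x0 K0.
Hypothesis hc : traj_cont h.
Hypothesis hm : maj w Kh h.
Hypothesis h0 : forall t i, 0 <= h t i.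
Hypothesis Hx : forall t i, x t i = Afree x0 t i + Vduh h t i.

(** The share of source index [j] in coordinate [l] of the solution; [qt] is its time integral. For
    each pair these are scalar functions, on which the results on convolutions apply. *)
Let yt (t : R) (l j : nat) : R :=
  evo t l j * x0 j + conv (fun s => evo s l j) (fun s => h s j) t.
Let qt (t : R) (l j : nat) : R :=
  ievo t l j * x0 j + conv (fun s => ievo s l j) (fun s => h s j) t.

Lemma x_cont : traj_cont x.
Proof.
  intros i t. apply (continuous_ext (fun t => Afree x0 t i + Vduh h t i)).
  { intros; symmetry; apply Hx. }
  apply (traj_cont_plus (Afree x0) (Vduh h)).
  - now apply (Afree_cont) with (K := K0).
  - now apply (Vduh_cont) with (K := Kh).
Qed.

Lemma h_bound : exists H, bnd w H Kh /\ forall t i, Rabs (h t i) <= H i.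
Proof. exact hm. Qed.

Lemma yt_term_bound H l j s : (forall t i, Rabs (h t i) <= H i) ->
  Rabs (yt (clamp T s) l j) <= sgm l j * x0 j + ievo T l j * H j.
Proof.
  intros Hh. eapply Rle_trans; [apply Rabs_triang|]. apply Rplus_le_compat.
  - apply (Afree_term). apply Hx0.
  - now apply (Vduh_term).
Qed.

Lemma yt_bound_ex H l : bnd w H Kh -> ex_series (fun j => sgm l j * x0 j + ievo T l j * H j).
Proof.
  intros HH. apply (ex_series_plus (fun j => sgm l j * x0 j) (fun j => ievo T l j * H j)).
  - apply (sgm_x0 x0 K0 Hx0).
  - apply (ievo_H wal (eta T) H Kh); auto.
    + intros; now apply wal_pos.
    + apply Rlt_le. now apply eta_pos.
    + intros j. now apply (ievo_bnd_al).
Qed.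

Lemma yt_series t l : 0 <= t <= T -> is_series (fun j => yt t l j) (x t l).
Proof.
  intros Ht. destruct h_bound as [H [HH Hh]].
  rewrite Hx. unfold Afree, Vduh. rewrite clamp_id by exact Ht.
  apply is_seriesR_plus; apply Series_correct.
  - apply (ex_series_dom _ (fun j => sgm l j * x0 j)).
    + intros j. rewrite <- (clamp_id T t) by exact Ht.
      apply (Afree_term). apply Hx0.
    + apply (sgm_x0 x0 K0 Hx0).
  - rewrite <- (clamp_id T t) by exact Ht.
    now apply (Vduh_ex) with (H := H) (K := Kh).
Qed.

Lemma yt_cont l j t : continuous (fun t => yt t l j) t.
Proof.
  destruct h_bound as [H [HH Hh]].
  destruct (evo_Lip_ex l j) as [L HL].
  apply (continuous_plus (fun t => evo t l j * x0 j)
    (conv (fun s => evo s l j) (fun s => h s j))).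
  - apply (continuous_mult (fun t => evo t l j) (fun _ => x0 j)); [|apply continuous_const].
    exact (Lipschitz_continuous _ L t HL).
  - apply (conv_cont _ _ L (H j) HL); auto.
Qed.

Lemma qt_deriv l j t : is_derive (fun t => qt t l j) t (yt t l j).
Proof.
  destruct h_bound as [H [HH Hh]].
  destruct (evo_Lip_ex l j) as [L HL].
  apply is_derive_plusR.
  - apply (is_derive_scal_rR (fun t => ievo t l j)).
    apply (conv_q_deriv (fun s => evo s l j) L HL).
  - apply (conv_deriv (fun s => evo s l j) (fun s => h s j) L (H j) HL); auto.
Qed.

Lemma qt_0 l j : qt 0 l j = 0.
Proof.
  unfold qt, conv. rewrite RInt_pointR. unfold ievo. rewrite RInt_pointR. ring.
Qed.

Lemma qt_RInt l j t : 0 <= t <= T ->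
  RInt (fun s => yt (clamp T s) l j) 0 t = qt t l j.
Proof.
  intros Ht. apply is_RInt_unique.
  apply (is_RInt_ext (fun s => yt s l j)).
  - intros s Hs. rewrite Rmin_left, Rmax_right in Hs by lra. now rewrite clamp_id by lra.
  - replace (qt t l j) with (minus (qt t l j) (qt 0 l j)).
    2:{ rewrite qt_0. unfold minus, plus, opp; simpl. ring. }
    apply (is_RInt_derive (fun s => qt s l j) (fun s => yt s l j)).
    + intros; apply qt_deriv.
    + intros; apply yt_cont.
Qed.

Lemma qt_series l t : 0 <= t <= T ->
  is_series (fun j => qt t l j) (RInt (fun s => x s l) 0 t).
Proof.
  intros Ht. destruct h_bound as [H [HH Hh]].
  pose proof (RInt_Series (fun s j => yt (clamp T s) l j)
    (fun j => sgm l j * x0 j + ievo T l j * H j) 0 t (proj1 Ht) (yt_bound_ex H l HH)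
    (fun s j => yt_term_bound H l j s Hh)) as HS.
  eapply is_series_eq.
  - eapply is_series_ext; [|apply HS].
    + intros j. simpl. now apply qt_RInt.
    + intros j s. apply (continuous_comp (clamp T) (fun s => yt s l j));
        [apply clamp_cont|apply yt_cont].
  - apply RInt_ext. intros s Hs. rewrite Rmin_left, Rmax_right in Hs by lra.
    rewrite clamp_id by lra. apply is_series_unique, yt_series. lra.
Qed.

Lemma ievo_cont l j t : continuous (fun s => ievo s l j) t.
Proof.
  destruct (evo_Lip_ex l j) as [L HL].
  apply (conv_q_cont (fun s => evo s l j) L HL).
Qed.

(** This is [evo_forward] at time [t - s], multiplied by [h s j] and integrated over [s]; the series
    passes through the integral because [ievo] is nondecreasing in time. *)
Lemma conv_forward i j t : 0 <= t <= T ->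
  is_series (fun l => B i l * conv (fun s => ievo s l j) (fun s => h s j) t)
    (conv (fun s => evo s i j) (fun s => h s j) t - kron i j * RInt (fun s => h s j) 0 t
     + D i * conv (fun s => ievo s i j) (fun s => h s j) t).
Proof.
  intros Ht. destruct h_bound as [H [HH Hh]].
  assert (HTT : 0 <= T) by lra.
  pose proof (RInt_Series (fun s l => B i l * ievo (clamp T (t - s)) l j * h s j)
    (fun l => B i l * ievo T l j * H j) 0 t (proj1 Ht)) as HS.
  assert (H1 : ex_series (fun l => B i l * ievo T l j * H j)).
  { apply (ex_series_scal_r (H j) (fun l => B i l * ievo T l j)).
    eexists. exact (evo_forward T i j HTT). }
  assert (H2 : forall s l, Rabs (B i l * ievo (clamp T (t - s)) l j * h s j)
       <= B i l * ievo T l j * H j).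
  { intros s l. pose proof (clamp_range T (t - s) (proj1 HT)).
    rewrite Rabs_mult, Rabs_pos_eq.
    2:{ apply Rmult_le_pos; [apply HB|apply ievo_ge0; lra]. }
    apply Rmult_le_compat; [|apply Rabs_pos| |apply Hh].
    - apply Rmult_le_pos; [apply HB|apply ievo_ge0; lra].
    - apply Rmult_le_compat_l; [apply HB|].
      now apply (ievo_mono). }
  assert (H3 : forall l s, continuous (fun s => B i l * ievo (clamp T (t - s)) l j * h s j) s).
  { intros l s. apply (continuous_mult (fun s => B i l * ievo (clamp T (t - s)) l j)); [|apply hc].
    apply (continuous_scal_r (B i l) (fun s => ievo (clamp T (t - s)) l j)).
    apply (continuous_comp (fun s => clamp T (t - s)) (fun s => ievo s l j)); [|apply ievo_cont].
    apply (continuous_comp (fun s => t - s) (clamp T)); [|apply clamp_cont].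
    apply (continuous_minus (fun _ => t) (fun s => s));
      [apply continuous_const|apply continuous_id]. }
  specialize (HS H1 H2 H3).
  assert (Hconv : forall v : R -> R, (forall s, continuous v s) ->
     forall s, continuous (fun s => v (t - s) * h s j) s).
  { intros v Hv s. now apply (conv_integrand_cont (fun s => h s j)). }
  assert (HUc : forall s, continuous (fun s => evo s i j) s).
  { intros s. destruct (evo_Lip_ex i j) as [L HL].
    exact (Lipschitz_continuous _ L s HL). }
  eapply is_series_eq.
  - eapply is_series_ext; [|apply HS]. intros l. simpl.
    transitivity (RInt (fun s => B i l * (ievo (t - s) l j * h s j)) 0 t).
    + apply RInt_ext. intros s Hs. rewrite Rmin_left, Rmax_right in Hs by lra.
      rewrite clamp_id by lra. apply Rmult_assoc.
    + apply (RInt_scal (fun s => ievo (t - s) l j * h s j)).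
      apply continuous_ex_RInt. apply (Hconv (fun s => ievo s l j)). intros; apply ievo_cont.
  - transitivity (RInt (fun s => (evo (t - s) i j * h s j - kron i j * h s j)
         + D i * (ievo (t - s) i j * h s j)) 0 t).
    + apply RInt_ext. intros s Hs. rewrite Rmin_left, Rmax_right in Hs by lra.
      rewrite clamp_id by lra.
      rewrite Series_scal_r.
      assert (Hts : 0 <= t - s) by lra.
      assert (E : Series (fun l => B i l * ievo (t - s) l j)
                  = evo (t - s) i j - kron i j + D i * ievo (t - s) i j).
      { apply is_series_unique. exact (evo_forward (t - s) i j Hts). }
      rewrite E. eqR. ring.
    + assert (HcQ : forall s, continuous (fun s => D i * (ievo (t - s) i j * h s j)) s).
      { intros s. apply (continuous_scal_r (D i) (fun s => ievo (t - s) i j * h s j)).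
        apply (Hconv (fun s => ievo s i j)). intros; apply ievo_cont. }
      assert (HcK : forall s, continuous (fun s => kron i j * h s j) s).
      { intros s. apply (continuous_scal_r (kron i j) (fun s => h s j)). apply hc. }
      transitivity (RInt (fun s => evo (t - s) i j * h s j - kron i j * h s j) 0 t
        + RInt (fun s => D i * (ievo (t - s) i j * h s j)) 0 t).
      { apply (RInt_plus (fun s => evo (t - s) i j * h s j - kron i j * h s j)
          (fun s => D i * (ievo (t - s) i j * h s j))); apply continuous_ex_RInt; [|exact HcQ].
        intros s. apply (continuous_minus (fun s => evo (t - s) i j * h s j)
          (fun s => kron i j * h s j)); [|apply HcK].
        now apply (Hconv (fun s => evo s i j)). }
      rewrite RInt_minusR; [|now apply (Hconv (fun s => evo s i j))|exact HcK].
      f_equal; [f_equal|].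
      * apply (RInt_scal (fun s => h s j)). apply continuous_ex_RInt. intros; apply hc.
      * apply (RInt_scal (fun s => ievo (t - s) i j * h s j)). apply continuous_ex_RInt.
        apply (Hconv (fun s => ievo s i j)). intros; apply ievo_cont.
Qed.

(** The contributions of the sources [j] each satisfy the forward equation. Summing over [j] and
    exchanging with the sum over [l] is Tonelli's theorem, for which the signs of [x0] and [h] are
    used. *)
Lemma integrated_equation t i : 0 <= t <= T ->
  is_series (fun l => B i l * RInt (fun s => x s l) 0 t)
    (x t i - x0 i - RInt (fun s => h s i) 0 t + D i * RInt (fun s => x s i) 0 t).
Proof.
  intros Ht. destruct h_bound as [H [HH Hh]].
  destruct (Series_Tonelli (fun l j => B i l * qt t l j)
    (fun j => (yt t i j - kron i j * (x0 j + RInt (fun s => h s j) 0 t)) + D i * qt t i j))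
    as [_ HS].
  - intros l j. apply Rmult_le_pos; [apply HB|].
    destruct (evo_Lip_ex l j) as [L HL].
    apply Rplus_le_le_0_compat.
    + apply Rmult_le_pos; [apply ievo_ge0, Ht|apply Hx0].
    + apply RInt_nonneg; [apply Ht| |].
      * intros s. apply (conv_integrand_cont (fun s => h s j)); [intros; apply hc|].
        intros; apply ievo_cont.
      * intros s Hs. apply Rmult_le_pos; [apply ievo_ge0; lra|apply h0].
  - intros j.
    pose proof (evo_forward t i j (proj1 Ht)) as H1.
    apply (is_seriesR_scal (x0 j)) in H1.
    pose proof (is_seriesR_plus _ _ _ _ H1 (conv_forward i j t Ht)) as H2.
    eapply is_series_eq; [eapply is_series_ext; [|exact H2]|].
    + intros l. unfold qt, ievo. eqR; ring.
    + unfold yt, qt, ievo. eqR; ring.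
  - eexists. apply is_seriesR_plus; [apply is_seriesR_minus|].
    + now apply yt_series.
    + apply is_series_kron.
    + now apply is_seriesR_scal, qt_series.
  - eapply is_series_eq; [eapply is_series_ext; [|exact HS]|].
    + intros l. simpl. rewrite Series_scal_l. f_equal.
      now apply is_series_unique, qt_series.
    + rewrite (is_series_unique _ (x t i - (x0 i + RInt (fun s => h s i) 0 t)
         + D i * RInt (fun s => x s i) 0 t)); [eqR; ring|].
      apply is_seriesR_plus; [apply is_seriesR_minus|].
      * now apply yt_series.
      * apply (is_series_kron (fun j => x0 j + RInt (fun s => h s j) 0 t)).
      * now apply is_seriesR_scal, qt_series.
Qed.

Lemma w_x0 : bnd w x0 K0.
Proof.
  apply (bnd_weight wal); [|exact Hx0].
  intros i. split; [apply Hw|now apply w_le_wal].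
Qed.

Lemma x_maj_Th t0 : 0 < t0 -> exists Y K, bnd wT Y K /\
  forall t, t0 <= t <= T -> forall i, Rabs (x t i) <= Y i.
Proof.
  intros Ht0.
  destruct (Afree_smooth x0 K0 w_x0)
    as [Y1 [HY1 HA]].
  destruct (Vduh_maj_Th h Kh hc hm)
    as [Y2 [HY2 HV]].
  exists (fun i => / t0 * Y1 i + Y2 i). eexists. split.
  - apply bnd_plus; [apply bnd_scal|exact HY2]; [|exact HY1].
    apply Rlt_le, Rinv_0_lt_compat, Ht0.
  - intros t Ht i. rewrite Hx. eapply Rle_trans; [apply Rabs_triang|].
    apply Rplus_le_compat; [|apply HV].
    specialize (HA t i). rewrite clamp_id in HA by lra.
    apply Rmult_le_reg_l with t0; [exact Ht0|].
    rewrite <- Rmult_assoc, Rinv_r, Rmult_1_l by lra.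
    eapply Rle_trans; [|exact HA]. apply Rmult_le_compat_r; [apply Rabs_pos|lra].
Qed.

Definition rhs (t : R) (i : nat) : R :=
  - D i * x t i + Series (fun l => B i l * x t l) + h t i.

Lemma B_apply Y K : bnd wT Y K ->
  (forall i, ex_series (fun l => B i l * Y l)) /\
  bnd w (fun i => Series (fun l => B i l * Y l)) (CB * K).
Proof. intros HY. apply (mat_vec w wT); auto using wT_pos. Qed.

Lemma D_apply Y K : bnd wT Y K -> bnd w (fun i => D i * Y i) (CD * K).
Proof.
  intros [H1 H2]. split.
  - intros i. apply Rmult_le_pos; auto.
  - intros I. eapply Rle_trans; [|apply Rmult_le_compat_l; [exact HCD|apply (H2 I)]].
    rewrite <- sm_scal. apply sm_le. intros i _. unfold wT.
    replace (w i * (D i * Y i)) with (D i * (w i * Y i)) by ring.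
    replace (CD * (Th i * w i * Y i)) with (CD * Th i * (w i * Y i)) by ring.
    apply Rmult_le_compat_r; [|apply HDle].
    apply Rmult_le_pos; [apply Rlt_le, Hw|apply H1].
Qed.

Lemma generator_norm (z e : nat -> R) K : bnd wT (fun i => Rabs (z i)) K ->
  bnd w (fun i => Rabs (e i)) (Series (fun i => w i * Rabs (e i))) ->
  Series (fun i => w i * Rabs (- D i * z i + Series (fun l => B i l * z l) + e i))
    <= (CD + CB) * K + Series (fun i => w i * Rabs (e i)) /\
  ex_series (fun i => w i * Rabs (- D i * z i + Series (fun l => B i l * z l) + e i)).
Proof.
  intros Hz He. destruct (B_apply _ _ Hz) as [Hex HBz].
  pose proof (bnd_plus _ _ _ _ _ (bnd_plus _ _ _ _ _ (D_apply _ _ Hz) HBz) He) as HS.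
  assert (HS' : bnd w (fun i => Rabs (- D i * z i + Series (fun l => B i l * z l) + e i))
     (CD * K + CB * K + Series (fun i => w i * Rabs (e i)))).
  { eapply bnd_le; [exact Hw| |exact HS]. intros i. split; [apply Rabs_pos|].
    eapply Rle_trans; [apply Rabs_triang|]. apply Rplus_le_compat_r.
    eapply Rle_trans; [apply Rabs_triang|]. apply Rplus_le_compat.
    - rewrite Rabs_mult, Rabs_Ropp, (Rabs_pos_eq (D i)) by apply HD. lra.
    - apply Series_abs_le; [|apply Hex]. intros l.
      rewrite Rabs_mult, (Rabs_pos_eq (B i l)) by apply HB. lra. }
  destruct (bnd_ex _ _ _ Hw HS') as [H1 H2]. split; [|exact H1]. lra.
Qed.

Lemma x_wT_ex t : 0 < t <= T -> ex_series (fun i => wT i * Rabs (x t i)).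
Proof.
  intros Ht. destruct (x_maj_Th t (proj1 Ht)) as [Y [K [HY HxY]]].
  apply (bnd_ex wT (fun i => Rabs (x t i)) K wT_pos).
  apply (bnd_le wT _ Y); [exact wT_pos| |exact HY].
  intros i; split; [apply Rabs_pos|apply HxY; lra].
Qed.

Lemma Bx_ex t i : 0 < t <= T -> ex_series (fun l => B i l * x t l).
Proof.
  intros Ht.
  pose proof (bnd_of_series wT (fun i => Rabs (x t i)) wT_pos (fun i => Rabs_pos _)
    (x_wT_ex t Ht)) as Hb.
  apply (ex_series_dom _ (fun l => B i l * Rabs (x t l))); [|apply (B_apply _ _ Hb)].
  intros l. rewrite Rabs_mult, (Rabs_pos_eq (B i l)) by apply HB. lra.
Qed.

Lemma h_w_ex t : ex_series (fun i => w i * Rabs (h t i)).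
Proof. apply (bnd_ex w (fun i => Rabs (h t i)) Kh Hw). now apply maj_bnd. Qed.

Lemma h_w_bnd t : bnd w (fun i => Rabs (h t i)) (Series (fun i => w i * Rabs (h t i))).
Proof. apply bnd_of_series; [exact Hw|intros; apply Rabs_pos|apply h_w_ex]. Qed.

Lemma rhs_ex t : 0 < t <= T -> ex_series (fun i => w i * Rabs (rhs t i)).
Proof.
  intros Ht. apply (generator_norm (x t) (h t) (Series (fun i => wT i * Rabs (x t i)))).
  - apply bnd_of_series; [exact wT_pos|intros; apply Rabs_pos|now apply x_wT_ex].
  - apply h_w_bnd.
Qed.

Lemma within_open_interval (t a : R) : a < t -> forall P,
  within P (locally t) (fun u => a <= u).
Proof.
  intros Ha P. assert (Hd : 0 < t - a) by lra.
  exists (mkposreal _ Hd). intros y Hy _. change (Rabs (y - t) < t - a) in Hy.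
  apply Rabs_lt_between in Hy. lra.
Qed.

Lemma x_norm_cont_Th : norm_cont_on (fun t => 0 < t < T) wT x.
Proof.
  apply traj_cont_norm_cont; [exact wT_pos|exact x_cont|]. intros t Ht.
  (* The majorant in [wT] behaves like the inverse of the time, so it is taken from time [t / 2]
     on. *)
  assert (Ht2 : 0 < t / 2) by lra.
  destruct (x_maj_Th (t / 2) Ht2) as [Y [K [HY HxY]]].
  exists Y. split; [apply (bnd_ex wT Y K wT_pos HY)|]. split; [intros; apply HxY; lra|].
  assert (Ht3 : t / 2 < t) by lra.
  generalize (within_open_interval t (t / 2) Ht3 (fun t => 0 < t < T)).
  intros [d Hd]. exists d. intros u Hu Hu' i. apply HxY. specialize (Hd u Hu Hu'). lra.
Qed.

Lemma h_norm_cont : norm_cont_on (fun t => 0 < t < T) w h.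
Proof.
  apply traj_cont_norm_cont; [exact Hw|exact hc|]. intros t Ht.
  destruct h_bound as [H [HH Hh]]. exists H. split; [apply (bnd_ex w H Kh Hw HH)|].
  split; [apply Hh|]. apply filter_forall. intros; apply Hh.
Qed.

Lemma rhs_norm_cont : norm_cont_on (fun t => 0 < t < T) w rhs.
Proof.
  intros t Ht eps He.
  assert (HC : 0 < CD + CB + 1) by lra.
  assert (He1 : 0 < eps / 2 / (CD + CB + 1)) by (apply Rdiv_lt_0_compat; lra).
  assert (He2 : 0 < eps / 2) by lra.
  destruct (x_norm_cont_Th t Ht _ He1) as [d1 [Hd1 H1]].
  destruct (h_norm_cont t Ht _ He2) as [d2 [Hd2 H2]].
  exists (Rmin d1 d2). split; [now apply Rmin_glb_lt|]. intros u Hu Hut.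
  specialize (H1 u Hu (Rlt_le_trans _ _ _ Hut (Rmin_l _ _))).
  specialize (H2 u Hu (Rlt_le_trans _ _ _ Hut (Rmin_r _ _))).
  destruct h_bound as [H [HH Hh]].
  assert (E : forall i, rhs u i - rhs t i = - D i * (x u i - x t i)
     + Series (fun l => B i l * (x u l - x t l)) + (h u i - h t i)).
  { intros i. unfold rhs.
    rewrite (Series_ext (fun l => B i l * (x u l - x t l)) (fun l => B i l * x u l - B i l * x t l))
      by (intros; ring).
    rewrite Series_minus by (apply Bx_ex; lra). ring. }
  rewrite (Series_ext _ (fun i => w i * Rabs (- D i * (x u i - x t i)
     + Series (fun l => B i l * (x u l - x t l)) + (h u i - h t i)))).
  2:{ intros i. now rewrite E. }
  set (K := Series (fun i => wT i * Rabs (x u i - x t i))) in *.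
  assert (HxK : bnd wT (fun i => Rabs (x u i - x t i)) K).
  { apply bnd_of_series; [exact wT_pos|intros; apply Rabs_pos|].
    apply (weighted_triangle wT (x u) (x t)); [exact wT_pos|apply x_wT_ex; lra|apply x_wT_ex; lra]. }
  destruct (generator_norm _ (fun i => h u i - h t i) K HxK) as [HN _].
  { apply bnd_of_series; [exact Hw|intros; apply Rabs_pos|].
    apply (weighted_triangle w (h u) (h t)); [exact Hw|apply h_w_ex|apply h_w_ex]. }
  eapply Rle_lt_trans; [exact HN|].
  pose proof (bnd_Kge0 _ _ _ wT_pos HxK) as HK0.
  assert ((CD + CB) * K <= eps / 2).
  { apply Rle_trans with ((CD + CB + 1) * (eps / 2 / (CD + CB + 1))).
    - apply Rmult_le_compat; lra.
    - apply Req_le. field. lra. }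
  lra.
Qed.

Lemma RInt_quotient_lim (f : R -> R) t : (forall s, continuous f s) ->
  forall eps, 0 < eps -> locally t (fun u => u <> t ->
    Rabs ((RInt f 0 u - RInt f 0 t) / (u - t) - f t) < eps).
Proof.
  intros Hf eps He.
  pose proof (continuous_is_derive_RInt f 0 Hf t) as Hd.
  apply is_derive_Reals in Hd. destruct (Hd eps He) as [d H].
  exists d. intros u Hu Hne. change (Rabs (u - t) < d) in Hu.
  assert (Hne' : u - t <> 0) by lra.
  specialize (H (u - t) Hne' Hu). now rewrite Rplus_minus in H.
Qed.

Lemma RInt_quotient_bound (f : R -> R) M t u : (forall s, continuous f s) -> u <> t ->
  (forall s, Rmin t u <= s <= Rmax t u -> Rabs (f s) <= M) ->
  Rabs ((RInt f 0 u - RInt f 0 t) / (u - t)) <= M.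
Proof.
  intros Hf Hne HM. rewrite <- (RInt_ChaslesR f 0 t u Hf).
  rewrite Rplus_minus_l.
  unfold Rdiv. rewrite Rabs_mult, Rabs_inv.
  assert (Hp : 0 < Rabs (u - t)) by (apply Rabs_pos_lt; lra).
  apply Rmult_le_reg_r with (Rabs (u - t)); [exact Hp|].
  rewrite Rmult_assoc, Rinv_l, Rmult_1_r by lra.
  now apply abs_RInt_bound.
Qed.

(** Subtracting the integrated equation at two times shows that the difference quotient of [x] is
    the generator applied to the mean [e] of [x], plus the mean [k] of [h]. The means converge in
    [wT] and [w] by domination, and the generator is bounded from [wT] to [w]. *)
Lemma x_norm_deriv t : 0 < t < T -> forall eps, 0 < eps ->
  exists delta, 0 < delta /\ forall u, 0 < u < T -> u <> t -> Rabs (u - t) < delta ->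
    Series (fun i => w i * Rabs ((x u i - x t i) / (u - t) - rhs t i)) < eps.
Proof.
  intros Ht eps He.
  destruct h_bound as [H [HH Hh]].
  assert (Ht2 : 0 < t / 2) by lra.
  destruct (x_maj_Th (t / 2) Ht2) as [Y [KY [HY HxY]]].
  set (P u := t / 2 < u < T /\ u <> t).
  set (X u i := RInt (fun s => x s i) 0 u).
  set (Hi u i := RInt (fun s => h s i) 0 u).
  set (e u i := (X u i - X t i) / (u - t)).
  set (k u i := (Hi u i - Hi t i) / (u - t)).
  assert (HC : 0 < CD + CB + 1) by lra.
  assert (He1 : 0 < eps / 2 / (CD + CB + 1)) by (apply Rdiv_lt_0_compat; lra).
  assert (He2 : 0 < eps / 2) by lra.
  assert (HeY : forall u, P u -> forall i, Rabs (e u i) <= Y i).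
  { intros u [Hu Hne] i. apply RInt_quotient_bound; [intros; apply x_cont|exact Hne|].
    intros s Hs. apply HxY. revert Hs. unfold Rmin, Rmax. destruct Rle_dec; lra. }
  assert (HkH : forall u, P u -> forall i, Rabs (k u i) <= H i).
  { intros u [Hu Hne] i. apply RInt_quotient_bound; [intros; apply hc|exact Hne|].
    intros s _. apply Hh. }
  assert (L1 := weighted_DCT (within P (locally t)) wT Y (x t) e wT_pos
    (proj1 (bnd_ex wT Y KY wT_pos HY))).
  assert (L2 := weighted_DCT (within P (locally t)) w H (h t) k Hw
    (proj1 (bnd_ex w H Kh Hw HH))).
  destruct (L1) with (eps := eps / 2 / (CD + CB + 1)) as [d1 Hd1].
  { intros i; apply HxY; lra. }
  { unfold within. apply filter_forall. exact HeY. }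
  { intros i r Hr. generalize (RInt_quotient_lim (fun s => x s i) t (x_cont i) r Hr).
    unfold within. apply filter_imp. intros u Hu [_ Hne]. now apply Hu. }
  { exact He1. }
  destruct (L2) with (eps := eps / 2) as [d2 Hd2].
  { intros i; apply Hh. }
  { unfold within. apply filter_forall. exact HkH. }
  { intros i r Hr. generalize (RInt_quotient_lim (fun s => h s i) t (hc i) r Hr).
    unfold within. apply filter_imp. intros u Hu [_ Hne]. now apply Hu. }
  { exact He2. }
  exists (Rmin (t / 2) (Rmin d1 d2)). split.
  { repeat apply Rmin_glb_lt; [exact Ht2|apply cond_pos|apply cond_pos]. }
  intros u Hu Hne Hut.
  assert (Hu0 := Rlt_le_trans _ _ _ Hut (Rmin_l _ _)).
  assert (Hu1 := Rlt_le_trans _ _ _ Hut (Rle_trans _ _ _ (Rmin_r _ _) (Rmin_l _ _))).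
  assert (Hu2 := Rlt_le_trans _ _ _ Hut (Rle_trans _ _ _ (Rmin_r _ _) (Rmin_r _ _))).
  assert (HPu : P u).
  { split; [|exact Hne]. apply Rabs_lt_between in Hu0. lra. }
  specialize (Hd1 u Hu1 HPu). specialize (Hd2 u Hu2 HPu).
  assert (Hut0 : u - t <> 0) by lra.
  assert (E : forall i, (x u i - x t i) / (u - t) - rhs t i = - D i * (e u i - x t i)
     + Series (fun l => B i l * (e u l - x t l)) + (k u i - h t i)).
  { intros i.
    assert (Hu' : 0 <= u <= T) by lra. assert (Ht' : 0 <= t <= T) by lra.
    assert (Ht'' : 0 < t <= T) by lra.
    pose proof (is_seriesR_minus _ _ _ _ (integrated_equation u i Hu') (integrated_equation t i Ht')) as H1.
    apply (is_seriesR_scal (/ (u - t))) in H1.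
    pose proof (is_seriesR_minus _ _ _ _ H1 (Series_correct _ (Bx_ex t i Ht''))) as H2.
    assert (HE : is_series (fun l => B i l * (e u l - x t l))
      (/ (u - t) * (x u i - x0 i - Hi u i + D i * X u i - (x t i - x0 i - Hi t i + D i * X t i))
       - Series (fun l => B i l * x t l))).
    { eapply is_series_ext; [|exact H2]. intros l. unfold e, X, Rdiv. eqR; ring. }
    rewrite (is_series_unique _ _ HE). unfold rhs, e, k. field. exact Hut0. }
  rewrite (Series_ext _ (fun i => w i * Rabs (- D i * (e u i - x t i)
     + Series (fun l => B i l * (e u l - x t l)) + (k u i - h t i)))).
  2:{ intros i. now rewrite E. }
  set (K := Series (fun i => wT i * Rabs (e u i - x t i))) in *.
  assert (HxK : bnd wT (fun i => Rabs (e u i - x t i)) K).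
  { apply bnd_of_series; [exact wT_pos|intros; apply Rabs_pos|].
    apply (weighted_triangle wT (e u) (x t)); [exact wT_pos| |apply x_wT_ex; lra].
    exact (proj1 (bnd_ex wT _ KY wT_pos (bnd_le wT _ Y KY wT_pos
      (fun i => conj (Rabs_pos _) (HeY u HPu i)) HY))). }
  destruct (generator_norm _ (fun i => k u i - h t i) K HxK) as [HN _].
  { apply bnd_of_series; [exact Hw|intros; apply Rabs_pos|].
    apply (weighted_triangle w (k u) (h t)); [exact Hw| |apply h_w_ex].
    exact (proj1 (bnd_ex w _ Kh Hw (bnd_le w _ H Kh Hw
      (fun i => conj (Rabs_pos _) (HkH u HPu i)) HH))). }
  eapply Rle_lt_trans; [exact HN|].
  pose proof (bnd_Kge0 _ _ _ wT_pos HxK) as HK0.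
  assert ((CD + CB) * K <= eps / 2).
  { apply Rle_trans with ((CD + CB + 1) * (eps / 2 / (CD + CB + 1))).
    - apply Rmult_le_compat; lra.
    - apply Req_le. field. lra. }
  lra.
Qed.

End Regularity.

End Mild.

Theorem strong_solution_exists (G : (nat -> R) -> nat -> R) (x0 : nat -> R) (K0 R0 L : R) :
  0 <= L -> bnd wal x0 K0 -> 4 * Cs * K0 <= R0 -> maj_Lipschitz G wal w R0 L ->
  (forall x, (forall i, 0 <= x i) -> bnd wal x R0 -> forall i, 0 <= G x i) ->
  (forall i, G (fun _ => 0) i = 0) ->
  exists T x x', 0 < T /\ strong_solution G T x x' /\
    (forall t i, 0 <= x t i) /\ (forall i, x 0 i = x0 i) /\ maj wal R0 x /\
    norm_cont_on (fun t => 0 < t < T) wT x /\ norm_cont_on (fun t => 0 < t < T) w x' /\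
    forall t i, 0 < t < T -> ex_series (fun l => B i l * x t l).
Proof.
  intros HL Hx0 HR0 HGL HGpos HG0.
  (* The target for [eta T]; dividing by [L + 1] avoids a case distinction at [L = 0]. *)
  assert (He : 0 < / 2 / (L + 1)) by (apply Rdiv_lt_0_compat; lra).
  destruct (eta_small _ He) as [T [HT HeT]].
  assert (HeL : eta T * L <= / 2).
  { apply Rle_trans with (/ 2 / (L + 1) * (L + 1)).
    - apply Rmult_le_compat; [apply Rlt_le, eta_pos|exact HL|exact HeT|lra].
    - apply Req_le. field. lra. }
  destruct (mild_exists T HT G R0 L K0 x0 HL Hx0 HR0 HeL HGL HGpos HG0) as [x [xc [xpos [xm xeq]]]].
  set (h t := G (x t)).
  assert (hc : traj_cont h) by now apply (G_cont G R0 L).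
  assert (hm : maj w (L * R0) h) by now apply (G_maj G R0 L K0 x0).
  assert (hpos : forall t i, 0 <= h t i).
  { intros t. apply HGpos; [apply xpos|].
    apply (bnd_le wal _ (fun i => Rabs (x t i))); [exact wal_pos| |now apply maj_bnd; [exact wal_pos|]].
    intros j; split; [apply xpos|apply Rle_abs]. }
  exists T, x, (rhs h x). split; [lra|]. split; [split; [|split]|split; [|split; [|split; [|split; [|split]]]]].
  - intros t _. exact (proj1 (bnd_ex wal _ _ wal_pos (maj_bnd wal _ _ t wal_pos xm))).
  - apply traj_cont_norm_cont; [exact wal_pos|exact xc|]. intros t _.
    destruct xm as [X [HX HXx]]. exists X. split; [apply (bnd_ex wal X R0 wal_pos HX)|].
    split; [apply HXx|]. apply filter_forall. intros; apply HXx.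
  - intros t Ht. assert (Ht' : 0 < t <= T) by lra. split; [|split; [|split]].
    + now apply (x_wT_ex T HT x0 h x K0 (L * R0)).
    + now apply (rhs_ex T HT x0 h x K0 (L * R0)).
    + reflexivity.
    + now apply (x_norm_deriv T HT x0 h x K0 (L * R0)).
  - exact xpos.
  - intros i. rewrite xeq. unfold Afree, Vduh. rewrite clamp_id by lra.
    rewrite (Series_ext _ (fun j => kron i j * x0 j)) by (intros; now rewrite evo_0).
    rewrite (is_series_unique _ _ (is_series_kron x0 i)), (Series_support _ 0).
    + simpl. unfold conv. rewrite RInt_pointR. ring.
    + intros j _. apply RInt_pointR.
  - exact xm.
  - now apply (x_norm_cont_Th T HT x0 h x K0 (L * R0)).
  - now apply (rhs_norm_cont T HT x0 h x K0 (L * R0)).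
  - intros t i Ht. apply (Bx_ex T HT x0 h x K0 (L * R0)); auto. lra.
Qed.

(** * Uniqueness from dissipativity *)

Lemma dissipation (z : nat -> R) : ex_series (fun i => wT i * Rabs (z i)) ->
  ex_series (fun i => w i * Series (fun l => B i l * Rabs (z l))) /\
  ex_series (fun i => D i * w i * Rabs (z i)) /\
  Series (fun i => w i * Series (fun l => B i l * Rabs (z l)))
    <= Series (fun i => D i * w i * Rabs (z i)) - c / 2 * Series (fun i => wT i * Rabs (z i)) /\
  forall i, ex_series (fun l => B i l * Rabs (z l)).
Proof.
  intros Hz.
  (* Half of the surplus is kept as dissipation; the other half makes [u] positive, so that it is an
     admissible weight in [mat_vec]. *)
  set (u j := D j * w j - c / 2 * wT j).
  assert (HwT : forall i, 0 < wT i) by (intros i; apply wT_pos).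
  assert (Hcu : forall j, c / 2 * wT j <= u j).
  { intros j. pose proof (Hcol j 0%nat) as H. simpl in H. unfold u, wT in *.
    pose proof (Rmult_le_pos _ _ (Rlt_le _ _ (Hw 0%nat)) (HB 0 j)). lra. }
  assert (Hu : forall j, 0 < u j).
  { intros j. specialize (Hcu j). specialize (HwT j).
    assert (0 < c / 2 * wT j) by (apply Rmult_lt_0_compat; lra). lra. }
  assert (HexD : ex_series (fun i => D i * w i * Rabs (z i))).
  { apply (ex_series_dom _ (fun i => CD * (wT i * Rabs (z i)))).
    - intros i. assert (HDw : 0 <= D i * w i).
      { specialize (Hu i). specialize (HwT i). unfold u in Hu.
        assert (0 < c / 2 * wT i) by (apply Rmult_lt_0_compat; lra). lra. }
      rewrite Rabs_mult, Rabs_Rabsolu, (Rabs_pos_eq _ HDw).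
      unfold wT. rewrite <- !Rmult_assoc.
      apply Rmult_le_compat_r; [apply Rabs_pos|].
      apply Rmult_le_compat_r; [apply Rlt_le, Hw|apply HDle].
    - exact (ex_series_scal_l CD _ Hz). }
  assert (HsU : is_series (fun i => u i * Rabs (z i))
    (Series (fun i => D i * w i * Rabs (z i)) - c / 2 * Series (fun i => wT i * Rabs (z i)))).
  { eapply is_series_ext; [|apply (is_seriesR_minus _ _ _ _ (Series_correct _ HexD)
      (is_seriesR_scal (c / 2) _ _ (Series_correct _ Hz)))].
    intros i. unfold u. eqR; ring. }
  assert (Hbu : bnd u (fun i => Rabs (z i)) (Series (fun i => u i * Rabs (z i)))).
  { apply bnd_of_series; [exact Hu|intros; apply Rabs_pos|]. eexists; exact HsU. }
  assert (Hcol1 : forall j, bnd w (fun i => B i j) (1 * u j)).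
  { intros j. split; [intros; apply HB|]. intros I. rewrite Rmult_1_l.
    pose proof (Hcol j I). unfold u, wT.
    assert (0 <= Th j * w j) by (apply Rlt_le, HwT).
    pose proof (Rmult_le_pos c _ (Rlt_le _ _ Hc) H0). lra. }
  destruct (mat_vec w u (fun i => Rabs (z i)) B 1 (Series (fun i => u i * Rabs (z i)))
    Hw Hu Rle_0_1 HB Hcol1 Hbu) as [Hex Hb].
  destruct (bnd_ex _ _ _ Hw Hb) as [H1 H2].
  repeat split; auto. rewrite Rmult_1_l in H2.
  now rewrite (is_series_unique _ _ HsU) in H2.
Qed.

Lemma wa_absorb L : 0 <= L -> exists M, 0 <= M /\ forall i, L * wal i <= M * w i + c / 2 * wT i.
Proof.
  intros HL.
  (* The solution of [Rpower m (alpha - 1) = c / 2 / (L + 1)], which makes the coefficient of [wT]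
     in [wal_interp] small enough to be absorbed. *)
  set (m := Rpower (c / 2 / (L + 1)) (/ (alpha - 1))).
  assert (Hm : 0 < m) by apply exp_pos.
  assert (Hc2 : 0 < c / 2 / (L + 1)) by (apply Rdiv_lt_0_compat; lra).
  assert (E : Rpower m alpha / m = c / 2 / (L + 1)).
  { unfold Rdiv at 1. rewrite <- (Rpower_1 m Hm) at 2. rewrite <- Rpower_Ropp, <- Rpower_plus.
    unfold m. rewrite Rpower_mult.
    replace (/ (alpha - 1) * (alpha + - (1))) with 1 by (field; lra).
    now apply Rpower_1. }
  exists (L * Rpower m alpha). split.
  - apply Rmult_le_pos; [exact HL|apply Rlt_le, exp_pos].
  - intros i. pose proof (wal_interp m i Hm) as H.
    rewrite E in H. fold (wT i) in H. fold (wal i) in H.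
    assert (HwT : 0 < wT i) by apply wT_pos.
    apply Rle_trans with (L * (Rpower m alpha * w i + c / 2 / (L + 1) * wT i)).
    + now apply Rmult_le_compat_l.
    + rewrite Rmult_plus_distr_l, <- !Rmult_assoc. apply Rplus_le_compat_l.
      apply Rmult_le_compat_r; [lra|].
      apply Rle_trans with ((L + 1) * (c / 2 / (L + 1))).
      * apply Rmult_le_compat_r; lra.
      * apply Req_le. field. lra.
Qed.

Section Uniqueness.
Variables (G : (nat -> R) -> nat -> R) (T : R) (z1 z1' z2 z2' : R -> nat -> R).
Hypothesis HT : 0 < T.
Hypothesis HG : forall R0, 0 <= R0 -> exists L, 0 <= L /\ maj_Lipschitz G wal w R0 L.
Hypothesis S1 : strong_solution G T z1 z1'.
Hypothesis S2 : strong_solution G T z2 z2'.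
Hypothesis Hinit : forall i, z1 0 i = z2 0 i.

Let u (t : R) (i : nat) : R := z1 t i - z2 t i.
Let du (t : R) (i : nat) : R := z1' t i - z2' t i.
Let Phi (t : R) (i : nat) : R := G (z1 t) i - G (z2 t) i.
Let Nm (t : R) : R := Series (fun i => w i * Rabs (u t i)).

Let wa_ex_w y : ex_series (fun i => wal i * Rabs (y i)) -> ex_series (fun i => w i * Rabs (y i)).
Proof.
  apply ex_series_dom. intros i. rewrite weighted_abs by apply Hw.
  apply Rmult_le_compat_r; [apply Rabs_pos|now apply w_le_wal].
Qed.

Lemma u_ex_wa t : 0 <= t <= T -> ex_series (fun i => wal i * Rabs (u t i)).
Proof.
  intros Ht. apply (weighted_triangle wal (z1 t) (z2 t)); [exact wal_pos|now apply S1|now apply S2].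
Qed.

Lemma u_ex_w t : 0 <= t <= T -> ex_series (fun i => w i * Rabs (u t i)).
Proof. intros Ht. now apply wa_ex_w, u_ex_wa. Qed.

Lemma u_ex_wT t : 0 < t < T -> ex_series (fun i => wT i * Rabs (u t i)).
Proof.
  intros Ht. destruct S1 as [_ [_ H1]]. destruct S2 as [_ [_ H2]].
  apply (weighted_triangle wT (z1 t) (z2 t)); [exact wT_pos|now apply H1|now apply H2].
Qed.

Lemma du_ex t : 0 < t < T -> ex_series (fun i => w i * Rabs (du t i)).
Proof.
  intros Ht. destruct S1 as [_ [_ H1]]. destruct S2 as [_ [_ H2]].
  apply (weighted_triangle w (z1' t) (z2' t)); [exact Hw|now apply H1|now apply H2].
Qed.

Lemma u_cont : norm_cont_on (fun t => 0 <= t <= T) w u.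
Proof.
  intros t Ht eps He. assert (He2 : 0 < eps / 2) by lra.
  destruct S1 as [E1 [C1 _]]. destruct S2 as [E2 [C2 _]].
  destruct (C1 t Ht _ He2) as [d1 [Hd1 H1]]. destruct (C2 t Ht _ He2) as [d2 [Hd2 H2]].
  exists (Rmin d1 d2). split; [now apply Rmin_glb_lt|]. intros v Hv Hvt.
  specialize (H1 v Hv (Rlt_le_trans _ _ _ Hvt (Rmin_l _ _))).
  specialize (H2 v Hv (Rlt_le_trans _ _ _ Hvt (Rmin_r _ _))).
  destruct (weighted_triangle wal (z1 v) (z1 t) wal_pos (E1 v Hv) (E1 t Ht)) as [F1 _].
  destruct (weighted_triangle wal (z2 v) (z2 t) wal_pos (E2 v Hv) (E2 t Ht)) as [F2 _].
  destruct (weighted_triangle wal (fun i => z1 v i - z1 t i) (fun i => z2 v i - z2 t i) wal_pos F1 F2)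
    as [F3 L3].
  eapply Rle_lt_trans; [apply Series_le with (2 := F3)|eapply Rle_lt_trans; [exact L3|lra]].
  intros i. split; [apply Rmult_le_pos; [apply Rlt_le, Hw|apply Rabs_pos]|].
  replace (u v i - u t i) with (z1 v i - z1 t i - (z2 v i - z2 t i)) by (unfold u; ring).
  apply Rmult_le_compat_r; [apply Rabs_pos|now apply w_le_wal].
Qed.

(** Continuity on the compact time interval confines both solutions to one ball; the Lipschitz
    property is then applied to trajectories frozen at time [t]. *)
Lemma Phi_bound : exists L, 0 <= L /\ forall t, 0 <= t <= T ->
  ex_series (fun i => w i * Rabs (Phi t i)) /\
  Series (fun i => w i * Rabs (Phi t i)) <= L * Series (fun i => wal i * Rabs (u t i)).
Proof.
  destruct S1 as [E1 [C1 _]]. destruct S2 as [E2 [C2 _]].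
  destruct (norm_bounded wal z1 T HT wal_pos E1 C1) as [R1 [HR1 B1]].
  destruct (norm_bounded wal z2 T HT wal_pos E2 C2) as [R2 [HR2 B2]].
  destruct (HG (R1 + R2)) as [L [HL HGL]]; [lra|].
  exists L. split; [exact HL|]. intros t Ht.
  set (K := Series (fun i => wal i * Rabs (u t i))).
  assert (HK : bnd wal (fun i => Rabs (u t i)) K).
  { apply bnd_of_series; [exact wal_pos|intros; apply Rabs_pos|now apply u_ex_wa]. }
  assert (Hcst : forall (y : nat -> R) r, bnd wal (fun i => Rabs (y i)) r -> r <= R1 + R2 ->
    maj wal (R1 + R2) (fun _ : R => y)).
  { intros y r Hy Hr. exists (fun i => Rabs (y i)).
    split; [now apply (bnd_weaken _ _ r)|intros; apply Rle_refl]. }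
  assert (HM : maj w (L * K) (fun (_ : R) i => Phi t i)).
  { apply (HGL K (fun _ => z1 t) (fun _ => z2 t)).
    - exact (bnd_Kge0 _ _ _ wal_pos HK).
    - apply (Hcst _ R1); [now apply B1|lra].
    - apply (Hcst _ R2); [now apply B2|lra].
    - exists (fun i => Rabs (u t i)). split; [exact HK|intros; apply Rle_refl]. }
  exact (bnd_ex w _ _ Hw (maj_bnd w _ _ 0 Hw HM)).
Qed.

Lemma du_eq t i : 0 < t < T ->
  du t i = - D i * u t i + Series (fun l => B i l * u t l) + Phi t i.
Proof.
  intros Ht. destruct S1 as [_ [_ H1]]. destruct S2 as [_ [_ H2]].
  destruct (H1 t Ht) as [E1 [_ [Q1 _]]]. destruct (H2 t Ht) as [E2 [_ [Q2 _]]].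
  assert (Hex : forall y, ex_series (fun i => wT i * Rabs (y i)) -> ex_series (fun l => B i l * y l)).
  { intros y Hy. apply (ex_series_dom _ (fun l => B i l * Rabs (y l))); [|now apply dissipation].
    intros l. rewrite Rabs_mult, (Rabs_pos_eq (B i l)) by apply HB. lra. }
  unfold du, u, Phi. rewrite Q1, Q2.
  rewrite (Series_ext (fun l => B i l * (z1 t l - z2 t l)) (fun l => B i l * z1 t l - B i l * z2 t l))
    by (intros; ring).
  rewrite Series_minus by now apply Hex. ring.
Qed.

Lemma u_deriv t : 0 < t < T -> forall eps, 0 < eps -> exists delta, 0 < delta /\
  forall v, 0 < v < T -> v <> t -> Rabs (v - t) < delta ->
    ex_series (fun i => w i * Rabs ((u v i - u t i) / (v - t) - du t i)) /\
    Series (fun i => w i * Rabs ((u v i - u t i) / (v - t) - du t i)) < eps.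
Proof.
  intros Ht eps He. assert (He2 : 0 < eps / 2) by lra.
  destruct S1 as [E1 [_ H1]]. destruct S2 as [E2 [_ H2]].
  destruct (H1 t Ht) as [_ [X1 [_ D1]]]. destruct (H2 t Ht) as [_ [X2 [_ D2]]].
  destruct (D1 _ He2) as [d1 [Hd1 G1]]. destruct (D2 _ He2) as [d2 [Hd2 G2]].
  exists (Rmin d1 d2). split; [now apply Rmin_glb_lt|]. intros v Hv Hne Hvt.
  specialize (G1 v Hv Hne (Rlt_le_trans _ _ _ Hvt (Rmin_l _ _))).
  specialize (G2 v Hv Hne (Rlt_le_trans _ _ _ Hvt (Rmin_r _ _))).
  assert (Hv' : 0 <= v <= T) by lra. assert (Ht' : 0 <= t <= T) by lra.
  assert (Hq : forall (z : R -> nat -> R) (z' : nat -> R),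
     (forall t, 0 <= t <= T -> ex_series (fun i => wal i * Rabs (z t i))) ->
     ex_series (fun i => w i * Rabs (z' i)) ->
     ex_series (fun i => w i * Rabs ((z v i - z t i) / (v - t) - z' i))).
  { intros z z' Hz Hz'.
    apply (weighted_triangle w (fun i => (z v i - z t i) / (v - t)) z' Hw); [|exact Hz'].
    apply (ex_series_ext (fun i => Rabs (/ (v - t)) * (w i * Rabs (z v i - z t i)))).
    - intros i. unfold Rdiv. rewrite Rabs_mult. eqR; ring.
    - apply (ex_series_scal_l (Rabs (/ (v - t))) (fun i => w i * Rabs (z v i - z t i))).
      apply (weighted_triangle w (z v) (z t) Hw); now apply wa_ex_w, Hz. }
  destruct (weighted_triangle w _ _ Hw (Hq z1 _ E1 X1) (Hq z2 _ E2 X2)) as [F3 L3].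
  assert (E : forall i, w i * Rabs ((z1 v i - z1 t i) / (v - t) - z1' t i
       - ((z2 v i - z2 t i) / (v - t) - z2' t i))
     = w i * Rabs ((u v i - u t i) / (v - t) - du t i)).
  { intros i. do 2 f_equal. unfold u, du. field. lra. }
  split; [exact (ex_series_ext _ _ E F3)|]. rewrite <- (Series_ext _ _ E).
  eapply Rle_lt_trans; [exact L3|lra].
Qed.

(** Multiplying by the sign turns the diagonal loss into exactly [- D i * Rabs (z i)], while the
    gain is at most [B] applied to the absolute values. The remaining dissipation [c / 2] in [wT]
    pays for the weight [wal] in the nonlinear difference. *)
Lemma energy_rate L M t : 0 <= L -> (forall i, L * wal i <= M * w i + c / 2 * wT i) ->
  0 < t < T -> ex_series (fun i => w i * Rabs (Phi t i)) ->
  Series (fun i => w i * Rabs (Phi t i)) <= L * Series (fun i => wal i * Rabs (u t i)) ->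
  ex_series (fun i => w i * (sgn (u t i) * du t i)) /\
  Series (fun i => w i * (sgn (u t i) * du t i)) <= M * Nm t.
Proof.
  intros HL HM Ht HPex HP. set (z := u t).
  assert (Ht' : 0 <= t <= T) by lra.
  destruct (dissipation z (u_ex_wT t Ht)) as [E1 [E2 [E3 E4]]].
  split.
  - apply (ex_series_dom _ (fun i => w i * Rabs (du t i))); [|now apply du_ex].
    intros i. rewrite !Rabs_mult, sgn_abs, (Rabs_pos_eq (w i)) by apply Rlt_le, Hw. lra.
  - pose proof (is_seriesR_plus _ _ _ _ (is_seriesR_minus _ _ _ _
      (Series_correct _ E1) (Series_correct _ E2)) (Series_correct _ HPex)) as HS.
    assert (Hle : Series (fun i => w i * (sgn (z i) * du t i)) <=
      Series (fun i => w i * Series (fun l => B i l * Rabs (z l)))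
      - Series (fun i => D i * w i * Rabs (z i)) + Series (fun i => w i * Rabs (Phi t i))).
    { apply (is_lim_seq_le (sm (fun i => w i * (sgn (z i) * du t i)))
        (sm (fun i => (w i * Series (fun l => B i l * Rabs (z l)) - D i * w i * Rabs (z i))
           + w i * Rabs (Phi t i)))
        (Series (fun i => w i * (sgn (z i) * du t i)))
        (Series (fun i => w i * Series (fun l => B i l * Rabs (z l)))
      - Series (fun i => D i * w i * Rabs (z i)) + Series (fun i => w i * Rabs (Phi t i)))).
      - intros n. apply sm_le. intros i _. rewrite (du_eq t i Ht). fold z.
        replace (w i * (sgn (z i) * (- D i * z i + Series (fun l => B i l * z l) + Phi t i)))
          with (w i * (sgn (z i) * Series (fun l => B i l * z l)) - D i * w i * (sgn (z i) * z i)
                + w i * (sgn (z i) * Phi t i)) by ring.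
        rewrite sgn_mult. apply Rplus_le_compat.
        + unfold Rminus. apply Rplus_le_compat_r.
          apply Rmult_le_compat_l; [apply Rlt_le, Hw|].
          eapply Rle_trans; [apply sgn_le|]. apply Series_abs_le; [|apply E4].
          intros l. rewrite Rabs_mult, (Rabs_pos_eq (B i l)) by apply HB. lra.
        + apply Rmult_le_compat_l; [apply Rlt_le, Hw|apply sgn_le].
      - apply is_series_sm, Series_correct.
        apply (ex_series_dom _ (fun i => w i * Rabs (du t i))); [|now apply du_ex].
        intros i. rewrite !Rabs_mult, sgn_abs, (Rabs_pos_eq (w i)) by apply Rlt_le, Hw. lra.
      - apply is_series_sm. exact HS. }
    fold z in HP.
    assert (HLM : L * Series (fun i => wal i * Rabs (z i))
      <= M * Nm t + c / 2 * Series (fun i => wT i * Rabs (z i))).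
    { unfold Nm. fold z.
      assert (HS2 := is_seriesR_plus _ _ _ _ (is_seriesR_scal M _ _ (Series_correct _ (u_ex_w t Ht')))
        (is_seriesR_scal (c / 2) _ _ (Series_correct _ (u_ex_wT t Ht)))).
      fold z in HS2.
      rewrite <- (is_series_unique _ _ HS2). rewrite <- Series_scal_l.
      apply Series_le; [|eexists; exact HS2]. intros i. split.
      - apply Rmult_le_pos; [exact HL|].
        apply Rmult_le_pos; [now apply Rlt_le, wal_pos|apply Rabs_pos].
      - rewrite <- !Rmult_assoc, <- Rmult_plus_distr_r.
        apply Rmult_le_compat_r; [apply Rabs_pos|apply HM]. }
    fold z. lra.
Qed.

(** The sign is frozen at the later time [t]: there it gives [Rabs (u t i)] exactly, and at the
    earlier time [s] a lower bound for [Rabs (u s i)]. This is why the estimate is from the left. *)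
Lemma Nm_Dini M t : 0 < t < T ->
  ex_series (fun i => w i * (sgn (u t i) * du t i)) ->
  Series (fun i => w i * (sgn (u t i) * du t i)) <= M * Nm t ->
  forall eps, 0 < eps -> exists delta, 0 < delta /\
     forall s, 0 < s < t -> t - s < delta -> Nm t - Nm s <= (t - s) * (M * Nm t + eps).
Proof.
  intros Ht Hrex Hr eps He.
  destruct (u_deriv t Ht eps He) as [d [Hd0 Hd]].
  exists d. split; [exact Hd0|]. intros s Hs Hsd.
  assert (Hs1 : 0 < s < T) by lra. assert (Hs2 : s <> t) by lra.
  assert (Hs3 : Rabs (s - t) < d) by (rewrite Rabs_minus_sym, Rabs_pos_eq; lra).
  destruct (Hd s Hs1 Hs2 Hs3) as [Hrx Hrd].
  assert (Hst : s - t <> 0) by lra.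
  set (r i := (u s i - u t i) / (s - t) - du t i).
  change (ex_series (fun i => w i * Rabs (r i))) in Hrx.
  assert (Ht' : 0 <= t <= T) by lra. assert (Hs' : 0 <= s <= T) by lra.
  pose proof (is_seriesR_minus _ _ _ _ (is_seriesR_minus _ _ _ _
    (Series_correct _ (u_ex_w t Ht')) (is_seriesR_scal (t - s) _ _ (Series_correct _ Hrex)))
    (is_seriesR_scal (t - s) _ _ (Series_correct _ Hrx))) as HS.
  assert (Hle : Nm t - (t - s) * Series (fun i => w i * (sgn (u t i) * du t i))
       - (t - s) * Series (fun i => w i * Rabs (r i)) <= Nm s).
  { apply (is_lim_seq_le _ (sm (fun i => w i * Rabs (u s i))) (Finite _) (Nm s))
      with (2 := proj1 (is_series_sm _ _) HS).
    - intros n. apply sm_le. intros i _.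
      replace (w i * Rabs (u t i) - (t - s) * (w i * (sgn (u t i) * du t i))
         - (t - s) * (w i * Rabs (r i)))
        with (w i * (Rabs (u t i) - (t - s) * (sgn (u t i) * du t i) - (t - s) * Rabs (r i))) by ring.
      apply Rmult_le_compat_l; [apply Rlt_le, Hw|].
      eapply Rle_trans; [|apply (sgn_le (u t i))].
      assert (Eu : u s i = u t i - (t - s) * du t i - (t - s) * r i).
      { unfold r. field. exact Hst. }
      rewrite Eu, <- sgn_mult.
      pose proof (sgn_le (u t i) (r i)) as H1.
      assert (H2 : (t - s) * (sgn (u t i) * r i) <= (t - s) * Rabs (r i))
        by (apply Rmult_le_compat_l; lra).
      lra.
    - apply is_series_sm, Series_correct, u_ex_w, Hs'. }
  assert (H1 : (t - s) * Series (fun i => w i * (sgn (u t i) * du t i)) <= (t - s) * (M * Nm t))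
    by (apply Rmult_le_compat_l; lra).
  assert (H2 : (t - s) * Series (fun i => w i * Rabs (r i)) <= (t - s) * eps)
    by (apply Rmult_le_compat_l; [lra|apply Rlt_le, Hrd]).
  rewrite Rmult_plus_distr_l.
  apply Rplus_le_reg_r with (Nm s). unfold Rminus.
  rewrite Rplus_assoc, Rplus_opp_l, Rplus_0_r.
  clear - Hle H1 H2. lra.
Qed.

Theorem strong_solution_unique t i : 0 <= t <= T -> z1 t i = z2 t i.
Proof.
  intros Ht. destruct Phi_bound as [L [HL HPhi]].
  destruct (wa_absorb L HL) as [M [HM0 HM]].
  assert (HN : Nm (clamp T t) <= 0).
  { apply (left_Dini_Gronwall (fun t => Nm (clamp T t)) M T HM0); [| | |exact Ht].
    - intros r. apply (norm_clamp_continuous w u T r HT Hw u_ex_w u_cont).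
    - rewrite clamp_id by lra. unfold Nm. rewrite (Series_support _ 0).
      + simpl. unfold u. rewrite Hinit, Rminus_diag, Rabs_R0. lra.
      + intros n _. unfold u. rewrite Hinit, Rminus_diag, Rabs_R0. ring.
    - intros r Hr eps He. assert (Hr' : 0 <= r <= T) by lra.
      destruct (HPhi r Hr') as [P1 P2].
      destruct (energy_rate L M r HL HM Hr P1 P2) as [X1 X2].
      destruct (Nm_Dini M r Hr X1 X2 eps He) as [del [Hd0 Hd]].
      exists del. split; [exact Hd0|]. intros v Hv Hvr.
      rewrite !clamp_id by lra. now apply Hd. }
  rewrite clamp_id in HN by exact Ht.
  assert (H : w i * Rabs (u t i) <= Nm t).
  { apply (Series_term_le (fun i => w i * Rabs (u t i))); [|now apply u_ex_w].
    intros n. apply Rmult_le_pos; [apply Rlt_le, Hw|apply Rabs_pos]. }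
  destruct (Req_dec (u t i) 0) as [E|E]; [unfold u in E; lra|]. apply Rabs_pos_lt in E.
  pose proof (Rmult_lt_0_compat _ _ (Hw i) E). lra.
Qed.

End Uniqueness.

End AbstractEquation.

(** * Index shift and comparison of powers *)

Lemma sum_n_m_shift (f : nat -> R) m : sum_n_m f 1 (S m) = sm (fun l => f (S l)) m.
Proof.
  induction m as [|m IH]; [apply (sum_n_n f 1)|].
  rewrite sum_n_Sm by lia. rewrite IH. reflexivity.
Qed.

(** The tangent to the exponential at [r * y] lies below it at [y] and at 0; the two inequalities
    are averaged with weights [r] and [1 - r]. *)
Lemma exp_convex_0 r y : 0 <= r <= 1 -> exp (r * y) <= r * exp y + (1 - r).
Proof.
  intros Hr. set (z := r * y).
  assert (H1 : exp z * (1 + (y - z)) <= exp y).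
  { replace (exp y) with (exp z * exp (y - z)) by (rewrite <- exp_plus; f_equal; ring).
    apply Rmult_le_compat_l; [apply Rlt_le, exp_pos|apply exp_ineq1_le]. }
  assert (H2 : exp z * (1 + - z) <= 1).
  { replace 1 with (exp z * exp (- z)) at 2
      by (rewrite <- exp_plus, Rplus_opp_r, exp_0; reflexivity).
    apply Rmult_le_compat_l; [apply Rlt_le, exp_pos|apply exp_ineq1_le]. }
  apply (Rmult_le_compat_l r) in H1; [|lra].
  apply (Rmult_le_compat_l (1 - r)) in H2; [|lra].
  replace (exp z) with (r * (exp z * (1 + (y - z))) + (1 - r) * (exp z * (1 + - z))).
  - lra.
  - unfold z. ring.
Qed.

(** With [ln x <= 0], the case [q0 <= q] is monotonicity with factor 1. Otherwise [q * ln x] is the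
    fraction [q / q0] of [q0 * ln x], and convexity of the exponential gives that factor. *)
Lemma one_minus_Rpower_compare x q q0 : 0 < x <= 1 -> 0 < q -> 0 < q0 ->
  Rmin 1 (q / q0) * (1 - Rpower x q0) <= 1 - Rpower x q.
Proof.
  intros Hx Hq Hq0.
  assert (Hln : ln x <= 0).
  { destruct (Req_dec x 1) as [->|H]; [rewrite ln_1; lra|].
    rewrite <- ln_1. apply Rlt_le, ln_increasing; lra. }
  assert (Hle1 : forall r, 0 < r -> Rpower x r <= 1).
  { intros r Hr. unfold Rpower. rewrite <- exp_0.
    destruct (Req_dec (ln x) 0) as [->|H]; [rewrite Rmult_0_r; lra|].
    apply Rlt_le, exp_increasing. nra. }
  pose proof (Hle1 q0 Hq0).
  destruct (Rle_dec q0 q) as [H1|H1].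
  - apply Rle_trans with (1 * (1 - Rpower x q0)).
    + apply Rmult_le_compat_r; [lra|apply Rmin_l].
    + assert (Rpower x q <= Rpower x q0); [|lra].
      unfold Rpower. destruct (Req_dec (q * ln x) (q0 * ln x)) as [->|H2]; [lra|].
      apply Rlt_le, exp_increasing.
      assert (q * ln x <= q0 * ln x); [|lra]. nra.
  - apply Rle_trans with (q / q0 * (1 - Rpower x q0)).
    + apply Rmult_le_compat_r; [lra|apply Rmin_r].
    + assert (Hr : 0 <= q / q0 <= 1).
      { split; [apply Rlt_le, Rdiv_lt_0_compat; lra|].
        apply Rmult_le_reg_r with q0; [exact Hq0|].
        unfold Rdiv. rewrite Rmult_assoc, Rinv_l by lra. lra. }
      pose proof (exp_convex_0 (q / q0) (q0 * ln x) Hr) as HE.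
      replace (q / q0 * (q0 * ln x)) with (q * ln x) in HE by (field; lra).
      unfold Rpower. lra.
Qed.

(** * The growth-decay-fragmentation-coagulation model *)

Section Model.
Variables (a g d s : nat -> R) (b k : nat -> nat -> R) (kappa alpha p : R).
Hypothesis Hg : forall i, 0 <= g i.
Hypothesis Hd : forall i, 0 <= d i.
Hypothesis Hs : forall i, 0 <= s i.
Hypothesis Ha : forall i, 0 <= a i.
Hypothesis Hb : forall i j, 0 <= b i j.
Hypothesis Ha2 : forall i, (2 <= i)%nat -> 0 < a i.
Hypothesis Hbij : forall i j, (j <= i)%nat -> b i j = 0.
Hypothesis Hbsum : forall j, (2 <= j)%nat ->
  sum_n_m (fun i => INR i * b i j) 1 (j - 1) = INR j.
Hypothesis HA : exists p0, 1 < p0 /\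
     Rbar_lt 0 (LimInf_seq (fun i =>
       (a i / theta a g d s i) * (DeltaP b p0 i / Rpower (INR i) p0))).
Hypothesis Hp : 1 < p.
Hypothesis Hg0 : g 0%nat = 0.
Hypothesis Hk : forall i j, 0 <= k i j.
Hypothesis Hkappa : 0 < kappa.
Hypothesis Halpha : 0 < alpha < 1.
Hypothesis HK : forall i j, (1 <= i)%nat -> (1 <= j)%nat ->
     k i j <= kappa * (Rpower (1 + theta a g d s i) alpha
                       + Rpower (1 + theta a g d s j) alpha).

(* From here on a sequence (f_i), i >= 1, is stored with its index lowered by one. *)
Definition wgt (n : nat) : R := wp p (S n).
Definition tht (n : nat) : R := theta a g d s (S n).
(** Column [n] records where clusters of size [S n] go: up by growth, down by decay, to smaller
    sizes by fragmentation. Writing the decay condition as [n = S l] sends nothing anywhere from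
    size 1. *)
Definition mat (l n : nat) : R :=
  kron l (S n) * g (S n) + kron n (S l) * d (S n) + a (S n) * b (S l) (S n).

Lemma wgt_pos n : 0 < wgt n.
Proof. apply exp_pos. Qed.

Lemma INR_S_ge1 n : 1 <= INR (S n).
Proof. rewrite S_INR. pose proof (pos_INR n). lra. Qed.

Lemma wgt_ge1 n : 1 <= wgt n.
Proof.
  unfold wgt, wp. rewrite <- (Rpower_O (INR (S n))).
  - apply Rle_Rpower; [apply INR_S_ge1|lra].
  - pose proof (INR_S_ge1 n); lra.
Qed.

Lemma tht_ge0 n : 0 <= tht n.
Proof.
  unfold tht, theta. pose proof (Ha (S n)). pose proof (Hg (S n)).
  pose proof (Hd (S n)). pose proof (Hs (S n)). lra.
Qed.

Lemma mat_ge0 l n : 0 <= mat l n.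
Proof.
  unfold mat. repeat apply Rplus_le_le_0_compat; apply Rmult_le_pos; auto using kron_ge0.
Qed.

(** * Dissipativity of the columns from assumption (A) *)

Definition frag (q : R) (n : nat) : R :=
  sum_n_m (fun i => Rpower (INR i) q * b i (S n)) 1 n.

Lemma frag_sm q n I : sm (fun l => Rpower (INR (S l)) q * b (S l) (S n)) I <= frag q n.
Proof.
  unfold frag. destruct n as [|m].
  - rewrite sum_n_m_zero by lia. rewrite sm_zero; [apply Rle_refl|].
    intros l _. rewrite Hbij by lia. ring.
  - rewrite sum_n_m_shift. apply sm_support_le.
    + intros l. apply Rmult_le_pos; [apply Rlt_le, exp_pos|apply Hb].
    + intros l Hl. rewrite Hbij by lia. ring.
Qed.

Lemma DeltaP_frag q n : DeltaP b q (S n) = Rpower (INR (S n)) q - frag q n.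
Proof. unfold DeltaP, frag. simpl Nat.sub. now rewrite Nat.sub_0_r. Qed.

(** By conservation of mass the numbers [INR (S l) / INR j * b (S l) j] are weights of total 1, so
    the normalized [DeltaP] is an average of [1 - x ^ (q - 1)] over relative sizes [x]. In this form
    different exponents can be compared term by term. *)
Lemma DeltaP_normalized q m : let j := S (S m) in
  DeltaP b q j / Rpower (INR j) q =
  sm (fun l => (INR (S l) / INR j) * b (S l) j * (1 - Rpower (INR (S l) / INR j) (q - 1))) m.
Proof.
  intros j. assert (Hj : 0 < INR j) by apply lt_0_INR, Nat.lt_0_succ.
  unfold j. rewrite DeltaP_frag. fold j. unfold frag. rewrite sum_n_m_shift.
  assert (Hone : 1 = sm (fun l => INR (S l) / INR j * b (S l) j) m).
  { assert (Hj2 : (2 <= j)%nat) by (unfold j; lia).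
    pose proof (Hbsum j Hj2) as H. unfold j in H. simpl Nat.sub in H.
    rewrite sum_n_m_shift in H. fold j in H.
    rewrite (sm_ext _ (fun l => / INR j * (INR (S l) * b (S l) j))).
    - rewrite sm_scal, H. field. lra.
    - intros; field. lra. }
  assert (Hpos : 0 < Rpower (INR j) q) by apply exp_pos.
  transitivity (1 - sm (fun l => / Rpower (INR j) q * (Rpower (INR (S l)) q * b (S l) j)) m).
  { rewrite sm_scal. unfold j. field. fold j. lra. }
  rewrite Hone at 1. rewrite <- sm_minus. apply sm_ext. intros l _.
  assert (Hl : 0 < INR (S l)) by (pose proof (INR_S_ge1 l); lra).
  assert (Hx : 0 < INR (S l) / INR j) by now apply Rdiv_lt_0_compat.
  replace (Rpower (INR (S l)) q) with
    (Rpower (INR j) q * (INR (S l) / INR j * Rpower (INR (S l) / INR j) (q - 1))).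
  - field. lra.
  - rewrite <- (Rpower_1 (INR (S l) / INR j)) at 1 by exact Hx.
    rewrite <- Rpower_plus. replace (1 + (q - 1)) with q by ring.
    rewrite Rpower_mult_distr by assumption. f_equal. field. lra.
Qed.

Lemma DeltaP_compare p0 m : 1 < p0 -> let j := S (S m) in
  Rmin 1 ((p - 1) / (p0 - 1)) * (DeltaP b p0 j / Rpower (INR j) p0)
    <= DeltaP b p j / Rpower (INR j) p.
Proof.
  intros Hp0 j. unfold j. rewrite !DeltaP_normalized. fold j.
  rewrite <- sm_scal. apply sm_le. intros l Hl.
  assert (Hl0 : 0 < INR (S l)) by (pose proof (INR_S_ge1 l); lra).
  assert (Hj : 0 < INR j) by apply lt_0_INR, Nat.lt_0_succ.
  assert (Hlj : INR (S l) <= INR j) by (apply le_INR; unfold j; lia).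
  assert (Hx : 0 < INR (S l) / INR j <= 1).
  { split; [now apply Rdiv_lt_0_compat|].
    apply Rmult_le_reg_r with (INR j); [exact Hj|].
    unfold Rdiv. rewrite Rmult_assoc, Rinv_l by lra. lra. }
  rewrite <- Rmult_assoc, (Rmult_comm (Rmin _ _)), Rmult_assoc.
  apply Rmult_le_compat_l; [apply Rmult_le_pos; [lra|apply Hb]|].
  apply one_minus_Rpower_compare; [exact Hx|lra|lra].
Qed.

Lemma fragmentation_dominates : exists c1 N, 0 < c1 /\ forall n, (N <= n)%nat ->
  c1 * (tht n * wgt n) <= a (S n) * (wgt n - frag p n).
Proof.
  destruct HA as [p0 [Hp0 Hlim]].
  set (v i := a i / theta a g d s i * (DeltaP b p0 i / Rpower (INR i) p0)) in *.
  assert (Hev : exists c0 N0, 0 < c0 /\ forall i, (N0 <= i)%nat -> c0 <= v i).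
  { destruct (ex_LimInf_seq v) as [l Hl].
    assert (E : LimInf_seq v = l) by now apply is_LimInf_seq_unique.
    rewrite E in Hlim. destruct l as [l| |]; simpl in Hlim; [| |contradiction].
    - assert (Hl2 : 0 < l / 2) by lra.
      destruct (Hl (mkposreal _ Hl2)) as [_ [N0 HN0]]. simpl in HN0.
      exists (l / 2), N0. split; [exact Hl2|]. intros i Hi. specialize (HN0 i Hi). lra.
    - destruct (Hl 1) as [N0 HN0]. exists 1, N0. split; [lra|].
      intros i Hi. apply Rlt_le, HN0, Hi. }
  destruct Hev as [c0 [N0 [Hc0 HN0]]].
  set (mm := Rmin 1 ((p - 1) / (p0 - 1))).
  assert (Hmm : 0 < mm) by (apply Rmin_glb_lt; [lra|apply Rdiv_lt_0_compat; lra]).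
  (* [S N0] excludes [n = 0]: only sizes from 2 on have positive [a] and conserve mass in
     fragmentation. *)
  exists (mm * c0), (S N0). split; [now apply Rmult_lt_0_compat|].
  intros n Hn. destruct n as [|m]; [lia|].
  assert (Hi : (N0 <= S (S m))%nat) by lia.
  specialize (HN0 _ Hi). unfold v in HN0.
  pose proof (DeltaP_compare p0 m Hp0) as HC. cbv zeta in HC. fold mm in HC.
  rewrite (DeltaP_frag p) in HC. unfold wgt, wp, tht in *.
  set (j := S (S m)) in *.
  set (th := theta a g d s j) in *.
  assert (Hth : 0 < th).
  { assert (Hj2 : (2 <= j)%nat) by (unfold j; lia).
    unfold th, theta. pose proof (Ha2 j Hj2). pose proof (Hg j). pose proof (Hd j). pose proof (Hs j). lra. }
  assert (HW : 0 < Rpower (INR j) p) by apply exp_pos.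
  set (W := Rpower (INR j) p) in *. set (X := DeltaP b p0 j / Rpower (INR j) p0) in *.
  assert (H1 : c0 * th <= a j * X).
  { apply (Rmult_le_compat_r th) in HN0; [|lra].
    replace (a j / th * X * th) with (a j * X) in HN0 by (field; lra). exact HN0. }
  assert (H2 : mm * X * W <= W - frag p (S m)).
  { apply (Rmult_le_compat_r W) in HC; [|lra].
    replace ((W - frag p (S m)) / W * W) with (W - frag p (S m)) in HC by (field; lra).
    exact HC. }
  apply Rle_trans with (a j * (mm * X * W)).
  - replace (mm * c0 * (th * W)) with (mm * W * (c0 * th)) by ring.
    replace (a j * (mm * X * W)) with (mm * W * (a j * X)) by ring.
    apply Rmult_le_compat_l; [apply Rmult_le_pos; lra|exact H1].
  - apply Rmult_le_compat_l; [apply Ha|exact H2].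
Qed.

(** Growth moves clusters to a larger weight. For large sizes the relative increase is below any
    [del], so the excess can be absorbed by fragmentation. *)
Lemma wgt_ratio del : 0 < del -> exists N, forall n, (N <= n)%nat -> wgt (S n) <= (1 + del) * wgt n.
Proof.
  intros Hdel. set (r := Rpower (1 + del) (/ p) - 1).
  assert (Hr : 0 < r).
  { unfold r. assert (1 < Rpower (1 + del) (/ p)); [|lra].
    apply Rle_lt_trans with (Rpower (1 + del) 0); [rewrite Rpower_O; lra|].
    apply Rpower_lt; [lra|].
    apply Rinv_0_lt_compat; lra. }
  destruct (nfloor_ex (/ r)) as [N [_ HN]]; [apply Rlt_le, Rinv_0_lt_compat, Hr|].
  exists N. intros n Hn. unfold wgt, wp.
  assert (Hj : 0 < INR (S n)) by (pose proof (INR_S_ge1 n); lra).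
  assert (Hj2 : INR N + 1 <= INR (S n)) by (rewrite S_INR; apply le_INR in Hn; lra).
  assert (H1 : INR (S (S n)) <= (1 + r) * INR (S n)).
  { rewrite (S_INR (S n)).
    assert (1 <= r * INR (S n)); [|lra].
    replace 1 with (r * / r) by (field; lra).
    apply Rmult_le_compat_l; lra. }
  apply Rle_trans with (Rpower ((1 + r) * INR (S n)) p).
  - apply Rle_Rpower_l; [lra|]. split; [pose proof (INR_S_ge1 (S n)); lra|exact H1].
  - rewrite <- Rpower_mult_distr by lra. apply Rmult_le_compat_r; [apply Rlt_le, exp_pos|].
    replace (1 + r) with (Rpower (1 + del) (/ p)) by (unfold r; ring).
    rewrite Rpower_mult, Rinv_l, Rpower_1 by lra. lra.
Qed.

Lemma mat_column n I :
  sm (fun l => wgt l * mat l n) I <= wgt (S n) * g (S n) + wgt n * d (S n) + a (S n) * frag p n.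
Proof.
  rewrite (sm_ext _ (fun l => (wgt l * g (S n) * kron l (S n) + wgt l * d (S n) * kron n (S l))
     + a (S n) * (wgt l * b (S l) (S n)))) by (intros; unfold mat; ring).
  rewrite !sm_plus, sm_scal. repeat apply Rplus_le_compat.
  - apply (sm_kron_le (fun l => wgt l * g (S n))).
    intros; apply Rmult_le_pos; [apply Rlt_le, wgt_pos|apply Hg].
  - destruct n as [|m].
    + rewrite sm_zero; [apply Rmult_le_pos; [apply Rlt_le, wgt_pos|apply Hd]|].
      intros l _. rewrite kron_diff by lia. ring.
    + apply Rle_trans with (wgt m * d (S (S m))).
      * rewrite (sm_ext _ (fun l => wgt l * d (S (S m)) * kron l m)).
        -- apply (sm_kron_le (fun l => wgt l * d (S (S m)))).
           intros; apply Rmult_le_pos; [apply Rlt_le, wgt_pos|apply Hd].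
        -- intros l _. f_equal. unfold kron. do 2 destruct Nat.eq_dec; congruence || lia.
      * apply Rmult_le_compat_r; [apply Hd|]. apply Rle_Rpower_l; [lra|].
        split; [pose proof (INR_S_ge1 m); lra|]. apply le_INR; lia.
  - apply Rmult_le_compat_l; [apply Ha|]. apply frag_sm.
Qed.

(** In large columns fragmentation yields a surplus [c1]: one half covers the extra weight caused by
    growth, the other half is [c]. The finitely many remaining columns are covered by [om]. *)
Lemma column_dissipativity : exists c om, 0 < c /\ 0 <= om /\ forall n I,
  sm (fun l => wgt l * mat l n) I + c * ((1 + tht n) * wgt n) <= (tht n + om) * wgt n.
Proof.
  destruct fragmentation_dominates as [c1 [N1 [Hc1 HN1]]].
  assert (Hc12 : 0 < c1 / 2) by lra.
  destruct (wgt_ratio (c1 / 2) Hc12) as [N2 HN2].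
  set (c := c1 / 2). assert (Hc0 : 0 < c) by exact Hc12.
  (* Bounds the left-hand side relative to [wgt n]; in small columns [om] dominates it outright. The
     additional [c] in [om] pays for the 1 in [1 + tht n] in the large columns. *)
  set (K n := (wgt (S n) * g (S n) + wgt n * d (S n) + a (S n) * frag p n) / wgt n
              + c * (1 + tht n)).
  set (om := c + sm (fun n => Rabs (K n)) (N1 + N2)).
  assert (Hsm : 0 <= sm (fun n => Rabs (K n)) (N1 + N2)).
  { apply sm_ge0. intros; apply Rabs_pos. }
  exists c, om. split; [exact Hc12|split; [unfold om, c; lra|]].
  intros n I. pose proof (wgt_pos n) as HW. pose proof (tht_ge0 n) as Ht.
  pose proof (mat_column n I) as HM.
  destruct (Nat.le_gt_cases (N1 + N2) n) as [Hn|Hn].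
  - assert (Hn1 : (N1 <= n)%nat) by lia. assert (Hn2 : (N2 <= n)%nat) by lia.
    specialize (HN1 n Hn1). specialize (HN2 n Hn2). fold c in HN2.
    assert (H1 : wgt (S n) * g (S n) <= (1 + c) * wgt n * g (S n))
      by (apply Rmult_le_compat_r; [apply Hg|exact HN2]).
    assert (H2 : c * wgt n * g (S n) <= c * wgt n * tht n).
    { apply Rmult_le_compat_l; [apply Rmult_le_pos; lra|].
      unfold tht, theta. pose proof (Ha (S n)). pose proof (Hd (S n)). pose proof (Hs (S n)). lra. }
    assert (H3 : (g (S n) + d (S n) + a (S n)) * wgt n <= tht n * wgt n).
    { apply Rmult_le_compat_r; [lra|]. unfold tht, theta. pose proof (Hs (S n)). lra. }
    assert (H4 : c * wgt n <= om * wgt n) by (apply Rmult_le_compat_r; unfold om; lra).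
    unfold c in *. lra.
  - assert (HKn : K n <= om).
    { eapply Rle_trans; [apply Rle_abs|].
      eapply Rle_trans; [apply (sm_term_le (fun n => Rabs (K n)) (N1 + N2) n)|].
      - intros; apply Rabs_pos.
      - lia.
      - unfold om, c. lra. }
    apply (Rmult_le_compat_r (wgt n)) in HKn; [|lra].
    replace (K n * wgt n) with (wgt (S n) * g (S n) + wgt n * d (S n) + a (S n) * frag p n
       + c * ((1 + tht n) * wgt n)) in HKn by (unfold K; field; lra).
    assert (0 <= tht n * wgt n) by (apply Rmult_le_pos; lra). lra.
Qed.

Lemma mat_series (f : nat -> R) n :
  ex_series (fun l => mat n l * f (S l)) ->
  ex_series (fun m => a (S n + 1 + m)%nat * b (S n) (S n + 1 + m)%nat * f (S n + 1 + m)%nat) /\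
  Yop a g d s b f (S n) = - tht n * f (S n) + Series (fun l => mat n l * f (S l)).
Proof.
  intros Hex.
  assert (Hgs : is_series (fun l => kron n (S l) * (g (S l) * f (S l)))
    (g (S n - 1)%nat * f (S n - 1)%nat)).
  { destruct n as [|m].
    (* For size 1 the growth term of [Yop] refers to index 0, where [g] vanishes; the matrix has no
       such entry. *)
    - simpl Nat.sub. rewrite Hg0, Rmult_0_l.
      apply is_series_sm. apply is_lim_seq_ext with (fun _ => 0); [|apply is_lim_seq_const].
      intros N. rewrite sm_zero; [reflexivity|]. intros l _. rewrite kron_diff by lia. ring.
    - simpl Nat.sub. apply (is_series_ext (fun l => kron m l * (g (S l) * f (S l)))).
      + intros l. f_equal. unfold kron. do 2 destruct Nat.eq_dec; congruence || lia.
      + apply (is_series_kron (fun l => g (S l) * f (S l))). }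
  assert (Hds : is_series (fun l => kron l (S n) * (d (S l) * f (S l)))
    (d (S (S n)) * f (S (S n)))).
  { apply (is_series_ext (fun l => kron (S n) l * (d (S l) * f (S l)))).
    - intros l. now rewrite kron_sym.
    - apply (is_series_kron (fun l => d (S l) * f (S l))). }
  pose proof (is_seriesR_minus _ _ _ _ (is_seriesR_minus _ _ _ _
    (Series_correct _ Hex) Hgs) Hds) as HF.
  assert (HF' : is_series (fun l => a (S l) * b (S n) (S l) * f (S l))
    (Series (fun l => mat n l * f (S l)) - g (S n - 1)%nat * f (S n - 1)%nat
     - d (S (S n)) * f (S (S n)))).
  { eapply is_series_ext; [|exact HF]. intros l. unfold mat. eqR; ring. }
  assert (Hidx : forall m, a (S (S n + m)) * b (S n) (S (S n + m)) * f (S (S n + m))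
     = a (S n + 1 + m)%nat * b (S n) (S n + 1 + m)%nat * f (S n + 1 + m)%nat).
  { intros m. now replace (S n + 1 + m)%nat with (S (S n + m)) by lia. }
  split.
  - apply (ex_series_ext _ _ Hidx).
    apply (ex_series_incr_n (fun l => a (S l) * b (S n) (S l) * f (S l)) (S n)).
    eexists; exact HF'.
  - unfold Yop. fold (tht n). rewrite <- (Series_ext _ _ Hidx).
    pose proof (Series_incr_n (fun l => a (S l) * b (S n) (S l) * f (S l)) (S n)
      (Nat.lt_0_succ n) (ex_intro _ _ HF')) as HI.
    rewrite (is_series_unique _ _ HF') in HI. simpl Nat.pred in HI.
    (* The first [S n] terms come from sizes up to [S n] and vanish by [Hbij], which aligns the full
       row with the series in [Yop]. *)
    rewrite (sm_zero (fun l => a (S l) * b (S n) (S l) * f (S l))) in HI.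
    2:{ intros l Hl. rewrite Hbij by lia. ring. }
    rewrite Rplus_0_l in HI. rewrite <- HI. ring.
Qed.

(** * The coagulation terms *)

Let Th (n : nat) : R := 1 + tht n.
Let ra (n : nat) : R := Rpower (Th n) alpha.
Let Wa : nat -> R := wal wgt Th alpha.
Let wT (n : nat) : R := Th n * wgt n.

Lemma Th_ge1 n : 1 <= Th n.
Proof. unfold Th. pose proof (tht_ge0 n). lra. Qed.

Lemma ra_range n : 1 <= ra n <= Th n.
Proof.
  pose proof (Th_ge1 n). unfold ra. split.
  - rewrite <- (Rpower_O (Th n)) by lra. apply Rle_Rpower; lra.
  - rewrite <- (Rpower_1 (Th n)) at 2 by lra. apply Rle_Rpower; lra.
Qed.

Let Wa_pos n : 0 < Wa n := wal_pos wgt Th alpha wgt_pos n.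

Let wT_pos n : 0 < wT n.
Proof. apply Rmult_lt_0_compat; [pose proof (Th_ge1 n); lra|apply wgt_pos]. Qed.

(** Bilinear, so that differences can be expanded. With lowered indices, [m - l] and [l] stand for
    sizes adding up to [S (S m)], stored at [S m]; nothing coagulates into size 1. *)
Definition gain (x y : nat -> R) (n : nat) : R :=
  match n with
  | O => 0
  | S m => sm (fun l => k (S (m - l)) (S l) * (x (m - l)%nat * y l)) m
  end.

Definition ksum (y : nat -> R) (n : nat) : R := Series (fun l => k (S n) (S l) * y l).

Definition loss (x y : nat -> R) (n : nat) : R := x n * ksum y n.

(** Both factors are at least 1, so their sum is at most twice their product. The product form
    splits the kernel between the two sequences. *)
Lemma k_bound i j : k (S i) (S j) <= 2 * kappa * (ra i * ra j).
Proof.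
  eapply Rle_trans; [apply HK; lia|]. change (kappa * (ra i + ra j) <= 2 * kappa * (ra i * ra j)).
  destruct (ra_range i) as [Hi _]. destruct (ra_range j) as [Hj _].
  replace (2 * kappa * (ra i * ra j)) with (kappa * (2 * (ra i * ra j))) by ring.
  apply Rmult_le_compat_l; [lra|]. clear - Hi Hj. nra.
Qed.

(** For sizes at least 1, a sum is at most twice the product; the power [p] is then taken. *)
Lemma W_submult m l : (l <= m)%nat -> wgt (S m) <= Rpower 2 p * (wgt (m - l) * wgt l).
Proof.
  intros Hl. unfold wgt, wp.
  pose proof (INR_S_ge1 (m - l)). pose proof (INR_S_ge1 l).
  rewrite !Rpower_mult_distr by (repeat apply Rmult_lt_0_compat; lra).
  apply Rle_Rpower_l; [lra|]. split; [pose proof (INR_S_ge1 (S m)); lra|].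
  replace (S (S m)) with (S (m - l) + S l)%nat by lia. rewrite plus_INR. nra.
Qed.

Lemma gain_ge0 x y n : (forall i, 0 <= x i) -> (forall i, 0 <= y i) -> 0 <= gain x y n.
Proof.
  intros Hx Hy. destruct n as [|m]; simpl; [lra|].
  apply sm_ge0. intros. repeat apply Rmult_le_pos; auto.
Qed.

Definition Cg : R := Rpower 2 p * (2 * kappa).

(** After [W_submult] and [k_bound] the weighted gain is dominated by the Cauchy product of the two
    weighted sequences, and [Cg] collects their constants. *)
Lemma gain_bnd X Y Kx Ky : bnd Wa X Kx -> bnd Wa Y Ky -> bnd wgt (gain X Y) (Cg * (Kx * Ky)).
Proof.
  intros HX HY. assert (HX0 : forall i, 0 <= X i) by apply HX.
  assert (HY0 : forall i, 0 <= Y i) by apply HY.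
  split; [intros; now apply gain_ge0|]. intros I.
  destruct (bnd_ex Wa X Kx Wa_pos HX) as [EX LX].
  destruct (bnd_ex Wa Y Ky Wa_pos HY) as [EY LY].
  set (AX i := Wa i * X i) in *. set (AY i := Wa i * Y i) in *.
  assert (AX0 : forall i, 0 <= AX i) by (intros; apply Rmult_le_pos; [apply Rlt_le, Wa_pos|apply HX0]).
  assert (AY0 : forall i, 0 <= AY i) by (intros; apply Rmult_le_pos; [apply Rlt_le, Wa_pos|apply HY0]).
  assert (HCg : 0 < Cg) by (apply Rmult_lt_0_compat; [apply exp_pos|lra]).
  assert (HC : is_series (fun m => sm (fun l => AY l * AX (m - l)%nat) m) (Series AY * Series AX)).
  { apply is_series_mult; try (now apply Series_correct).
    - apply (ex_series_ext AY); [intros; now rewrite Rabs_pos_eq|exact EY].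
    - apply (ex_series_ext AX); [intros; now rewrite Rabs_pos_eq|exact EX]. }
  assert (Hterm : forall m, wgt (S m) * gain X Y (S m) <= Cg * sm (fun l => AY l * AX (m - l)%nat) m).
  { intros m. simpl gain. rewrite <- !sm_scal. apply sm_le. intros l Hl.
    apply Rle_trans with ((Rpower 2 p * (wgt (m - l) * wgt l)) *
      ((2 * kappa * (ra (m - l) * ra l)) * (X (m - l)%nat * Y l))).
    - apply Rmult_le_compat; [apply Rlt_le, wgt_pos| |now apply W_submult|].
      + repeat apply Rmult_le_pos; auto.
      + apply Rmult_le_compat_r; [apply Rmult_le_pos; auto|apply k_bound].
    - apply Req_le. unfold AX, AY, Wa, wal, Cg. fold (ra l) (ra (m - l)%nat). ring. }
  assert (Hprod : Series AY * Series AX <= Kx * Ky).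
  { rewrite Rmult_comm. apply Rmult_le_compat; auto; apply Series_ge0; auto. }
  destruct I as [|I].
  - simpl. rewrite Rmult_0_r. apply Rmult_le_pos; [lra|].
    apply Rmult_le_pos; eapply bnd_Kge0; [exact Wa_pos|exact HX|exact Wa_pos|exact HY].
  - rewrite decomp_sum by lia. simpl gain at 1. rewrite Rmult_0_r, Rplus_0_l. simpl Nat.pred.
    apply Rle_trans with (Cg * (Series AY * Series AX)); [|apply Rmult_le_compat_l; lra].
    eapply Rle_trans; [apply sm_le; intros; apply Hterm|].
    rewrite sm_scal. apply Rmult_le_compat_l; [lra|].
    rewrite <- (is_series_unique _ _ HC). apply sm_le_Series.
    + intros m. apply sm_ge0. intros. now apply Rmult_le_pos.
    + eexists; exact HC.
Qed.

Lemma ksum_bound Y Ky n : bnd Wa Y Ky ->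
  ex_series (fun l => k (S n) (S l) * Y l) /\ 0 <= ksum Y n <= 2 * kappa * Ky * ra n.
Proof.
  intros HY. assert (HY0 : forall i, 0 <= Y i) by apply HY.
  destruct (bnd_ex Wa Y Ky Wa_pos HY) as [EY LY].
  assert (Hle : forall l, 0 <= k (S n) (S l) * Y l <= 2 * kappa * ra n * (Wa l * Y l)).
  { intros l. split; [now apply Rmult_le_pos|]. rewrite <- Rmult_assoc.
    apply Rmult_le_compat_r; [apply HY0|]. eapply Rle_trans; [apply k_bound|].
    rewrite Rmult_assoc, (Rmult_assoc (2 * kappa)). pose proof (ra_range n). pose proof (ra_range l).
    rewrite <- !Rmult_assoc.
    apply Rmult_le_compat_l; [repeat apply Rmult_le_pos; lra|].
    unfold Wa, wal. fold (ra l). pose proof (wgt_ge1 l).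
    rewrite <- (Rmult_1_r (ra l)) at 1. apply Rmult_le_compat_l; lra. }
  assert (Hex2 : ex_series (fun l => 2 * kappa * ra n * (Wa l * Y l)))
    by exact (ex_series_scal_l (2 * kappa * ra n) _ EY).
  assert (Hex : ex_series (fun l => k (S n) (S l) * Y l)).
  { apply (ex_series_dom _ (fun l => 2 * kappa * ra n * (Wa l * Y l))); [|exact Hex2].
    intros l. rewrite Rabs_pos_eq; apply Hle. }
  split; [exact Hex|]. split.
  - apply Series_ge0; [apply Hle|exact Hex].
  - eapply Rle_trans; [apply Series_le; [exact Hle|exact Hex2]|].
    rewrite Series_scal_l. replace (2 * kappa * Ky * ra n) with (2 * kappa * ra n * Ky) by ring.
    apply Rmult_le_compat_l; [|exact LY]. pose proof (ra_range n). apply Rmult_le_pos; lra.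
Qed.

Lemma loss_bnd X Y Kx Ky : bnd Wa X Kx -> bnd Wa Y Ky ->
  bnd wgt (loss X Y) (2 * kappa * (Kx * Ky)).
Proof.
  intros HX HY. pose proof (bnd_Kge0 _ _ _ Wa_pos HY) as HKy.
  split.
  - intros i. apply Rmult_le_pos; [apply HX|]. now apply (ksum_bound Y Ky).
  - intros I. eapply Rle_trans; [apply sm_le with (b := fun i => 2 * kappa * Ky * (Wa i * X i))|].
    + intros i _. unfold loss.
      replace (2 * kappa * Ky * (Wa i * X i)) with (wgt i * (X i * (2 * kappa * Ky * ra i)))
        by (unfold Wa, wal, ra; ring).
      apply Rmult_le_compat_l; [apply Rlt_le, wgt_pos|].
      apply Rmult_le_compat_l; [apply HX|]. now apply ksum_bound.
    + rewrite sm_scal. replace (2 * kappa * (Kx * Ky)) with (2 * kappa * Ky * Kx) by ring.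
      apply Rmult_le_compat_l; [apply Rmult_le_pos; lra|apply HX].
Qed.

Lemma Fop_gain_loss (f : nat -> R) n :
  Fop k f (S n) = / 2 * gain (fun m => f (S m)) (fun m => f (S m)) n
                  - loss (fun m => f (S m)) (fun m => f (S m)) n.
Proof.
  unfold Fop. f_equal; [f_equal|].
  - destruct n as [|m].
    + rewrite sum_n_m_zero by lia. reflexivity.
    + replace (S (S m) - 1)%nat with (S m) by lia. rewrite sum_n_m_shift.
      apply sm_ext. intros l Hl.
      replace (S (S m) - S l)%nat with (S (m - l)) by lia. ring.
  - unfold loss, ksum. rewrite <- Series_scal_l. apply Series_ext. intros; ring.
Qed.

Section Shift.
Variable gam : R.
Hypothesis Hgam : 0 <= gam.

(** The last term is cancelled by the diagonal [Dg gam], so the equation itself does not depend on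
    [gam]. *)
Definition coag (x : nat -> R) (n : nat) : R := / 2 * gain x x n - loss x x n + gam * ra n * x n.

Lemma gain_abs x y X Y n : (forall i, Rabs (x i) <= X i) -> (forall i, Rabs (y i) <= Y i) ->
  Rabs (gain x y n) <= gain X Y n.
Proof.
  intros Hx Hy. destruct n as [|m]; simpl; [rewrite Rabs_R0; lra|].
  eapply Rle_trans; [apply sm_abs|]. apply sm_le. intros l _.
  rewrite !Rabs_mult, (Rabs_pos_eq (k _ _)) by apply Hk.
  apply Rmult_le_compat_l; [apply Hk|].
  apply Rmult_le_compat; auto using Rabs_pos.
Qed.

Lemma ksum_ex y Y Ky n : (forall i, Rabs (y i) <= Y i) -> bnd Wa Y Ky ->
  ex_series (fun l => k (S n) (S l) * y l).
Proof.
  intros Hy HY. apply (ex_series_dom _ (fun l => k (S n) (S l) * Y l)).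
  - intros l. rewrite Rabs_mult, (Rabs_pos_eq (k _ _)) by apply Hk.
    apply Rmult_le_compat_l; auto.
  - now apply (ksum_bound Y Ky).
Qed.

Lemma ksum_abs y Y Ky n : (forall i, Rabs (y i) <= Y i) -> bnd Wa Y Ky ->
  Rabs (ksum y n) <= ksum Y n.
Proof.
  intros Hy HY. apply Series_abs_le; [|now apply (ksum_bound Y Ky)].
  intros l. rewrite Rabs_mult, (Rabs_pos_eq (k _ _)) by apply Hk.
  apply Rmult_le_compat_l; auto.
Qed.

Lemma coag_Lipschitz_const_ge0 R0 : 0 <= R0 -> 0 <= (Cg + 4 * kappa) * R0 + gam.
Proof.
  intros HR0. assert (0 < Cg) by (apply Rmult_lt_0_compat; [apply exp_pos|lra]).
  assert (0 <= (Cg + 4 * kappa) * R0) by (apply Rmult_le_pos; lra). lra.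
Qed.

(** Each quadratic term splits into one with the difference in the first slot and one with it in the
    second. The gain contributes [/ 2 * (2 * Cg * R0)], the loss twice [2 * kappa * R0], and the
    linear shift [gam]. *)
Lemma coag_Lipschitz R0 : 0 <= R0 ->
  maj_Lipschitz coag Wa wgt R0 ((Cg + 4 * kappa) * R0 + gam).
Proof.
  intros HR0 K x y HK0 [X [HX Hx]] [Y [HY Hy]] [Z [HZ Hz]].
  exists (fun n => / 2 * (gain Z X n + gain Y Z n) + (loss Z X n + loss Y Z n) + gam * (ra n * Z n)).
  split.
  - replace (((Cg + 4 * kappa) * R0 + gam) * K) with
      (/ 2 * (Cg * (K * R0) + Cg * (R0 * K)) + (2 * kappa * (K * R0) + 2 * kappa * (R0 * K))
        + gam * K) by field.
    apply bnd_plus; [apply bnd_plus|].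
    + apply bnd_scal; [lra|]. apply bnd_plus; now apply gain_bnd.
    + apply bnd_plus; now apply loss_bnd.
    + apply bnd_scal; [exact Hgam|]. split.
      * intros i. apply Rmult_le_pos; [pose proof (ra_range i); lra|apply HZ].
      * intros I. eapply Rle_trans; [|apply (proj2 HZ I)]. apply sm_le. intros i _.
        unfold Wa, wal. fold (ra i). apply Req_le. ring.
  - intros t n. unfold coag.
    set (z := fun i => x t i - y t i).
    assert (Eg : gain (x t) (x t) n - gain (y t) (y t) n = gain z (x t) n + gain (y t) z n).
    { destruct n as [|m]; simpl; [ring|]. rewrite <- sm_minus, <- sm_plus.
      apply sm_ext. intros l _. unfold z. ring. }
    assert (Ek : ksum (x t) n - ksum (y t) n = ksum z n).
    { unfold ksum. rewrite <- Series_minus; [apply Series_ext; intros; unfold z; ring| |].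
      - now apply (ksum_ex _ X R0).
      - now apply (ksum_ex _ Y R0). }
    assert (El : loss (x t) (x t) n - loss (y t) (y t) n = loss z (x t) n + loss (y t) z n).
    { unfold loss. rewrite <- Ek. unfold z. ring. }
    replace (/ 2 * gain (x t) (x t) n - loss (x t) (x t) n + gam * ra n * x t n -
      (/ 2 * gain (y t) (y t) n - loss (y t) (y t) n + gam * ra n * y t n))
      with (/ 2 * (gain z (x t) n + gain (y t) z n) + - (loss z (x t) n + loss (y t) z n)
        + gam * (ra n * z n)).
    2:{ rewrite <- Eg, <- El. unfold z. ring. }
    assert (Hz' : forall i, Rabs (z i) <= Z i) by (intros; apply Hz).
    assert (Hx' : forall i, Rabs (x t i) <= X i) by (intros; apply Hx).
    assert (Hy' : forall i, Rabs (y t i) <= Y i) by (intros; apply Hy).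
    eapply Rle_trans; [apply Rabs_triang|]. apply Rplus_le_compat.
    + eapply Rle_trans; [apply Rabs_triang|]. apply Rplus_le_compat.
      * rewrite Rabs_mult, (Rabs_pos_eq (/ 2)) by lra.
        apply Rmult_le_compat_l; [lra|].
        eapply Rle_trans; [apply Rabs_triang|]. apply Rplus_le_compat; now apply gain_abs.
      * rewrite Rabs_Ropp. eapply Rle_trans; [apply Rabs_triang|].
        apply Rplus_le_compat; unfold loss; rewrite Rabs_mult;
        (apply Rmult_le_compat; [apply Rabs_pos|apply Rabs_pos|auto|]).
        -- now apply (ksum_abs _ _ R0).
        -- now apply (ksum_abs _ _ K).
    + rewrite !Rabs_mult, (Rabs_pos_eq gam), (Rabs_pos_eq (ra n));
        [|pose proof (ra_range n); lra|exact Hgam].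
      apply Rmult_le_compat_l; [exact Hgam|].
      apply Rmult_le_compat_l; [pose proof (ra_range n); lra|auto].
Qed.

(** On the ball the loss rate at [i] is at most [2 * kappa * R0 * ra i], which the shift
    compensates. *)
Lemma coag_pos R0 x : 2 * kappa * R0 <= gam -> (forall i, 0 <= x i) -> bnd Wa x R0 ->
  forall i, 0 <= coag x i.
Proof.
  intros HR Hx HxR i. unfold coag, loss.
  pose proof (gain_ge0 x x i Hx Hx).
  destruct (ksum_bound x R0 i HxR) as [_ [_ H1]].
  apply (Rmult_le_compat_l (x i)) in H1; [|apply Hx].
  assert (H2 : 2 * kappa * R0 * (ra i * x i) <= gam * (ra i * x i)).
  { apply Rmult_le_compat_r; [|exact HR].
    apply Rmult_le_pos; [pose proof (ra_range i); lra|apply Hx]. }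
  lra.
Qed.

Lemma coag_0 i : coag (fun _ => 0) i = 0.
Proof.
  unfold coag, loss. destruct i as [|m]; simpl; [ring|].
  rewrite sm_zero by (intros; ring). ring.
Qed.

End Shift.

(** * Return to the original sequences and weights *)

Lemma wpb_alpha n : wpb a g d s p alpha (S n) = Wa n.
Proof. unfold wpb, Wa, wal. rewrite Rmult_comm. reflexivity. Qed.

Lemma wpb_one n : wpb a g d s p 1 (S n) = wT n.
Proof.
  unfold wpb, wT. rewrite Rpower_1, Rmult_comm; [reflexivity|].
  pose proof (Th_ge1 n). unfold Th, tht in *. lra.
Qed.

Definition Dg (gam : R) (n : nat) : R := tht n + gam * ra n.

Section Generator.
Variables (c om gam : R).
Hypothesis Hc : 0 < c.
Hypothesis Hom : 0 <= om.
Hypothesis Hcol : forall n I,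
  sm (fun l => wgt l * mat l n) I + c * (Th n * wgt n) <= (tht n + om) * wgt n.
Hypothesis Hgam : om <= gam.

Lemma Dg_ge0 n : 0 <= Dg gam n.
Proof.
  unfold Dg. pose proof (tht_ge0 n). pose proof (ra_range n).
  assert (0 <= gam * ra n) by (apply Rmult_le_pos; lra). lra.
Qed.

Lemma Dg_le n : Dg gam n <= (1 + gam) * Th n.
Proof.
  unfold Dg. pose proof (ra_range n).
  assert (gam * ra n <= gam * Th n) by (apply Rmult_le_compat_l; lra).
  unfold Th in *. lra.
Qed.

Lemma Dg_col n I : sm (fun l => wgt l * mat l n) I + c * (Th n * wgt n) <= Dg gam n * wgt n.
Proof.
  eapply Rle_trans; [apply Hcol|]. apply Rmult_le_compat_r; [apply Rlt_le, wgt_pos|].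
  unfold Dg. pose proof (ra_range n).
  assert (gam * 1 <= gam * ra n) by (apply Rmult_le_compat_l; lra). lra.
Qed.

Lemma mat_bnd n : bnd wgt (fun l => mat l n) ((1 + om) * (Th n * wgt n)).
Proof.
  split; [intros; apply mat_ge0|]. intros I. pose proof (Hcol n I).
  pose proof (Th_ge1 n). pose proof (wgt_pos n).
  assert (0 <= c * (Th n * wgt n)) by (repeat apply Rmult_le_pos; lra).
  rewrite <- Rmult_assoc.
  apply Rle_trans with ((tht n + om) * wgt n); [lra|].
  apply Rmult_le_compat_r; [lra|]. unfold Th in *.
  rewrite Rmult_plus_distr_r. pose proof (Rmult_le_compat_l om _ _ Hom H0). lra.
Qed.

End Generator.

(** For uniqueness the shift is [om] itself: it restores the column inequality, and no a priori ball
    has to be known. *)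
Lemma classical_solution_strong T f0 f om : classical_solution a g d s b k p alpha T f0 f ->
  (forall n, bnd wgt (fun l => mat l n) ((1 + om) * (Th n * wgt n))) -> 0 <= om ->
  exists z', strong_solution mat (Dg om) wgt Th alpha (coag om) T
    (fun t n => f t (S n)) z'.
Proof.
  intros [fex [fc [[f' [f'ex [fd [_ feq]]]] _]]] HBcol Hom.
  exists (fun t n => f' t (S n)). split; [|split].
  - intros t Ht. refine (ex_series_ext _ _ _ (fex t Ht)). intros n. now rewrite wpb_alpha.
  - intros t Ht eps He. destruct (fc t Ht eps He) as [del [Hd0 Hdel]].
    exists del. split; [exact Hd0|]. intros u Hu Hut. refine (Rle_lt_trans _ _ _ _ (Hdel u Hu Hut)).
    apply Req_le, Series_ext. intros n. now rewrite wpb_alpha.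
  - intros t Ht. destruct (feq t Ht) as [fex1 feq1].
    assert (HexT : ex_series (fun n => wT n * Rabs (f t (S n)))).
    { refine (ex_series_ext _ _ _ fex1). intros n. now rewrite wpb_one. }
    split; [exact HexT|split; [exact (f'ex t Ht)|split]].
    + intros n.
      assert (HBex : ex_series (fun l => mat n l * f t (S l))).
      { destruct (mat_vec wgt wT (fun n => Rabs (f t (S n))) mat (1 + om)
          (Series (fun n => wT n * Rabs (f t (S n)))) wgt_pos wT_pos) as [Hex _].
        - lra.
        - exact mat_ge0.
        - exact HBcol.
        - apply bnd_of_series; [exact wT_pos|intros; apply Rabs_pos|exact HexT].
        - apply (ex_series_dom _ (fun l => mat n l * Rabs (f t (S l)))); [|apply Hex].
          intros l. rewrite Rabs_mult, (Rabs_pos_eq (mat n l)) by apply mat_ge0. lra. }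
      assert (Hn : (1 <= S n)%nat) by lia.
      rewrite (proj2 (proj2 (feq1 (S n) Hn))).
      rewrite (proj2 (mat_series (f t) n HBex)), Fop_gain_loss.
      unfold coag, Dg. fold (ra n). unfold mat. ring.
    + exact (fd t Ht).
Qed.

Lemma classical_solution_unique T f0 f h : 0 < T ->
  classical_solution a g d s b k p alpha T f0 f ->
  classical_solution a g d s b k p alpha T f0 h ->
  forall t, 0 <= t <= T -> forall i, (1 <= i)%nat -> h t i = f t i.
Proof.
  intros HT Hf Hh t Ht i Hi. destruct i as [|n]; [lia|].
  destruct column_dissipativity as [c [om [Hc [Hom Hcol]]]].
  assert (HBcol := mat_bnd c om Hc Hom Hcol).
  destruct (classical_solution_strong T f0 f om Hf HBcol Hom) as [zf Sf].
  destruct (classical_solution_strong T f0 h om Hh HBcol Hom) as [zh Sh].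
  refine (strong_solution_unique mat (Dg om) wgt Th c (1 + om) alpha mat_ge0 wgt_pos Th_ge1 Hc
    (Dg_col c om om Hom Hcol (Rle_refl om)) (Dg_le om om Hom (Rle_refl om)) Halpha
    (coag om) T _ zh _ zf HT _ Sh Sf _ t n Ht).
  - intros R0 HR0. exists ((Cg + 4 * kappa) * R0 + om). split.
    + now apply coag_Lipschitz_const_ge0.
    + now apply coag_Lipschitz.
  - intros j. destruct Hf as [_ [_ [_ fi]]]. destruct Hh as [_ [_ [_ hi]]].
    rewrite fi, hi by lia. reflexivity.
Qed.

Lemma norm_cont_on_shift P (w v : nat -> R) (x : R -> nat -> R) : (forall n, w (S n) = v n) ->
  norm_cont_on P v x -> cont_on P w (fun t i => x t (pred i)).
Proof.
  intros E H t Ht eps Heps. destruct (H t Ht eps Heps) as [del [Hd0 Hdel]].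
  exists del. split; [exact Hd0|]. intros u Hu Hut. refine (Rle_lt_trans _ _ _ _ (Hdel u Hu Hut)).
  apply Req_le, Series_ext. intros n. now rewrite E.
Qed.

Lemma classical_solution_exists f0 :
  inX (wpb a g d s p alpha) f0 -> (forall i, (1 <= i)%nat -> 0 <= f0 i) ->
  exists T, 0 < T /\ exists f, classical_solution a g d s b k p alpha T f0 f /\ nonneg_on T f /\
    (forall t, 0 < t < T -> inX (wpb a g d s p 1) (f t)) /\
    cont_on (fun t => 0 < t < T) (wpb a g d s p 1) f.
Proof.
  intros Hf0 Hpos.
  destruct column_dissipativity as [c [om [Hc [Hom Hcol]]]].
  set (x0 n := f0 (S n)).
  set (K0 := Series (fun n => Wa n * x0 n)).
  assert (Hx0 : bnd Wa x0 K0).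
  { apply bnd_of_series; [exact Wa_pos|intros; apply Hpos; lia|].
    refine (ex_series_ext _ _ _ Hf0). intros n.
    rewrite wpb_alpha, Rabs_pos_eq; [reflexivity|apply Hpos; lia]. }
  pose proof (bnd_Kge0 _ _ _ Wa_pos Hx0) as HK0.
  (* This is [4 * Cs * K0] with the column bound [CB = 1 + om], hence free of [gam]. *)
  set (R0 := 4 * (1 + (1 + om) / c) * K0).
  assert (HR0 : 0 <= R0).
  { assert (0 < (1 + om) / c) by (apply Rdiv_lt_0_compat; lra).
    unfold R0. repeat apply Rmult_le_pos; lra. }
  (* The first summand gives positivity of [coag] on the ball, the second the column inequality. *)
  set (gam := 2 * kappa * R0 + om).
  assert (HkR : 0 <= 2 * kappa * R0) by (apply Rmult_le_pos; lra).
  assert (Hgam : om <= gam) by (unfold gam; lra).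
  assert (Hgam0 : 0 <= gam) by lra.
  destruct (strong_solution_exists mat (Dg gam) wgt Th c (1 + om) (1 + gam) alpha mat_ge0
    (Dg_ge0 om gam Hom Hgam) wgt_pos Th_ge1 Hc ltac:(lra) ltac:(lra)
    (Dg_col c om gam Hom Hcol Hgam) (mat_bnd c om Hc Hom Hcol) (Dg_le om gam Hom Hgam) Halpha
    (coag gam) x0 K0 R0 ((Cg + 4 * kappa) * R0 + gam)
    (coag_Lipschitz_const_ge0 gam Hgam0 R0 HR0) Hx0 (Rle_refl _) (coag_Lipschitz gam Hgam0 R0 HR0))
    as [T [x [y [HT [[Hxa [Hxac Hxy]] [Hx [Hxi [xm [HxTc [Hyc HBx]]]]]]]]]].
  { intros z Hz HzR. apply (coag_pos gam R0); [unfold gam; lra|exact Hz|exact HzR]. }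
  { intros i. apply coag_0. }
  (* Index 0 receives a copy of the value at size 1. Norms and equations start at index 1, and the
     only reference to index 0, in the growth term, is multiplied by [g 0 = 0]. *)
  set (f t i := x t (pred i)).
  assert (HfT : forall t, 0 < t < T -> inX (wpb a g d s p 1) (f t)).
  { intros t Ht. refine (ex_series_ext _ _ _ (proj1 (Hxy t Ht))). intros n. now rewrite wpb_one. }
  exists T. split; [exact HT|]. exists f. split; [|split; [|split]].
  - split; [|split; [|split]].
    + intros t Ht. refine (ex_series_ext _ _ _ (Hxa t Ht)). intros n. now rewrite wpb_alpha.
    + exact (norm_cont_on_shift _ _ _ _ wpb_alpha Hxac).
    + exists (fun t i => y t (pred i)). split; [|split; [|split]].
      * intros t Ht. exact (proj1 (proj2 (Hxy t Ht))).
      * intros t Ht. exact (proj2 (proj2 (proj2 (Hxy t Ht)))).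
      * exact Hyc.
      * intros t Ht. split; [now apply HfT|]. intros i Hi. destruct i as [|n]; [lia|].
        destruct (mat_series (f t) n (HBx t n Ht)) as [E1 E2].
        split; [exact E1|split].
        -- apply (ex_series_ext (fun m => x t n * (k (S n) (S m) * x t m))).
           { intros m. unfold f; simpl pred. eqR; ring. }
           apply (ex_series_scal_l (x t n) (fun m => k (S n) (S m) * x t m)).
           destruct xm as [X [HX HXx]]. apply (ksum_ex (x t) X R0); auto.
        -- rewrite E2, Fop_gain_loss. simpl pred. rewrite (proj1 (proj2 (proj2 (Hxy t Ht))) n).
           unfold coag, Dg, f. simpl pred. change (fun m => x t m) with (x t). ring.
    + intros i Hi. destruct i as [|n]; [lia|]. apply Hxi.
  - intros t Ht i Hi. apply Hx.
  - exact HfT.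
  - exact (norm_cont_on_shift _ _ _ _ wpb_one HxTc).
Qed.

End Model.

Theorem theorem3p4
  (a g d s : nat -> R) (b k : nat -> nat -> R)
  (Hg : forall i, 0 <= g i) (Hd : forall i, 0 <= d i)
  (Hs : forall i, 0 <= s i) (Ha : forall i, 0 <= a i)
  (Hb : forall i j, 0 <= b i j) (Hk : forall i j, 0 <= k i j)
  (Ha1 : a 1%nat = 0) (Ha2 : forall i, (2 <= i)%nat -> 0 < a i)
  (Hbij : forall i j, (j <= i)%nat -> b i j = 0)
  (Hbsum : forall j, (2 <= j)%nat ->
     sum_n_m (fun i => INR i * b i j) 1 (j - 1) = INR j)
  (Hg0 : g 0%nat = 0)
  (HA : exists p0, 1 < p0 /\
     Rbar_lt 0 (LimInf_seq (fun i =>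
       (a i / theta a g d s i) * (DeltaP b p0 i / Rpower (INR i) p0))))
  (kappa alpha : R) (Hkappa : 0 < kappa) (Halpha : 0 < alpha < 1)
  (HK : forall i j, (1 <= i)%nat -> (1 <= j)%nat ->
     k i j <= kappa * (Rpower (1 + theta a g d s i) alpha
                       + Rpower (1 + theta a g d s j) alpha))
  (p : R) (Hp : 1 < p)
  (f0 : nat -> R) (Hf0 : inX (wpb a g d s p alpha) f0)
  (Hf0pos : forall i, (1 <= i)%nat -> 0 <= f0 i) :
  exists T, 0 < T /\
    (exists f, classical_solution a g d s b k p alpha T f0 f /\ nonneg_on T f /\
       (forall t, 0 < t < T -> inX (wpb a g d s p 1) (f t)) /\
       cont_on (fun t => 0 < t < T) (wpb a g d s p 1) f /\
       (forall h, classical_solution a g d s b k p alpha T f0 h -> nonneg_on T h ->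
          forall t, 0 <= t <= T -> forall i, (1 <= i)%nat -> h t i = f t i)).
Proof.
  destruct (classical_solution_exists a g d s b k kappa alpha p Hg Hd Hs Ha Hb Ha2 Hbij Hbsum HA Hp
    Hg0 Hk Hkappa Halpha HK f0 Hf0 Hf0pos) as [T [HT [f [Hf [Hpos [HfX Hfc]]]]]].
  exists T. split; [exact HT|]. exists f.
  split; [exact Hf|split; [exact Hpos|split; [exact HfX|split; [exact Hfc|]]]].
  intros h Hh _.
  exact (classical_solution_unique a g d s b k kappa alpha p Hg Hd Hs Ha Hb Ha2 Hbij Hbsum HA Hp
    Hg0 Hk Hkappa Halpha HK T f0 f h HT Hf Hh).
Qed.
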